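(* For every integer $d\geq 4$, there exist smooth rational real affine varieties of dimension $d$ which have at least countably infinitely many pairwise non-isomorphic real forms.
   Context: A real (resp. complex) algebraic variety is a geometrically integral quasi-projective scheme of finite type over $\mathbb{R}$ (resp. $\mathbb{C}$); morphisms are morphisms of schemes over the base field. The complexification of a real algebraic variety $X$ is $X_{\mathbb{C}}=X\times_{\mathrm{Spec}(\mathbb{R})}\mathrm{Spec}(\mathbb{C})$. A real form of a real algebraic variety $X$ is a real algebraic variety $X'$ such that $X_{\mathbb{C}}$ and $X'_{\mathbb{C}}$ are isomorphic as complex algebraic varieties. ''Non-isomorphic'' means non-isomorphic as real algebraic varieties. *)

(* Defs.v *)
From HB Require Import structures.
From mathcomp Require Import all_boot all_order all_algebra.
From mathcomp Require Import boolp reals.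
From mathcomp Require Import complex mpoly.

Set Implicit Arguments.
Unset Strict Implicit.
Unset Printing Implicit Defensive.

Import GRing.Theory Num.Theory.

Local Open Scope ring_scope.

Section Ideals.
Variables (K : fieldType) (n : nat).

Definition ideal_gen (s : seq {mpoly K[n]}) : {pred {mpoly K[n]}} :=
  [pred p | `[< exists q : 'I_(size s) -> {mpoly K[n]},
                  p = \sum_(i < size s) q i * s`_i >]].

(* [idealr_closed] already requires that 1 does not belong to P. *)
Definition prime_ideal (P : {pred {mpoly K[n]}}) : Prop :=
  idealr_closed P /\ prime_idealr_closed P.

End Ideals.

(* Stands for Spec K[x_0, .., x_(n-1)] / (f_1, .., f_r), n being the ambient
   dimension and f_1, .., f_r the equations. By Hilbert's basis theorem every
   affine K-scheme of finite type is isomorphic to one of these. *)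
Record affine_scheme (K : fieldType) := AffineScheme {
  ambient : nat;
  equations : seq {mpoly K[ambient]} }.

Section AffineSchemes.
Variable K : fieldType.

Definition defining_ideal (X : affine_scheme K) : {pred {mpoly K[ambient X]}} :=
  ideal_gen (equations X).
Arguments defining_ideal : clear implicits.

Definition is_integral (X : affine_scheme K) : Prop :=
  prime_ideal (defining_ideal X).

Definition affine_space (n : nat) : affine_scheme K :=
  @AffineScheme K n [::].

(* A morphism X -> Y is a K-algebra morphism from the coordinate ring of Y to
   that of X. It is represented by polynomials F_0, .., F_(m-1) lifting the
   images of the coordinates of Y; two such tuples represent the same morphism
   when they agree modulo the ideal of X. *)
Definition is_morphism (X Y : affine_scheme K)
    (F : (ambient Y).-tuple {mpoly K[ambient X]}) : Prop :=
  forall p, p \in defining_ideal Y -> p \mPo F \in defining_ideal X.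

Definition isomorphic (X Y : affine_scheme K) : Prop :=
  exists (F : (ambient Y).-tuple {mpoly K[ambient X]})
         (G : (ambient X).-tuple {mpoly K[ambient Y]}),
    [/\ is_morphism F, is_morphism G,
        forall i, tnth G i \mPo F - 'X_i \in defining_ideal X
      & forall j, tnth F j \mPo G - 'X_j \in defining_ideal Y].

(* The complement of the zero locus of f in X, embedded in one dimension more
   by the equation f * t = 1. *)
Definition principal_open (X : affine_scheme K) (f : {mpoly K[ambient X]}) :
    affine_scheme K :=
  AffineScheme (rcons [seq mwiden p | p <- equations X]
                      (mwiden f * 'X_ord_max - 1)).

(* For integral X and Y: some nonempty open subschemes of X and Y are
   isomorphic. These can be taken principal, because nonempty principal opens
   form a basis of the Zariski topology and the image of a principal open by an
   isomorphism between principal opens can be shrunk to a principal one. *)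
Definition birational (X Y : affine_scheme K) : Prop :=
  exists (f : {mpoly K[ambient X]}) (g : {mpoly K[ambient Y]}),
    [/\ f \notin defining_ideal X, g \notin defining_ideal Y
      & isomorphic (principal_open f) (principal_open g)].

Definition is_rational (X : affine_scheme K) : Prop :=
  exists n : nat, birational X (affine_space n).

(* A chain P_0 < P_1 < .. < P_d of prime ideals of the coordinate ring of X,
   seen as prime ideals of the ambient polynomial ring. *)
Definition has_prime_chain (X : affine_scheme K) (d : nat) : Prop :=
  exists P : nat -> {pred {mpoly K[ambient X]}},
    (forall i, (i <= d)%N ->
       prime_ideal (P i) /\ {subset defining_ideal X <= P i}) /\
    (forall i, (i < d)%N ->
       {subset P i <= P i.+1} /\ exists2 p, p \in P i.+1 & p \notin P i).

(* Krull dimension; an initial segment of a chain is a chain, so chains longer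
   than d.+1 need not be mentioned. *)
Definition has_dimension (X : affine_scheme K) (d : nat) : Prop :=
  has_prime_chain X d /\ ~ has_prime_chain X d.+1.

End AffineSchemes.

Arguments defining_ideal {K} X.
Arguments is_integral {K} X.
Arguments isomorphic {K} X Y.
Arguments birational {K} X Y.
Arguments is_rational {K} X.
Arguments has_prime_chain {K} X d.
Arguments has_dimension {K} X d.

Section RealVarieties.
Variable R : realType.

Definition complexification (X : affine_scheme R) : affine_scheme R[i] :=
  AffineScheme [seq map_mpoly (real_complex R) p | p <- equations X].

Definition jacobian (K : fieldType) (X : affine_scheme K)
    (a : 'I_(ambient X) -> K) : 'M[K]_(size (equations X), ambient X) :=
  \matrix_(i, j) ((equations X)`_i)^`M(j).@[a].

(* Over R, geometric integrality is integrality over the algebraic closure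
   R[i]. *)
Record real_affine_variety := RealAffineVariety {
  scheme_of :> affine_scheme R;
  _ : is_integral (complexification scheme_of) }.

(* Jacobian criterion at the geometric points; X is of pure dimension since it
   is integral. *)
Definition is_smooth (X : real_affine_variety) : Prop :=
  exists2 d, has_dimension X d &
    forall a : 'I_(ambient X) -> R[i],
      (forall p, p \in equations (complexification X) -> p.@[a] = 0) ->
      (\rank (@jacobian _ (complexification X) a) + d = ambient X)%N.

(* A real form of an affine variety is itself affine, because affineness
   descends along field extensions; it is thus enough to consider affine real
   forms. *)
Definition real_form (X X' : real_affine_variety) : Prop :=
  isomorphic (complexification X) (complexification X').

End RealVarieties.

Arguments is_smooth {R} X.
Arguments real_form {R} X X'.

(* Main.v *)
Require Import Defs.
From HB Require Import structures.
From mathcomp Require Import all_boot all_order all_algebra.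
From mathcomp Require Import boolp reals.
From mathcomp Require classical_sets topology normedtype realfun.
From mathcomp Require Import trigo.
From mathcomp Require Import zify ring lra.
(** Let [k = d - 4], [P1 = s - 1] and [P2 = (2 - s) (s^2 + 1)]. The variety of the
    theorem is the product of a plane, with coordinates [u] and [v], and of the
    base [x^2 + y^2 = P1(s_0) P2(s_0)], [s_0, ..., s_k] invertible. Its dimension
    is [k + 4] and it is geometrically integral, as over a closed field it is
    parametrised by [w = x + i y], [u], [v] and the [s_l]; it is smooth since the
    product [P1 P2] is separable, and rational since [s^2 + 1] is a norm from the
    complex numbers: dividing by it leaves the surface
    [a^2 + b^2 = (2 - s_0) / (s_0 - 1)], which is a graph over the [(a, b)].

    The points of the base with [x], [y], [s_0] real, [1 <= s_0 <= 2] and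
    [s_1 = ... = s_k = 1] form a sphere. For every [n >= 1], the trivial complex
    plane bundle over the base has a real structure whose real points over that
    sphere form a real plane bundle with [n] twists. To get it, choose
    polynomials [a] and [b] with [a P1^n + b P2^n = 1] and write [w = S T] with
    [S] real, [S^2 = P1] and [|T|^2 = P2]. The vectors
    [(S^n c - b T^n cbar, Tbar^n c + a S^n cbar)], for [c] complex, form the set
    of the [(u, v)] with [(ubar, vbar) = M (u, v)], where the entries of [M] turn
    out to be polynomials in [x], [y] and [s_0] although [S] and [T] are not
    ([glue_u], [glue_v], [frame_real]). The bundle defined by this equation over
    the real numbers ([plane_bundle]) is a real form, as over the complex numbers
    [(ubar, vbar)] becomes a function of [(u, v)] ([plane_bundle_isomorphic]).

    It remains to see that [n] can be read off from the form. An isomorphism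
    between the forms with [n] and [m] twists induces an automorphism [Phi] of the
    complexification that respects the two real structures. Each [s_l o Phi] is a
    unit, hence homogeneous in all of the coordinates of the parametrisation. By
    comparing degrees, and because the roots [1, 2, i, -i] of [P1 P2] are not
    permuted by any nontrivial map [s |-> lambda s^(+-1)], one finds that [Phi]
    preserves [s_0] over the sphere ([s0_fixed]) and maps [w] to [c(s_0) w] or to
    [c(s_0) wbar], with [|c| = 1] ([rotation_of_w], [rot_norm]): it rotates or
    reflects every circle [s_0 = constant]. The derivative of [Phi] along the
    fibres is an isomorphism of real plane bundles. In the frames above it is
    given by [c |-> A c + B cbar], and as it is injective, [|A|] and [|B|] always
    differ ([lin_anti_moduli]). So one of [A] and [B] has no zeros on the
    cylinder of the pairs of an [s_0] in [[1, 2]] and an argument of [T]. Now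
    [T = 0] at the end [s_0 = 2], where [A] and [B] are therefore constant,
    whereas [S = 0] at the end [s_0 = 1], where a computation shows that [A] makes
    [m - n] turns and [B] makes [m + n] turns, or [- m - n] and [- m + n] turns if
    [Phi] reflects the circles ([loop_bottom]). The winding number being constant
    along the cylinder ([two_loops]), one of these integers vanishes and [n = m]. *)

Set Implicit Arguments.
Unset Strict Implicit.
Unset Printing Implicit Defensive.
Import Order.TTheory GRing.Theory Num.Theory.
Local Open Scope ring_scope.

(** * Loops on a cylinder *)

Section Topology.
Import classical_sets topology normedtype realfun.
Import numFieldNormedType.Exports.
Local Open Scope classical_set_scope.

Section Winding.
Variable R : realType.
Implicit Types (a b : R * R -> R).

Lemma cos_sin_atan_div (c d : R) : 0 < c ->
  cos (atan (d / c)) * Num.sqrt (c ^+ 2 + d ^+ 2) = c /\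
  sin (atan (d / c)) * Num.sqrt (c ^+ 2 + d ^+ 2) = d.
Proof.
move=> c0.
have E : Num.sqrt (c ^+ 2 + d ^+ 2) = c * Num.sqrt (1 + (d / c) ^+ 2).
  have -> : c ^+ 2 + d ^+ 2 = c ^+ 2 * (1 + (d / c) ^+ 2) by field; lra.
  by rewrite sqrtrM ?sqr_ge0 // sqrtr_sqr gtr0_norm.
have nz : Num.sqrt (1 + (d / c) ^+ 2) != 0.
  by rewrite sqrtr_eq0 -ltNge; have := sqr_ge0 (d / c); lra.
have C : cos (atan (d / c)) * Num.sqrt (c ^+ 2 + d ^+ 2) = c.
  by rewrite E cos_atan mulrCA mulVf ?mulr1.
split=> //.
have cz : cos (atan (d / c)) != 0.
  by apply/negP => /eqP z; move: C; rewrite z mul0r; lra.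
have T : sin (atan (d / c)) = d / c * cos (atan (d / c)).
  by rewrite -{2}(atanK (d / c)) /tan divfK.
by rewrite T -mulrA C divfK; lra.
Qed.

(** Compactness gives a step [h], uniform on the cylinder, such that the values at
    [t] and [t + h] form an acute angle. *)
Lemma mesh_exists (lo hi : R) a b :
  (forall s t, lo <= s <= hi -> {for (s, t), continuous a}) ->
  (forall s t, lo <= s <= hi -> {for (s, t), continuous b}) ->
  (forall s t, lo <= s <= hi -> 0 < a (s, t) ^+ 2 + b (s, t) ^+ 2) ->
  exists2 e : R, 0 < e & forall h s t, `|h| < e -> lo <= s <= hi ->
    0 <= t <= pi *+ 2 ->
    0 < a (s, t) * a (s, t + h) + b (s, t) * b (s, t + h).
Proof.
move=> ca cb ab0.
pose P h (q : R * R) := 0 < a q * a (q.1, q.2 + h) + b q * b (q.1, q.2 + h).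
have cK : compact (`[lo, hi]%classic `*` `[0, (pi : R) *+ 2]%classic).
  by apply: compact_setX; exact: segment_compact.
move/compact_near_coveringP: cK => /(_ R (nbhs (0 : R)) P _).
case.
- move=> [s t] [/= sI _].
  have sI' : lo <= s <= hi by move: sI; rewrite in_itv.
  pose sh (z : (R * R) * R) : R * R := (z.1.1, z.1.2 + z.2).
  have c1 : {for ((s, t), 0 : R), continuous (fun z : (R * R) * R => z.1)}.
    exact: cvg_fst.
  have c2 : {for ((s, t), 0 : R), continuous (fun z : (R * R) * R => z.2)}.
    exact: cvg_snd.
  have c11 : {for ((s, t), 0 : R), continuous (fun z : (R * R) * R => z.1.1)}.
    by apply: (cvg_comp _ _ c1); exact: cvg_fst.
  have c12 : {for ((s, t), 0 : R), continuous (fun z : (R * R) * R => z.1.2)}.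
    by apply: (cvg_comp _ _ c1); exact: cvg_snd.
  have csh : {for ((s, t), 0), continuous sh}.
    have c3 := continuousD c12 c2.
    exact: (cvg_pair c11 c3).
  have cc (f : R * R -> R) : {for (s, t), continuous f} ->
      {for ((s, t), 0), continuous (fun z : (R * R) * R => f z.1 * f (sh z))}.
    move=> cf.
    have d1 : {for ((s, t), 0 : R), continuous (fun z : (R * R) * R => f z.1)}.
      exact: (cvg_comp _ _ c1 cf).
    have cf' : {for sh ((s, t), 0), continuous f} by rewrite /sh /= addr0.
    have d2 : {for ((s, t), 0 : R), continuous (fun z : (R * R) * R => f (sh z))}.
      exact: (cvg_comp _ _ csh cf').
    exact: (continuousM d1 d2).
  have cG : {for ((s, t), 0 : R),
      continuous (fun z : (R * R) * R => a z.1 * a (sh z) + b z.1 * b (sh z))}.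
    exact: (continuousD (cc _ (ca _ _ sI')) (cc _ (cb _ _ sI'))).
  have pos : 0 < a (s, t) * a (sh ((s, t), 0)) + b (s, t) * b (sh ((s, t), 0)).
    by rewrite /sh /= addr0 -!expr2 ab0.
  have := @cvgr_gt _ _ _ _ _ _ cG _ pos.
  by move=> /(_ _); apply.
- move=> e /= e0 He; exists e => // h s t he sI tI.
  apply: (He h _ (s, t)).
    by rewrite /ball_ /= sub0r normrN.
  by split; rewrite /= in_itv.
Qed.

Lemma rotation_eq1 (x y C S : R) : 0 < x ^+ 2 + y ^+ 2 ->
  x = x * C - y * S -> y = x * S + y * C -> C = 1.
Proof.
move=> p e1 e2; have z : (x ^+ 2 + y ^+ 2) * (C - 1) = 0.
  transitivity (x * (x * C - y * S) + y * (x * S + y * C) - (x ^+ 2 + y ^+ 2)).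
    by ring.
  by rewrite -e1 -e2; ring.
by move/eqP: z; rewrite mulf_eq0 gt_eqF //= subr_eq0 => /eqP.
Qed.

(** The total angle [W s] turned by the loop at [s] is a sum of [atan] over a
    subdivision into steps of acute angle. It is continuous in [s], and since the
    loop is closed, [cos (W s) = 1]. So [W] cannot go from [W hi = 0] to
    [W lo = 2 k pi] without passing, unless [k = 0], through [pi] or [- pi]. *)
Lemma winding_number_eq0 (lo hi : R) a b (k : int) : lo <= hi ->
  (forall s t, lo <= s <= hi -> {for (s, t), continuous a}) ->
  (forall s t, lo <= s <= hi -> {for (s, t), continuous b}) ->
  (forall s t, lo <= s <= hi -> 0 < a (s, t) ^+ 2 + b (s, t) ^+ 2) ->
  (forall s, a (s, pi *+ 2) = a (s, 0)) ->
  (forall s, b (s, pi *+ 2) = b (s, 0)) ->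
  (forall t, a (hi, t) = a (hi, 0)) -> (forall t, b (hi, t) = b (hi, 0)) ->
  (forall t, a (lo, t) = a (lo, 0) * cos (k%:~R * t) - b (lo, 0) * sin (k%:~R * t)) ->
  (forall t, b (lo, t) = a (lo, 0) * sin (k%:~R * t) + b (lo, 0) * cos (k%:~R * t)) ->
  k = 0.
Proof.
move=> lohi ca cb ab0 pa pb ha hb la lb.
have [e e0 He] := mesh_exists ca cb ab0.
have pi0 := pi_gt0 R.
(* A subdivision fine enough for the angles to be acute, at [lo] by [Nk]. *)
have [N [N0 Ne Nk]] : exists N : nat, [/\ (0 < N)%N, pi *+ 2 / N%:R < e &
    `|k%:~R * (pi *+ 2 / N%:R)| < pi / 2 :> R].
  pose z : R := pi *+ 2 / e + `|k%:~R| * 4 + 1.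
  have z0 : 0 < z.
    have : 0 < pi *+ 2 / e by rewrite divr_gt0 // mulrn_wgt0.
    by have : 0 <= `|k%:~R : R| by []; rewrite /z; lra.
  have Nz := truncnS_gt z; set N := (Num.truncn z).+1 in Nz.
  have N0 : (0 : R) < N%:R by rewrite ltr0n.
  have e4 : 0 <= `|k%:~R : R| by [].
  have p4 : 0 < pi *+ 2 / e by rewrite divr_gt0 // mulrn_wgt0.
  exists N; split=> //.
    rewrite ltr_pdivrMr // -ltr_pdivrMl // mulrC; rewrite /z in Nz; lra.
  have hp : 0 <= pi *+ 2 / N%:R :> R by rewrite divr_ge0 ?ler0n // mulrn_wge0 // ltW.
  rewrite normrM (ger0_norm hp).
  rewrite mulrA ltr_pdivrMr //.
  have : `|k%:~R| * 4 < N%:R :> R by rewrite /z in Nz; lra.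
  by rewrite -(mulr_natr pi 2); nra.
pose h : R := pi *+ 2 / N%:R.
pose th (j : nat) : R := h * j%:R.
have h0 : 0 < h by rewrite divr_gt0 ?ltr0n // mulrn_wgt0.
have thS j : th j.+1 = th j + h by rewrite /th -natr1 mulrDr mulr1.
have thN : th N = pi *+ 2 by rewrite /th /h divfK // pnatr_eq0 -lt0n.
pose c s j := a (s, th j) * a (s, th j.+1) + b (s, th j) * b (s, th j.+1).
pose d s j := a (s, th j) * b (s, th j.+1) - b (s, th j) * a (s, th j.+1).
have c0 s j : lo <= s <= hi -> (j < N)%N -> 0 < c s j.
  move=> sI jN; rewrite /c thS; apply: He => //.
    by rewrite gtr0_norm.
  apply/andP; split; first by rewrite /th mulr_ge0 ?ler0n // ltW.
  by rewrite -thN /th ler_pM2l // ler_nat ltnW.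
pose W s := \sum_(j < N) atan (d s j / c s j).
have cW s : lo <= s <= hi -> {for s, continuous W}.
  move=> sI; apply: cvg_big => [|j _]; first exact: add_continuous.
  - have cm (f : R * R -> R) t : {for (s, t), continuous f} -> {for s, continuous (fun s => f (s, t))}.
      move=> cf; have c1 : {for s, continuous (fun s : R => (s, t))}.
        have i1 : {for s, continuous (fun x : R => x)} by exact: cvg_id.
        have i2 : {for s, continuous (fun _ : R => t)} by exact: cvg_cst.
        exact: (cvg_pair i1 i2).
      exact: (cvg_comp _ _ c1 cf).
    have A j' := cm _ (th j') (ca s (th j') sI).
    have B j' := cm _ (th j') (cb s (th j') sI).
    have cd : {for s, continuous (d ^~ j)}.
      exact: (continuousB (continuousM (A _) (B _)) (continuousM (B _) (A _))).
    have cc : {for s, continuous (c ^~ j)}.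
      exact: (continuousD (continuousM (A _) (A _)) (continuousM (B _) (B _))).
    have ci : {for s, continuous (fun s => (c s j)^-1)}.
      by apply: continuousV => //; rewrite gt_eqF // c0.
    have cq := continuousM cd ci.
    exact: (cvg_comp _ _ cq (@continuous_atan R _)).
have W1 s : lo <= s <= hi -> cos (W s) = 1.
  move=> sI.
  pose r j := Num.sqrt (a (s, th j) ^+ 2 + b (s, th j) ^+ 2).
  have r0 j : 0 < r j by rewrite sqrtr_gt0 ab0.
  have rr j : r j ^+ 2 = a (s, th j) ^+ 2 + b (s, th j) ^+ 2.
    by rewrite sqr_sqrtr // ltW // ab0.
  have key n : (n <= N)%N ->
      a (s, th n) * r 0 = r n * (a (s, th 0) * cos (\sum_(j < n) atan (d s j / c s j))
         - b (s, th 0) * sin (\sum_(j < n) atan (d s j / c s j))) /\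
      b (s, th n) * r 0 = r n * (a (s, th 0) * sin (\sum_(j < n) atan (d s j / c s j))
         + b (s, th 0) * cos (\sum_(j < n) atan (d s j / c s j))).
    elim: n => [_|n IH nN].
      by rewrite big_ord0 cos0 sin0 !mulr0 !mulr1 subr0 add0r; split; rewrite mulrC.
    have [ia ib] := IH (ltnW nN).
    rewrite !big_ord_recr /=; set U := \sum_(j < n) _ in ia ib *.
    have [] := cos_sin_atan_div (d s n) (c0 _ _ sI nN).
    have -> : Num.sqrt (c s n ^+ 2 + d s n ^+ 2) = r n * r n.+1.
      have -> : c s n ^+ 2 + d s n ^+ 2 = (r n * r n.+1) ^+ 2.
        by rewrite exprMn !rr /c /d; ring.
      by rewrite sqrtr_sqr gtr0_norm // mulr_gt0.
    set V := atan _ => Ec Es.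
    have ea : a (s, th n.+1) * r n ^+ 2 = a (s, th n) * c s n - b (s, th n) * d s n.
      by rewrite rr /c /d; ring.
    have eb : b (s, th n.+1) * r n ^+ 2 = a (s, th n) * d s n + b (s, th n) * c s n.
      by rewrite rr /c /d; ring.
    have nz : r n ^+ 2 != 0 by rewrite expf_neq0 // gt_eqF.
    rewrite cosD sinD; split; apply: (mulIf nz).
      rewrite mulrAC ea -Ec -Es.
      transitivity (r n * r n.+1 * (a (s, th n) * r 0 * cos V - b (s, th n) * r 0 * sin V)); first by ring.
      by rewrite ia ib; ring.
    rewrite mulrAC eb -Ec -Es.
    transitivity (r n * r n.+1 * (a (s, th n) * r 0 * sin V + b (s, th n) * r 0 * cos V)); first by ring.
    by rewrite ia ib; ring.
  have th0 : th 0 = 0 by rewrite /th mulr0.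
  have [] := key N (leqnn _).
  have rN : r N = r 0 by rewrite /r thN th0 pa pb.
  have nz : r 0 != 0 by rewrite gt_eqF.
  rewrite rN thN pa pb th0 -/(W s) ![_ * r 0]mulrC => /(mulfI nz) e1 /(mulfI nz) e2.
  exact: (rotation_eq1 (ab0 s 0 sI) e1 e2).
have hiI : lo <= hi <= hi by rewrite lohi lexx.
have loI : lo <= lo <= hi by rewrite lohi lexx.
have Whi : W hi = 0.
  rewrite /W big1 // => j _.
  by rewrite /d !(ha (th _)) !(hb (th _)) [X in _ - X]mulrC subrr mul0r atan0.
have Wlo : W lo = k%:~R * (pi *+ 2).
  rewrite /W (eq_bigr (fun=> k%:~R * h)) => [|j _].
    by rewrite sumr_const card_ord -mulr_natr -mulrA /h divfK // pnatr_eq0 -lt0n.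
  have kh : k%:~R * h \in `](- (pi / 2)), (pi / 2)[%R.
    by rewrite in_itv /= -ltr_norml.
  have ck : 0 < cos (k%:~R * h) by apply: cos_gt0_pihalf; rewrite -ltr_norml.
  rewrite -[RHS](tanK kh); congr atan.
  have -> : c lo j = (a (lo, 0) ^+ 2 + b (lo, 0) ^+ 2) * cos (k%:~R * h).
    rewrite /c !(la (th _)) !(lb (th _)) thS (mulrDr k%:~R) cosD sinD.
    have := cos2Dsin2 (k%:~R * th j); set x := cos _; set y := sin _ => xy.
    transitivity ((a (lo, 0) ^+ 2 + b (lo, 0) ^+ 2) * cos (k%:~R * h) * (x ^+ 2 + y ^+ 2)).
      by ring.
    by rewrite xy mulr1.
  have -> : d lo j = (a (lo, 0) ^+ 2 + b (lo, 0) ^+ 2) * sin (k%:~R * h).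
    rewrite /d !(la (th _)) !(lb (th _)) thS (mulrDr k%:~R) cosD sinD.
    have := cos2Dsin2 (k%:~R * th j); set x := cos _; set y := sin _ => xy.
    transitivity ((a (lo, 0) ^+ 2 + b (lo, 0) ^+ 2) * sin (k%:~R * h) * (x ^+ 2 + y ^+ 2)).
      by ring.
    by rewrite xy mulr1.
  have nz : a (lo, 0) ^+ 2 + b (lo, 0) ^+ 2 != 0 by rewrite gt_eqF // ab0.
  by rewrite /tan; field; rewrite nz gt_eqF.
apply/eqP/negP => k0.
have cWw : {within `[lo, hi], continuous W}.
  apply: continuous_in_subspaceT => s; rewrite inE /= in_itv /=.
  exact: cW.
have contra s : lo <= s <= hi -> W s = pi \/ W s = - pi -> False.
  by move=> sI [] Ws; have := W1 s sI; rewrite Ws ?cosN cospi; lra.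
have [kp|kn] : (1 <= k%:~R :> R) \/ (k%:~R <= -1 :> R).
  have : (1 <= k) \/ (k <= -1) by lia.
  by case=> kk; [left; rewrite ler1z | right; rewrite -(ler_int R) in kk].
- have /(IVT lohi cWw) [] : Num.min (W lo) (W hi) <= pi <= Num.max (W lo) (W hi).
    rewrite Wlo Whi ge_min le_max; apply/andP; split; apply/orP.
      by right; exact: ltW.
    by left; rewrite -(mulr_natr pi 2); nra.
  move=> s; rewrite in_itv /= => sI Ws; exact: (contra s sI (or_introl Ws)).
- have /(IVT lohi cWw) [] : Num.min (W lo) (W hi) <= - pi <= Num.max (W lo) (W hi).
    rewrite Wlo Whi ge_min le_max; apply/andP; split; apply/orP.
      by left; rewrite -(mulr_natr pi 2); nra.
    by right; lra.
  move=> s; rewrite in_itv /= => sI Ws; exact: (contra s sI (or_intror Ws)).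
Qed.
End Winding.

Section Continuity.
Variable R : realType.
Implicit Types (f g : R * R -> R) (p : R * R).

Definition cont_at f p : Prop := {for p, continuous f}.

Lemma cont_at_cst c p : cont_at (fun=> c) p.
Proof. exact: cvg_cst. Qed.

Lemma cont_at_fst p : cont_at (fun q => q.1) p.
Proof. exact: cvg_fst. Qed.

Lemma cont_at_comp f (h : R -> R) p : cont_at f p -> {for f p, continuous h} ->
  cont_at (fun q => h (f q)) p.
Proof. by move=> cf ch; apply: continuous_comp. Qed.

Lemma cont_at_cos p : cont_at (fun q => cos q.2) p.
Proof. by apply: (cont_at_comp (f := snd)); [exact: cvg_snd | exact: continuous_cos]. Qed.

Lemma cont_at_sin p : cont_at (fun q => sin q.2) p.
Proof. by apply: (cont_at_comp (f := snd)); [exact: cvg_snd | exact: continuous_sin]. Qed.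

Lemma cont_at_sqrt f p : cont_at f p -> cont_at (fun q => Num.sqrt (f q)) p.
Proof. by move=> cf; apply: cont_at_comp cf _; exact: sqrt_continuous. Qed.

Lemma cont_at_inv f p : f p != 0 -> cont_at f p -> cont_at (fun q => (f q)^-1) p.
Proof. by move=> f0 cf; apply: cont_at_comp cf _; exact: inv_continuous. Qed.

Lemma cont_atD f g p : cont_at f p -> cont_at g p -> cont_at (fun q => f q + g q) p.
Proof. by move=> cf cg; exact: (continuousD cf cg). Qed.

Lemma cont_atN f p : cont_at f p -> cont_at (fun q => - f q) p.
Proof. by move=> cf; exact: (continuousN cf). Qed.

Lemma cont_atM f g p : cont_at f p -> cont_at g p -> cont_at (fun q => f q * g q) p.
Proof. by move=> cf cg; exact: (continuousM cf cg). Qed.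

Lemma slice_continuous f s t : cont_at f (s, t) -> {for s, continuous (fun x => f (x, t))}.
Proof.
move=> cf; have i1 : {for s, continuous (fun x : R => x)} by exact: cvg_id.
have i2 : {for s, continuous (fun x : R => t)} by exact: cvg_cst.
have c : {for s, continuous (fun x : R => (x, t))} by exact: (cvg_pair i1 i2).
exact: (cvg_comp _ _ c cf).
Qed.

(** This recovers an identity at an end of a segment, where the algebra that
    proves it inside divides by zero. *)
Lemma edge_constant f lo hi t c : lo < hi -> cont_at f (lo, t) ->
  (forall s, lo < s < hi -> f (s, t) = c) -> f (lo, t) = c.
Proof.
move=> lohi cf fc.
have cg : {for lo, continuous (fun s => f (s, t))}.
  exact: slice_continuous.
have c1 : f (s, t) @[s --> lo^'+] --> f (lo, t) by exact: cvg_at_right_filter.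
have c2 : f (s, t) @[s --> lo^'+] --> c.
  apply: cvg_near_cst; near=> s; apply: fc; apply/andP; split; near: s.
    exact: nbhs_right_gt.
  exact: nbhs_right_lt.
exact: (cvg_unique _ c1 c2).
Unshelve. all: by end_near.
Qed.

(** The difference of the squared moduli of [a + i b] and [c + i d] never vanishes,
    so its sign at [hi] decides which of the two has no zeros on the cylinder; the
    number of turns of that one is then the same at both ends. *)
Lemma two_loops (lo hi : R) a b c d (ka kb : int) : lo <= hi ->
  (forall s t, lo <= s <= hi -> [/\ cont_at a (s, t), cont_at b (s, t), cont_at c (s, t) & cont_at d (s, t)]) ->
  (forall s t, lo <= s <= hi -> a (s, t) ^+ 2 + b (s, t) ^+ 2 != c (s, t) ^+ 2 + d (s, t) ^+ 2) ->
  (forall s, [/\ a (s, pi *+ 2) = a (s, 0), b (s, pi *+ 2) = b (s, 0),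
     c (s, pi *+ 2) = c (s, 0) & d (s, pi *+ 2) = d (s, 0)]) ->
  (forall t, [/\ a (hi, t) = a (hi, 0), b (hi, t) = b (hi, 0), c (hi, t) = c (hi, 0) & d (hi, t) = d (hi, 0)]) ->
  (forall t, [/\ a (lo, t) = a (lo, 0) * cos (ka%:~R * t) - b (lo, 0) * sin (ka%:~R * t),
    b (lo, t) = a (lo, 0) * sin (ka%:~R * t) + b (lo, 0) * cos (ka%:~R * t),
    c (lo, t) = c (lo, 0) * cos (kb%:~R * t) - d (lo, 0) * sin (kb%:~R * t) &
    d (lo, t) = c (lo, 0) * sin (kb%:~R * t) + d (lo, 0) * cos (kb%:~R * t)]) ->
  ka = 0 \/ kb = 0.
Proof.
move=> lohi cont ne per top bot.
pose h q := (a q ^+ 2 + b q ^+ 2) - (c q ^+ 2 + d q ^+ 2).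
have ch s t : lo <= s <= hi -> cont_at h (s, t).
  move=> sI; have [ca cb cc cd] := cont s t sI.
  apply: (cont_atD (f := fun q => a q * a q + b q * b q) (g := fun q => - (c q * c q + d q * d q))).
    by apply: cont_atD; apply: cont_atM.
  by apply: cont_atN; apply: cont_atD; apply: cont_atM.
have h0 s t : lo <= s <= hi -> h (s, t) != 0 by move=> sI; rewrite subr_eq0 ne.
have htop t : h (hi, t) = h (hi, 0) by rewrite /h; have [-> -> -> ->] := top t.
have sgn s t : lo <= s <= hi -> 0 < h (s, t) * h (hi, 0).
  move=> /andP[ls sh]; rewrite -(htop t) ltNge; apply/negP => le0.
  have cg : {within `[s, hi], continuous (fun x => h (x, t))}.
    apply: continuous_in_subspaceT => x; rewrite inE /= in_itv /= => /andP[sx xh].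
    by apply: slice_continuous; apply: ch; rewrite xh andbT (le_trans ls).
  have [|x] := IVT sh cg (v := 0).
    have n1 := h0 s t; have n2 := h0 hi t; rewrite ls sh in n1; rewrite lohi lexx in n2.
    move: (n1 isT) (n2 isT) le0.
    case: (ltrgtP (h (s, t)) 0) => // p1 _; case: (ltrgtP (h (hi, t)) 0) => // p2 _ le0.
    - by have := nmulr_rgt0 (h (hi,t)) p1; rewrite p2 ltNge le0.
    - by rewrite ge_min le_max (ltW p1) (ltW p2) orbT.
    - by rewrite ge_min le_max (ltW p1) (ltW p2) orbT.
    - by have := mulr_gt0 p1 p2; rewrite ltNge le0.
  rewrite in_itv /= => /andP[sx xh] /eqP; apply/negP/h0.
  by rewrite xh andbT (le_trans ls).
have [hp|hn|h00] := ltrgtP (h (hi, 0)) 0; last 1 first.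
- by have := h0 hi 0; rewrite lohi lexx h00 eqxx => /(_ isT).
- right; apply: (@winding_number_eq0 _ lo hi c d kb) => //.
  + by move=> s t /(cont s t)[].
  + by move=> s t /(cont s t)[].
  + move=> s t /sgn => /(_ t); rewrite nmulr_lgt0 // /h.
    by have := sqr_ge0 (a (s, t)); have := sqr_ge0 (b (s, t)); lra.
  + by move=> s; have [] := per s.
  + by move=> s; have [] := per s.
  + by move=> t; have [] := top t.
  + by move=> t; have [] := top t.
  + by move=> t; have [] := bot t.
  + by move=> t; have [] := bot t.
- left; apply: (@winding_number_eq0 _ lo hi a b ka) => //.
  + by move=> s t /(cont s t)[].
  + by move=> s t /(cont s t)[].
  + move=> s t /sgn => /(_ t); rewrite pmulr_lgt0 // /h.
    by have := sqr_ge0 (c (s, t)); have := sqr_ge0 (d (s, t)); lra.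
  + by move=> s; have [] := per s.
  + by move=> s; have [] := per s.
  + by move=> t; have [] := top t.
  + by move=> t; have [] := top t.
  + by move=> t; have [] := bot t.
  + by move=> t; have [] := bot t.
Qed.
End Continuity.

End Topology.

From mathcomp Require Import complex mpoly.

(** * Polynomials and their values *)

Section MpolyGeneralities.

(** The induction used below for every identity between ring morphisms on polynomials. *)
Lemma mpoly_ring_ind (K : comNzRingType) n (P : {mpoly K[n]} -> Prop) :
  (forall c, P c%:MP) -> (forall i, P 'X_i) ->
  (forall p q, P p -> P q -> P (p + q)) ->
  (forall p q, P p -> P q -> P (p * q)) -> forall p, P p.
Proof.
move=> PC PX PD PM; have PXm m : P 'X_[m].
  rewrite mpolyXE_id; elim/big_ind: _ => [||i _]; [by rewrite -mpolyC1|exact: PM|].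
  elim: (m i) => [|e IH]; first by rewrite expr0 -mpolyC1.
  by rewrite exprS; apply: PM.
elim/mpolyind => [|c m p _ _ Pp]; first by rewrite -mpolyC0.
by apply: PD => //; rewrite -mul_mpolyC; apply: PM.
Qed.

(** Polynomials in [n + 1] variables as polynomials in the last one, for inductions
    on the number of variables. *)
Definition last_uni (K : comNzRingType) n : {mpoly K[n.+1]} -> {poly {mpoly K[n]}} :=
  mmap (polyC \o @mpolyC n K)
    (fun i => if unlift ord_max i is Some j then ('X_j)%:P else 'X).

Lemma last_uniC (K : comNzRingType) n (c : K) : last_uni c%:MP_[n.+1] = (c%:MP)%:P.
Proof. by rewrite /last_uni mmapC. Qed.

Lemma last_uniX (K : comNzRingType) n i : last_uni ('X_i : {mpoly K[n.+1]}) =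
  if unlift ord_max i is Some j then ('X_j)%:P else 'X.
Proof. by rewrite /last_uni mmapX mmap1U. Qed.

Lemma last_uniD (K : comNzRingType) n (p q : {mpoly K[n.+1]}) :
  last_uni (p + q) = last_uni p + last_uni q.
Proof. exact: rmorphD. Qed.

Lemma last_uniM (K : comNzRingType) n (p q : {mpoly K[n.+1]}) :
  last_uni (p * q) = last_uni p * last_uni q.
Proof. exact: rmorphM. Qed.

Lemma last_uniE (K : comNzRingType) n (S : comNzRingType) (f : {rmorphism K -> S})
    (h : 'I_n.+1 -> S) (p : {mpoly K[n.+1]}) :
  mmap f h p =
  (map_poly (mmap f (fun i => h (lift ord_max i))) (last_uni p)).[h ord_max].
Proof.
elim/mpoly_ring_ind: p => [c|i|p q IHp IHq|p q IHp IHq].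
- by rewrite mmapC last_uniC map_polyC hornerC /= mmapC.
- rewrite mmapX mmap1U last_uniX; case: unliftP => [j ->|->].
    by rewrite map_polyC hornerC /= mmapX mmap1U.
  by rewrite map_polyX hornerX.
- by rewrite last_uniD mmapD [map_poly _ _]rmorphD hornerD IHp IHq.
- by rewrite last_uniM rmorphM /= IHp IHq rmorphM /= hornerM.
Qed.

Lemma last_uni_eq0 (K : comNzRingType) n (p : {mpoly K[n.+1]}) :
  last_uni p = 0 -> p = 0.
Proof.
move=> p0; have := last_uniE (@mpolyC n.+1 K) (fun i => 'X_i) p.
rewrite p0 rmorph0 horner0 => <-; rewrite -[LHS]comp_mpoly_id /comp_mpoly.
by apply: eq_bigr => m _; congr (_ * _); apply: mmap1_eq => i; rewrite tnth_mktuple.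
Qed.

Lemma poly_eq_nat (L : numFieldType) (P Q : {poly L}) : (forall k : nat, P.[k.+1%:R] = Q.[k.+1%:R]) -> P = Q.
Proof.
move=> PQ; apply/eqP; rewrite -subr_eq0; apply/negPn/negP => PQ0.
have := @max_poly_roots _ _ [seq k.+1%:R | k <- iota 0 (size (P - Q))] PQ0.
rewrite size_map size_iota ltnn => H; suff: false by []; apply: H => //.
  by apply/allP => _ /mapP[k _ ->]; rewrite /root hornerD hornerN PQ subrr.
by rewrite map_inj_uniq ?iota_uniq // => a b /eqP; rewrite eqr_nat eqSS => /eqP.
Qed.

Lemma exists_meval_neq0 (L : numFieldType) n (p : {mpoly L[n]}) :
  p != 0 -> exists v, p.@[v] != 0.
Proof.
elim: n p => [|n IH] p p0.
  by exists (fun=> 0); move: p0; rewrite (nvar0_mpolyC p) mevalC mpolyC_eq0.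
have: lead_coef (last_uni p) != 0.
  by rewrite lead_coef_eq0; apply: contraNneq p0 => /last_uni_eq0 ->.
move=> /IH[v vP]; set q := map_poly (meval v) (last_uni p).
have q0 : q != 0.
  apply: contraNneq vP => /(congr1 (fun r : {poly L} => r`_(size (last_uni p)).-1)).
  by rewrite coef0 coef_map /= => ->.
have [x /negP xP] : exists x, ~ root q x.
  apply/existsNP => H; case/eqP: q0; apply: poly_eq_nat => k.
  by rewrite horner0; exact/eqP/H.
exists (fun i => if unlift ord_max i is Some j then v j else x).
rewrite /meval last_uniE unlift_none /=.
suff -> : map_poly (mmap idfun (fun i => if unlift ord_max (lift ord_max i) is Some j
    then v j else x)) (last_uni p) = q by [].
apply/polyP => i; rewrite !coef_map /=; apply: eq_bigr => m _.
by congr (_ * _); apply: mmap1_eq => j; rewrite liftK.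
Qed.

Lemma mpoly_eq0_dense (L : numFieldType) n (g p : {mpoly L[n]}) : g != 0 ->
  (forall v, g.@[v] != 0 -> p.@[v] = 0) -> p = 0.
Proof.
move=> g0 gp; have : g * p == 0.
  apply/negPn/negP => /exists_meval_neq0[v]; rewrite mevalM.
  by have [->|/gp ->] := eqVneq g.@[v] 0; rewrite ?mul0r ?mulr0 eqxx.
by rewrite mulf_eq0 (negPf g0) => /eqP.
Qed.

End MpolyGeneralities.

Section Ideals.
Variables (K : fieldType) (n : nat).
Implicit Types (s : seq {mpoly K[n]}) (p q : {mpoly K[n]}).

Lemma ideal_genP s p : reflect
  (exists q : 'I_(size s) -> {mpoly K[n]}, p = \sum_(i < size s) q i * s`_i)
  (p \in ideal_gen s).
Proof. exact: asboolP. Qed.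

Lemma ideal_gen_closed s : [/\ 0 \in ideal_gen s,
  {in ideal_gen s &, forall p q, p + q \in ideal_gen s} &
  forall a p, p \in ideal_gen s -> a * p \in ideal_gen s].
Proof.
split.
- by apply/ideal_genP; exists (fun=> 0); rewrite big1 // => i _; rewrite mul0r.
- move=> p q /ideal_genP[f ->] /ideal_genP[g ->]; apply/ideal_genP.
  exists (fun i => f i + g i); rewrite -big_split /=.
  by apply: eq_bigr => i _; rewrite mulrDl.
- move=> a p /ideal_genP[f ->]; apply/ideal_genP.
  exists (fun i => a * f i); rewrite mulr_sumr.
  by apply: eq_bigr => i _; rewrite mulrA.
Qed.

Lemma ideal_gen0 s : 0 \in ideal_gen s. Proof. by case: (ideal_gen_closed s). Qed.

Lemma ideal_genD s p q :
  p \in ideal_gen s -> q \in ideal_gen s -> p + q \in ideal_gen s.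
Proof. by move=> ps qs; case: (ideal_gen_closed s) => _ + _; apply. Qed.

Lemma ideal_genMl s a p : p \in ideal_gen s -> a * p \in ideal_gen s.
Proof. by move=> ps; case: (ideal_gen_closed s) => _ _; apply. Qed.

Lemma ideal_genMr s a p : p \in ideal_gen s -> p * a \in ideal_gen s.
Proof. by rewrite mulrC; exact: ideal_genMl. Qed.

Lemma ideal_genN s p : p \in ideal_gen s -> - p \in ideal_gen s.
Proof. by rewrite -mulN1r; exact: ideal_genMl. Qed.

Lemma ideal_genB s p q :
  p \in ideal_gen s -> q \in ideal_gen s -> p - q \in ideal_gen s.
Proof. by move=> ps /ideal_genN; exact: ideal_genD. Qed.

Lemma ideal_gen_sum s I (r : seq I) (F : I -> {mpoly K[n]}) :
  (forall i, F i \in ideal_gen s) -> \sum_(i <- r) F i \in ideal_gen s.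
Proof.
move=> Fs; elim/big_ind: _ => //; first exact: ideal_gen0.
by move=> p q; exact: ideal_genD.
Qed.

Lemma mem_ideal_gen s p : p \in s -> p \in ideal_gen s.
Proof.
move=> ps; have pz : (index p s < size s)%N by rewrite index_mem.
apply/ideal_genP; exists (fun i => (i == Ordinal pz)%:R).
rewrite (bigD1 (Ordinal pz)) //= eqxx mul1r big1 => [|i /negPf ->]; last exact: mul0r.
by rewrite addr0 nth_index.
Qed.

End Ideals.

Section IdealMaps.
Variables (K K' : fieldType) (n m : nat).

Lemma ideal_gen_map (phi : {rmorphism {mpoly K[n]} -> {mpoly K'[m]}}) s t :
  (forall e, e \in s -> phi e \in ideal_gen t) ->
  forall p, p \in ideal_gen s -> phi p \in ideal_gen t.
Proof.
move=> st p /ideal_genP[q ->]; rewrite rmorph_sum; apply: ideal_gen_sum => i.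
by rewrite rmorphM; apply/ideal_genMl/st/mem_nth.
Qed.

End IdealMaps.

Section Congruence.
Variables (K : fieldType) (n m : nat).

Lemma comp_mpoly_congr (F G : n.-tuple {mpoly K[m]}) t :
  (forall i, tnth F i - tnth G i \in ideal_gen t) ->
  forall p, (p \mPo F) - (p \mPo G) \in ideal_gen t.
Proof.
move=> FG; elim/mpoly_ring_ind => [c|i|p q IHp IHq|p q IHp IHq].
- by rewrite !comp_mpolyC subrr ideal_gen0.
- by rewrite !comp_mpolyXU -!tnth_nth.
- rewrite !comp_mpolyD opprD addrACA; exact: ideal_genD.
- rewrite !rmorphM /=.
  have -> : (p \mPo F) * (q \mPo F) - (p \mPo G) * (q \mPo G) =
    (p \mPo F) * ((q \mPo F) - (q \mPo G)) + (q \mPo G) * ((p \mPo F) - (p \mPo G)) by ring.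
  by apply: ideal_genD; exact: ideal_genMl.
Qed.

End Congruence.

Section Homogeneity.

Lemma poly_monomial_factor (D : idomainType) (p q : {poly D}) (c : D) j :
  c != 0 -> p * q = c *: 'X^j -> exists a e, p = a *: 'X^e.
Proof.
move=> c0 pq; have nz : p * q != 0 by rewrite pq -mul_polyC mulf_eq0 polyC_eq0 (negPf c0) -size_poly_eq0 size_polyXn.
have [p0 q0] : p != 0 /\ q != 0 by apply/andP; rewrite -negb_or -mulf_eq0.
have [a [p' p'0 pE]] := multiplicity_XsubC p 0.
have [b [q' q'0 qE]] := multiplicity_XsubC q 0.
rewrite p0 /= in p'0; rewrite q0 /= in q'0; rewrite subr0 in pE qE.
have pq' : ~~ root (p' * q') 0 by rewrite rootM negb_or p'0.
have E : (p' * q') * 'X^(a + b) = c *: 'X^j.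
  by rewrite -pq pE qE exprD; ring.
have ab : (a + b = j)%N.
  apply/eqP; rewrite eqn_leq; apply/andP; split; rewrite leqNgt; apply/negP => lt.
    have := congr1 (fun r : {poly D} => r`_j) E.
    by rewrite coefMXn lt coefZ coefXn eqxx mulr1 => /esym/eqP; apply/negP.
  have := congr1 (fun r : {poly D} => r`_(a + b)) E.
  rewrite coefMXn ltnn subnn coefZ coefXn (ltn_eqF lt) mulr0 => /eqP.
  by rewrite -horner_coef0; apply/negP.
have E' : p' * q' = c%:P.
  apply: (mulIf (x := 'X^j)); first by rewrite -size_poly_eq0 size_polyXn.
  by rewrite -{1}ab E mul_polyC.
have := size_mul_eq1 p' q'.
exists p'`_0, a; rewrite pE -mul_polyC; congr (_ * _); apply: size1_polyC.
have p'n : p' != 0 by apply: contraNneq p'0 => ->; rewrite root0.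
have q'n : q' != 0 by apply: contraNneq q'0 => ->; rewrite root0.
have := size_mul p'n q'n; rewrite E' size_polyC c0.
by move: q'n; rewrite -size_poly_gt0; move: (size p') (size q') => [|?] [|?] //=; lia.
Qed.

Definition scale_coord (L : nzRingType) n (i : 'I_n) (t : L) (y : 'I_n -> L) : 'I_n -> L :=
  fun j => if j == i then t * y j else y j.

(** Seen as a polynomial in the scaling factor [t], the homogeneous polynomial [h]
    is a monomial, hence so is each factor. A dense open set, such as the
    one where [den] does not vanish, is enough to recognise that. *)
Lemma meval_scale_factor (L : numFieldType) n (i : 'I_n) (p q h den : {mpoly L[n]}) j :
  h != 0 -> den != 0 -> p * q = h ->
  (forall t y, t != 0 -> den.@[y] != 0 -> h.@[scale_coord i t y] = t ^+ j * h.@[y]) ->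
  exists e, forall t y, p.@[scale_coord i t y] = t ^+ e * p.@[y].
Proof.
move=> h0 den0 pq hh.
pose X k : {poly {mpoly L[n]}} := if k == i then ('X_k) *: 'X else ('X_k)%:P.
pose d : {mpoly L[n]} -> {poly {mpoly L[n]}} := mmap (polyC \o @mpolyC n L) X.
have dD r r' : d (r + r') = d r + d r' by exact: rmorphD.
have dM r r' : d (r * r') = d r * d r' by exact: rmorphM.
have dE r t y : r.@[scale_coord i t y] = (map_poly (meval y) (d r)).[t].
  elim/mpoly_ring_ind: r => [c|k|r r' IHr IHr'|r r' IHr IHr'].
  - by rewrite mevalC /d mmapC map_polyC hornerC /= mevalC.
  - rewrite mevalXU /d mmapX mmap1U /X /scale_coord; case: ifP => _.
      by rewrite map_polyZ map_polyX hornerZ hornerX /= mevalXU mulrC.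
    by rewrite map_polyC hornerC /= mevalXU.
  - by rewrite dD mevalD IHr IHr' rmorphD hornerD.
  - by rewrite dM mevalM IHr IHr' rmorphM hornerM.
have dinj (u : {poly {mpoly L[n]}}) :
    (forall t y, t != 0 -> den.@[y] != 0 -> (map_poly (meval y) u).[t] = 0) -> u = 0.
  move=> u0; apply/polyP => l; rewrite coef0.
  apply: (mpoly_eq0_dense den0) => y dy.
  have -> : (u`_l).@[y] = (map_poly (meval y) u)`_l by rewrite coef_map.
  suff -> : map_poly (meval y) u = 0 by rewrite coef0.
  by apply: poly_eq_nat => k; rewrite horner0 u0 // pnatr_eq0.
have dh : d p * d q = h *: 'X^j.
  rewrite -dM pq; apply/eqP; rewrite -subr_eq0; apply/eqP/dinj => t y t0 dy.
  rewrite rmorphB hornerD hornerN /= -dE hh // map_polyZ map_polyXn hornerZ hornerXn /=.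
  by rewrite mulrC subrr.
have [a [e de]] := poly_monomial_factor h0 dh.
exists e => t y; rewrite dE de map_polyZ map_polyXn hornerZ hornerXn /= mulrC.
congr (_ * _); have := dE p 1 y; rewrite de map_polyZ map_polyXn hornerZ hornerXn /=.
rewrite expr1n mulr1 => <-; apply: meval_eq => k.
by rewrite /scale_coord mul1r if_same.
Qed.

End Homogeneity.

(** * Prime ideals and their chains in a polynomial ring *)

Section Charts.
Variables (K : fieldType) (L : numFieldType) (iota : {rmorphism K -> L}).
Variables (n r : nat) (g : {mpoly L[r]}) (chart : ('I_r -> L) -> 'I_n -> L).

(** The coordinates of a chart are regular functions on the open set [g != 0];
    only the values of the chart there matter. *)
Definition rational_chart :=
  forall i, exists (M : nat) (F : {mpoly L[r]}),
    forall y, g.@[y] != 0 -> chart y i * g.@[y] ^+ M = F.@[y].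

Hypothesis chartP : rational_chart.

Lemma chart_clear_denominators (f : {mpoly K[n]}) :
  exists (M : nat) (F : {mpoly L[r]}),
    forall y, g.@[y] != 0 -> mmap iota (chart y) f * g.@[y] ^+ M = F.@[y].
Proof.
elim/mpoly_ring_ind: f => [c|i|p q [M [F FE]] [N [G GE]]|p q [M [F FE]] [N [G GE]]].
- by exists 0%N, (iota c)%:MP => y _; rewrite mmapC mevalC mulr1.
- have [M [F FE]] := chartP i; exists M, F => y /FE <-.
  by rewrite mmapX mmap1U.
- exists (M + N)%N, (F * g ^+ N + G * g ^+ M) => y gy.
  rewrite mevalD !mevalM !rmorphXn /= -(FE y gy) -(GE y gy) rmorphD exprD /=; ring.
- exists (M + N)%N, (F * G) => y gy.
  by rewrite mevalM -(FE y gy) -(GE y gy) rmorphM exprD /=; ring.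
Qed.

Definition chart_ideal : {pred {mpoly K[n]}} :=
  [pred f | `[< forall y, g.@[y] != 0 -> mmap iota (chart y) f = 0 >]].

Lemma chart_idealP f : reflect
  (forall y, g.@[y] != 0 -> mmap iota (chart y) f = 0) (f \in chart_ideal).
Proof. exact: asboolP. Qed.

(** The parameter space is irreducible, hence so is the closure of the image. This
    is how all the prime ideals below are obtained. *)
Lemma chart_ideal_prime : g != 0 -> prime_ideal chart_ideal.
Proof.
move=> g0; split; first split.
- by apply/chart_idealP => y _; rewrite rmorph0.
- apply/negP => /chart_idealP H; have [y gy] := exists_meval_neq0 g0.
  by have /eqP := H y gy; rewrite rmorph1 oner_eq0.
- move=> a u v /chart_idealP Hu /chart_idealP Hv; apply/chart_idealP => y gy.
  by rewrite rmorphD rmorphM /= Hu // Hv // mulr0 addr0.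
move=> u v /chart_idealP Huv.
have [M [F FE]] := chart_clear_denominators u.
have [N [G GE]] := chart_clear_denominators v.
have FG : F * G = 0.
  apply: (mpoly_eq0_dense g0) => y gy; rewrite mevalM -FE // -GE //.
  have := Huv y gy; rewrite rmorphM /= => uv0.
  by rewrite mulrACA uv0 mul0r.
move/eqP: FG; rewrite mulf_eq0 => /orP[] /eqP z; apply/orP; [left|right];
  apply/chart_idealP => y gy.
  have := FE y gy; rewrite z meval0 => /eqP.
  by rewrite mulf_eq0 expf_eq0 (negPf gy) andbF orbF => /eqP.
have := GE y gy; rewrite z meval0 => /eqP.
by rewrite mulf_eq0 expf_eq0 (negPf gy) andbF orbF => /eqP.
Qed.

End Charts.

Section AlgebraicDependence.
Variable K : fieldType.

Lemma leq_expl (a b n : nat) : (a <= b)%N -> (a ^ n <= b ^ n)%N.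
Proof. by move=> ab; elim: n => // n; rewrite !expnS; exact: leq_mul. Qed.

Lemma msizeM_le_pred n (p q : {mpoly K[n]}) :
  (msize (p * q)%R <= (msize p + msize q).-1)%N.
Proof.
have [->|p0] := eqVneq p 0; first by rewrite mul0r msize0.
have [->|q0] := eqVneq q 0; first by rewrite mulr0 msize0.
by rewrite msizeM.
Qed.

Lemma msize_prod_exp_le n m (f : 'I_m -> {mpoly K[n]}) (a : 'I_m -> nat) e :
  (forall i, (msize (f i) <= e.+1)%N) ->
  (msize (\prod_(i < m) f i ^+ a i)%R <= (\sum_(i < m) a i * e).+1)%N.
Proof.
move=> fe; elim/big_ind2: _ => [|x1 x2 y1 y2 h1 h2|i _]; first by rewrite msize1.
  apply: leq_trans (msizeM_le_pred _ _) _; lia.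
elim: (a i) => [|k IH]; first by rewrite expr0 msize1.
rewrite exprS; apply: leq_trans (msizeM_le_pred _ _) _.
have := fe i; rewrite mulSn; lia.
Qed.

(** The products of powers of the [f i] with exponents below [D] are [D ^ m] in
    number, and lie in a space whose dimension grows like [D ^ n]. *)
Lemma algebraic_dependence n m (f : 'I_m -> {mpoly K[n]}) : (n < m)%N ->
  exists2 Q : {mpoly K[m]}, Q != 0 & mmap (@mpolyC n K) f Q = 0.
Proof.
move=> nm.
pose e := \max_(i < m) msize (f i).
have fe i : (msize (f i) <= e.+1)%N.
  by apply: leqW; exact: (leq_bigmax (F := fun i => msize (f i)) i).
(* With exponents below [D] the products have degrees below [B], and
   [B <= (m e + 1) D] so that [B ^ n < D ^ (n + 1)]. *)
pose D := ((m * e).+1 ^ n).+1.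
pose B := (m * D * e).+1.
have DB : (B ^ n < D ^ m)%N.
  have h : (B <= (m * e).+1 * D)%N by rewrite /B -addn1; have : (1 <= D)%N by []; nia.
  have Bn : (B ^ n <= (m * e).+1 ^ n * D ^ n)%N  by rewrite -expnMn leq_expl.
  apply: leq_ltn_trans Bn _.
  have D0 : (0 < D)%N by [].
  apply: (@leq_trans (D * D ^ n)); first by rewrite ltn_pmul2r ?expn_gt0 // ltnSn.
  by rewrite -expnS leq_pexp2l.
pose A := {ffun 'I_m -> 'I_D}; pose E := {ffun 'I_n -> 'I_B}.
have cA : #|A| = (D ^ m)%N by rewrite card_ffun !card_ord.
have cE : #|E| = (B ^ n)%N by rewrite card_ffun !card_ord.
pose mon (b : E) : 'X_{1..n} := [multinom (b i : nat) | i < n].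
pose pw (a : A) := \prod_(i < m) f i ^+ a i.
pose M : 'M[K]_(#|A|, #|E|) := \matrix_(a, b) (pw (enum_val a))@_(mon (enum_val b)).
have : ~~ row_free M.
  by rewrite -row_leq_rank -ltnNge (leq_ltn_trans (rank_leq_col M)) // cA cE.
rewrite -kermx_eq0 => /rowV0Pn[c /sub_kermxP cM c0].
pose amon (a : A) : 'X_{1..m} := [multinom (a i : nat) | i < m].
have amonI : injective amon.
  move=> a a' /mnmP aa; apply/ffunP => i; apply/val_inj.
  by have := aa i; rewrite !mnmE.
exists (\sum_(a : 'I_#|A|) c 0 a *: 'X_[amon (enum_val a)]).
  have [a ca] : exists a, c 0 a != 0.
    by apply/rV0Pn.
  apply: contraNneq ca => /(congr1 (fun q => q@_(amon (enum_val a)))).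
  rewrite raddf_sum mcoeff0 (bigD1 a) //= mcoeffZ mcoeffX eqxx mulr1 big1 ?addr0 => [->//|b ba].
  rewrite mcoeffZ mcoeffX; case: eqP => [/amonI /enum_val_inj h|]; last by rewrite mulr0.
  by rewrite h eqxx in ba.
rewrite raddf_sum /=.
have pwE (a : 'I_#|A|) : mmap (@mpolyC n K) f (c 0 a *: 'X_[amon (enum_val a)]) =
    c 0 a *: pw (enum_val a).
  rewrite mmapZ mmapX mul_mpolyC /mmap1 /pw; congr (_ *: _).
  by apply: eq_bigr => i _; rewrite mnmE.
rewrite (eq_bigr _ (fun a _ => pwE a)); apply/mpolyP => mm; rewrite mcoeff0 raddf_sum /=.
have [/forallP le|/forallPn[i0 nle]] := boolP [forall i, (mm i < B)%N].
  pose b : E := [ffun i => Ordinal (le i)].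
  have bmm : mon b = mm by apply/mnmP => i; rewrite mnmE ffunE.
  transitivity ((c *m M) 0 (enum_rank b)); last by rewrite cM mxE.
  rewrite mxE.
  by apply: eq_bigr => a _; rewrite mcoeffZ !mxE enum_rankK bmm.
apply: big1 => a _; rewrite mcoeffZ; apply/eqP; rewrite mulf_eq0; apply/orP; right.
rewrite mcoeff_eq0; apply: mmeasure_mnm_ge.
apply: leq_trans (msize_prod_exp_le _ fe) _.
have mi : (mm i0 <= mdeg mm)%N by rewrite mdegE (bigD1 i0) //= leq_addr.
rewrite -leqNgt in nle; apply: leq_trans mi; apply: leq_trans nle.
rewrite /B ltnS -big_distrl /= leq_mul2r; apply/orP; right.
apply: (@leq_trans (\sum_(i < m) D)); last by rewrite sum_nat_const card_ord.
by apply: leq_sum => i _; apply: ltnW.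
Qed.

Lemma prime_idealX n (P : {pred {mpoly K[n]}}) u k :
  prime_ideal P -> u ^+ k \in P -> u \in P.
Proof.
move=> [[_ P1 _] Pm]; elim: k => [|k IH]; first by rewrite expr0 (negPf P1).
by rewrite exprS => /Pm/orP[].
Qed.

(** A dependence relation between elements picked one from each step of a chain
    of primes loses its lowest power of the first of them, then the remaining
    terms that it divides, and so becomes a relation between the others. *)
Lemma prime_chain_independent n m (Q : {mpoly K[m]}) (P : nat -> {pred {mpoly K[n]}})
    (x : nat -> {mpoly K[n]}) : Q != 0 ->
  (forall t, (t <= m)%N -> prime_ideal (P t)) ->
  (forall t, (t < m)%N -> [/\ {subset P t <= P t.+1}, x t \in P t.+1 & x t \notin P t]) ->
  mmap (@mpolyC n K) (fun i : 'I_m => x (m - i.+1)%N) Q \notin P 0%N.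
Proof.
elim: m Q P x => [|m IH] Q P x Q0 Pp Px.
  move: Q0; rewrite (nvar0_mpolyC Q) mpolyC_eq0 mmapC; set c := Q@_ _ => c0.
  have [[P0 P1 PD] _] := Pp 0%N isT; apply: contraNN P1 => Pc.
  have := PD (c^-1)%:MP _ 0 Pc P0.
  by rewrite addr0 -mpolyCM mulVf ?mpolyC1.
have [P01 x1 x0] := Px 0%N isT.
have [[P0 _ PD] _] := Pp 1%N isT.
set ev := mmap _ _ Q.
have U0 : last_uni Q != 0 by apply: contraNneq Q0 => /last_uni_eq0 ->.
have [e [q + UE]] := multiplicity_XsubC (last_uni Q) 0.
rewrite U0 /= => q0; rewrite subr0 in UE.
pose f (i : 'I_m) := x (m - i)%N.
pose mf := map_poly (mmap (@mpolyC n K) f).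
have evE : ev = (mf q).[x 0%N] * x 0%N ^+ e.
  rewrite /ev last_uniE /= subnn.
  have -> : map_poly (mmap (@mpolyC n K) (fun i : 'I_m => x (m.+1 - (lift ord_max i).+1)%N))
      (last_uni Q) = mf (last_uni Q).
    apply/polyP => k; rewrite !coef_map /=; apply: eq_bigr => mm _; congr (_ * _).
    by apply: mmap1_eq => i; rewrite /f /= /bump leqNgt ltn_ord subSS add0n.
  by rewrite UE /mf rmorphM rmorphXn /= map_polyX hornerM hornerXn.
apply/negP => evP.
have : (mf q).[x 0%N] \in P 0%N.
  rewrite evE in evP; have [_ /(_ _ _ evP)/orP[//|]] := Pp 0%N isT.
  by move=> /(prime_idealX (Pp 0%N isT)); rewrite (negPf x0).
move=> /P01 qP.
pose q1 : {mpoly K[m]} := q`_0.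
have q1P : mmap (@mpolyC n K) f q1 \in P 1%N.
  have [h hE] : exists h, (mf q).[x 0%N] = mmap (@mpolyC n K) f q1 + h * x 0%N.
    have /factor_theorem[w wE] : root (mf q - (mf q).[0]%:P) 0.
      by rewrite /root !hornerE subrr.
    exists w.[x 0%N].
    have -> : mf q = (mf q).[0]%:P + w * 'X by rewrite -['X]subr0 -wE addrC subrK.
    by rewrite !hornerE horner_coef0 /mf coef_map.
  have -> : mmap (@mpolyC n K) f q1 = - h * x 0%N + (mf q).[x 0%N] by rewrite hE; ring.
  exact: PD.
have q10 : q1 != 0 by rewrite /q1 -horner_coef0.
have := IH q1 (fun t => P t.+1) (fun t => x t.+1) q10 (fun t tm => Pp t.+1 tm)
  (fun t tm => Px t.+1 tm).
have -> : mmap (@mpolyC n K) (fun i : 'I_m => x (m - i.+1).+1) q1 = mmap (@mpolyC n K) f q1.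
  apply: eq_bigr => mm _; congr (_ * _); apply: mmap1_eq => i.
  by rewrite /f -subSn ?subSS //.
by rewrite q1P.
Qed.

(** Elements chosen in the steps of such a chain would be algebraically independent. *)
Lemma no_long_prime_chain n (P : nat -> {pred {mpoly K[n]}}) :
  (forall t, (t <= n.+1)%N -> prime_ideal (P t)) ->
  (forall t, (t < n.+1)%N ->
     {subset P t <= P t.+1} /\ exists2 p, p \in P t.+1 & p \notin P t) -> False.
Proof.
move=> Pp Pi.
have [x xP] : exists x : nat -> {mpoly K[n]}, forall t, (t < n.+1)%N ->
    x t \in P t.+1 /\ x t \notin P t.
  have H t : exists y, (t < n.+1)%N -> y \in P t.+1 /\ y \notin P t.
    have [/Pi[_ [y y1 y0]]|] := boolP (t < n.+1)%N; first by exists y.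
    by exists 0.
  by have [x xP] := choice H; exists x.
have [Q Q0 QE] := algebraic_dependence (fun i : 'I_n.+1 => x (n.+1 - i.+1)%N) (ltnSn n).
have := prime_chain_independent Q0 Pp (x := x); rewrite QE => H.
have [[P0 _ _] _] := Pp 0%N isT.
suff: 0 \notin P 0%N by rewrite P0.
by apply: H => t tn; have [? ?] := xP t tn; have [? _] := Pi t tn.
Qed.

End AlgebraicDependence.

(** * Affine schemes and their points *)

Section PointValues.
Variables (K L : fieldType) (iota : {rmorphism K -> L}).

Lemma mmap_comp_mpoly n m (F : n.-tuple {mpoly K[m]}) v (p : {mpoly K[n]}) :
  mmap iota v (p \mPo F) = mmap iota (fun i => mmap iota v (tnth F i)) p.
Proof.
elim/mpoly_ring_ind: p => [c|i|p q IHp IHq|p q IHp IHq].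
- by rewrite comp_mpolyC !mmapC.
- by rewrite comp_mpolyXU mmapX mmap1U -tnth_nth.
- by rewrite comp_mpolyD !mmapD IHp IHq.
- by rewrite !rmorphM /= IHp IHq.
Qed.

Lemma eq_mmap n (v w : 'I_n -> L) (p : {mpoly K[n]}) :
  v =1 w -> mmap iota v p = mmap iota w p.
Proof. by move=> vw; apply: eq_bigr => m _; rewrite (mmap1_eq _ vw). Qed.

Lemma mmapXU n (v : 'I_n -> L) i : mmap iota v ('X_i : {mpoly K[n]}) = v i.
Proof. by rewrite mmapX mmap1U. Qed.

Lemma mwidenXU n (i : 'I_n) : mwiden ('X_i : {mpoly K[n]}) = 'X_(widen_ord (leqnSn n) i).
Proof. by rewrite /mwiden mmapX mmap1U. Qed.

Lemma mmap_mwiden n (v : 'I_n.+1 -> L) (p : {mpoly K[n]}) :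
  mmap iota v (mwiden p) = mmap iota (fun i => v (widen_ord (leqnSn n) i)) p.
Proof.
elim/mpoly_ring_ind: p => [c|i|p q IHp IHq|p q IHp IHq].
- by rewrite mwidenC !mmapC.
- by rewrite mwidenXU !mmapXU.
- by rewrite mwidenD !mmapD IHp IHq.
- by rewrite mwidenM !rmorphM /= IHp IHq.
Qed.

Definition on_points (X : affine_scheme K) (v : 'I_(ambient X) -> L) : Prop :=
  forall e, e \in equations X -> mmap iota v e = 0.

Arguments on_points : clear implicits.

(** The conclusion of the Nullstellensatz for a radical ideal. *)
Definition detected_by_points (X : affine_scheme K) : Prop :=
  forall h, (forall v, on_points X v -> mmap iota v h = 0) -> h \in defining_ideal X.

Lemma ideal_on_points X v h : on_points X v -> h \in defining_ideal X -> mmap iota v h = 0.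
Proof.
move=> Xv /ideal_genP[q ->]; rewrite rmorph_sum big1 // => i _.
by rewrite rmorphM /= (Xv _ (mem_nth _ (ltn_ord i))) mulr0.
Qed.

(** With the ideals detected by points, an isomorphism is a pair of inverse
    polynomial bijections between the sets of points. *)
Lemma isomorphic_by_points (X Y : affine_scheme K)
    (F : (ambient Y).-tuple {mpoly K[ambient X]})
    (G : (ambient X).-tuple {mpoly K[ambient Y]}) :
  detected_by_points X -> detected_by_points Y ->
  (forall v, on_points X v -> on_points Y (fun j => mmap iota v (tnth F j))) ->
  (forall w, on_points Y w -> on_points X (fun i => mmap iota w (tnth G i))) ->
  (forall v, on_points X v -> forall i,
     mmap iota (fun j => mmap iota v (tnth F j)) (tnth G i) = v i) ->
  (forall w, on_points Y w -> forall j,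
     mmap iota (fun i => mmap iota w (tnth G i)) (tnth F j) = w j) ->
  isomorphic X Y.
Proof.
move=> dX dY FXY GYX GF FG; exists F, G; split.
- move=> p pY; apply: dX => v Xv; rewrite mmap_comp_mpoly.
  by apply: ideal_on_points pY; exact: FXY.
- move=> p pX; apply: dY => v Yv; rewrite mmap_comp_mpoly.
  by apply: ideal_on_points pX; exact: GYX.
- by move=> i; apply: dX => v Xv; rewrite mmapB mmap_comp_mpoly mmapXU GF ?subrr.
- by move=> j; apply: dY => v Yv; rewrite mmapB mmap_comp_mpoly mmapXU FG ?subrr.
Qed.

Lemma on_principal_open (X : affine_scheme K) (f : {mpoly K[ambient X]})
    (v : 'I_(ambient X).+1 -> L) :
  on_points (principal_open f) v <->
  on_points X (fun i => v (widen_ord (leqnSn _) i)) /\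
  mmap iota (fun i => v (widen_ord (leqnSn _) i)) f * v ord_max = 1.
Proof.
split=> [Xv|[Xv fv] e]; first split.
- move=> e eX; rewrite -mmap_mwiden; apply: Xv.
  by rewrite /= mem_rcons inE map_f ?orbT.
- have := Xv (mwiden f * 'X_ord_max - 1); rewrite /= mem_rcons inE eqxx => /(_ isT)/eqP.
  by rewrite mmapB rmorphM rmorph1 /= mmap_mwiden mmapXU subr_eq0 => /eqP.
rewrite /= mem_rcons inE => /orP[/eqP ->|/mapP[e' e'X ->]].
  by rewrite mmapB rmorphM rmorph1 /= mmap_mwiden mmapXU fv subrr.
by rewrite mmap_mwiden; exact: Xv.
Qed.

(** After multiplication by a power of [f], which is invertible on the open
    subscheme, a function comes from [X]; a multiple of [f] then vanishes on [X]. *)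
Lemma principal_open_detected (X : affine_scheme K) (f : {mpoly K[ambient X]}) :
  detected_by_points X -> detected_by_points (principal_open f).
Proof.
move=> dX h hv; rewrite /defining_ideal.
set I := ideal_gen _; pose T : {mpoly K[(ambient X).+1]} := 'X_ord_max.
have fT : mwiden f * T - 1 \in I by apply: mem_ideal_gen; rewrite mem_rcons inE eqxx.
have wI p : p \in defining_ideal X -> mwiden p \in I.
  apply: (ideal_gen_map (phi := @mwiden _ _)) => e eX; apply: mem_ideal_gen.
  by rewrite mem_rcons inE map_f ?orbT.
have [N [H NH]] : exists N H, mwiden f ^+ N * h - mwiden H \in I.
  elim/mpoly_ring_ind: {hv}h => [c|i|p q [N [F FE]] [M [G GE]]|p q [N [F FE]] [M [G GE]]].
  - by exists 0%N, c%:MP; rewrite mwidenC expr0 mul1r subrr ideal_gen0.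
  - case: (unliftP ord_max i) => [j ->|->]; last by exists 1%N, 1; rewrite mwiden1.
    exists 0%N, 'X_j; rewrite mwidenXU expr0 mul1r.
    suff -> : lift ord_max j = widen_ord (leqnSn _) j by rewrite subrr ideal_gen0.
    by apply/val_inj; rewrite /= /bump leqNgt ltn_ord.
  - exists (N + M)%N, (f ^+ M * F + f ^+ N * G).
    rewrite mwidenD !mwidenM !rmorphXn /=.
    have -> : mwiden f ^+ (N + M) * (p + q) - (mwiden f ^+ M * mwiden F + mwiden f ^+ N * mwiden G) =
      mwiden f ^+ M * (mwiden f ^+ N * p - mwiden F) + mwiden f ^+ N * (mwiden f ^+ M * q - mwiden G).
      by rewrite exprD; ring.
    by apply: ideal_genD; exact: ideal_genMl.
  - exists (N + M)%N, (F * G); rewrite mwidenM.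
    have -> : mwiden f ^+ (N + M) * (p * q) - mwiden F * mwiden G =
      (mwiden f ^+ N * p) * (mwiden f ^+ M * q - mwiden G) + mwiden G * (mwiden f ^+ N * p - mwiden F).
      by rewrite exprD; ring.
    by apply: ideal_genD; exact: ideal_genMl.
have fH : f * H \in defining_ideal X.
  apply: dX => v Xv; rewrite rmorphM /=.
  have [->|fv] := eqVneq (mmap iota v f) 0; first by rewrite mul0r.
  pose w (i : 'I_(ambient X).+1) := if unlift ord_max i is Some j then v j else (mmap iota v f)^-1.
  have wv i : w (widen_ord (leqnSn _) i) = v i.
    suff -> : widen_ord (leqnSn _) i = lift ord_max i by rewrite /w liftK.
    by apply/val_inj; rewrite /= /bump leqNgt ltn_ord.
  have Xw : on_points (principal_open f) w.
    apply/on_principal_open; rewrite (eq_mmap _ wv) {2}/w unlift_none mulfV //; split=> // e eX.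
    by rewrite (eq_mmap _ wv) Xv.
  have := ideal_on_points Xw NH.
  rewrite mmapB rmorphM /= hv // mulr0 sub0r mmap_mwiden (eq_mmap _ wv) => /eqP.
  by rewrite oppr_eq0 => /eqP ->; rewrite mulr0.
have kI : mwiden f ^+ N.+1 * h \in I.
  have -> : mwiden f ^+ N.+1 * h = mwiden f * (mwiden f ^+ N * h - mwiden H) + mwiden (f * H).
    by rewrite mwidenM exprS; ring.
  by apply: ideal_genD; [exact: ideal_genMl | exact: wI].
have -> : h = T ^+ N.+1 * (mwiden f ^+ N.+1 * h) - h * ((mwiden f * T) ^+ N.+1 - 1).
  by rewrite exprMn; ring.
apply: ideal_genB; first exact: ideal_genMl.
by apply: ideal_genMl; rewrite subrX1; apply: ideal_genMr.
Qed.

End PointValues.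
Arguments on_points {K L} iota X v.
Arguments detected_by_points {K L} iota X.

Lemma meval_map_mpoly (K L : fieldType) (iota : {rmorphism K -> L}) n v (h : {mpoly K[n]}) :
  (map_mpoly iota h).@[v] = mmap iota v h.
Proof.
elim/mpoly_ring_ind: h => [c|i|p q IHp IHq|p q IHp IHq].
- by rewrite map_mpolyC mevalC mmapC.
- by rewrite map_mpolyX mevalXU mmapXU.
- by rewrite rmorphD mevalD mmapD IHp IHq.
- by rewrite rmorphM mevalM rmorphM /= IHp IHq.
Qed.

Lemma mmap_eq0_dense (K : fieldType) (L : numFieldType) (iota : {rmorphism K -> L}) n
    (g : {mpoly L[n]}) (h : {mpoly K[n]}) : g != 0 ->
  (forall v, g.@[v] != 0 -> mmap iota v h = 0) -> h = 0.
Proof.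
move=> g0 gh; have : map_mpoly iota h = 0.
  by apply: (mpoly_eq0_dense g0) => v gv; rewrite meval_map_mpoly gh.
move=> z; apply/mpolyP => m; rewrite mcoeff0; apply: (fmorph_inj iota).
by rewrite -mcoeff_map_mpoly z mcoeff0 rmorph0.
Qed.

Lemma affine_space_detected (K : fieldType) (L : numFieldType) (iota : {rmorphism K -> L}) n :
  detected_by_points iota (affine_space K n).
Proof.
move=> h hv; suff -> : h = 0 by exact: ideal_gen0.
by apply: (mmap_eq0_dense (iota := iota) (oner_neq0 _)) => v _; apply: hv => e; rewrite in_nil.
Qed.

(** * The variety *)

(** Both factors are nonnegative on [[1, 2]], and the roots [1, 2, i, -i] of the
    product are simple and have no symmetry of the form [s |-> lambda s^(+-1)]
    (see [roots_rigid]). The factor [s^2 + 1] is a norm, which keeps the variety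
    rational, and spoils that symmetry. *)
Definition P1 (A : comNzRingType) (s : A) : A := s - 1.
Definition P2 (A : comNzRingType) (s : A) : A := (2%:R - s) * (s ^+ 2 + 1).

Lemma rmorph_P1 (A B : comNzRingType) (f : {rmorphism A -> B}) s : f (P1 s) = P1 (f s).
Proof. by rewrite /P1 rmorphB rmorph1. Qed.

Lemma rmorph_P2 (A B : comNzRingType) (f : {rmorphism A -> B}) s : f (P2 s) = P2 (f s).
Proof. by rewrite /P2 rmorphM rmorphB rmorph_nat rmorphD rmorphXn rmorph1. Qed.

Section Coordinates.
Variable k : nat.

(** The ambient coordinates are [x], [y], the inverse [tau] of [s_0 ... s_k], the
    fibre coordinates [u] and [v], and [s_0, ..., s_k]. *)
Definition ix : 'I_(5 + k.+1) := lshift k.+1 (@Ordinal 5 0 isT).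
Definition iy : 'I_(5 + k.+1) := lshift k.+1 (@Ordinal 5 1 isT).
Definition it : 'I_(5 + k.+1) := lshift k.+1 (@Ordinal 5 2 isT).
Definition iu : 'I_(5 + k.+1) := lshift k.+1 (@Ordinal 5 3 isT).
Definition iv : 'I_(5 + k.+1) := lshift k.+1 (@Ordinal 5 4 isT).
Definition is_ (l : 'I_k.+1) : 'I_(5 + k.+1) := rshift 5 l.

Definition pt (T : Type) (x y t u v : T) (s : 'I_k.+1 -> T) : 'I_(5 + k.+1) -> T :=
  fun i => match split i with
    | inl j => nth x [:: x; y; t; u; v] j
    | inr l => s l
    end.

Lemma ptE (T : Type) (x y t u v : T) (s : 'I_k.+1 -> T) (p := pt x y t u v s) :
  ((p ix = x) * (p iy = y) * (p it = t) * (p iu = u) * (p iv = v) *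
  (forall l, p (is_ l) = s l))%type.
Proof.
by rewrite /p /pt /ix /iy /it /iu /iv /is_; do !split;
   rewrite ?(unsplitK (inl _)) // => l; rewrite (unsplitK (inr _)).
Qed.

Lemma ix_cases (i : 'I_(5 + k.+1)) :
  [\/ i = ix, i = iy, i = it | [\/ i = iu, i = iv | exists l, i = is_ l]].
Proof.
case: (split_ordP i) => [[j jlt] ->|l ->]; last by constructor 4; constructor 3; exists l.
case: j jlt => [|[|[|[|[|//]]]]] jlt;
  [constructor 1|constructor 2|constructor 3|constructor 4; constructor 1|
   constructor 4; constructor 2]; exact/val_inj.
Qed.

Lemma pt_eta (T : Type) (p : 'I_(5 + k.+1) -> T) :
  p =1 pt (p ix) (p iy) (p it) (p iu) (p iv) (fun l => p (is_ l)).
Proof.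
move=> i; case: (ix_cases i) => [->|->|->|[->|->|[l ->]]]; by rewrite !ptE.
Qed.

End Coordinates.

Section Base.
Variables (K : fieldType) (k : nat).
Notation N := (5 + k.+1)%N.
Notation X_ i := ('X_(i k) : {mpoly K[N]}).
Notation S_ l := ('X_(is_ l) : {mpoly K[N]}).

Definition circle_eq : {mpoly K[N]} :=
  X_ ix ^+ 2 + X_ iy ^+ 2 - P1 (S_ ord0) * P2 (S_ ord0).
Definition torus_eq : {mpoly K[N]} := X_ it * (\prod_l S_ l) - 1.

Definition sphere_torus_plane : affine_scheme K :=
  AffineScheme [:: circle_eq; torus_eq].
Notation X := sphere_torus_plane.

Lemma circle_eq_in : circle_eq \in defining_ideal X.
Proof. by apply: mem_ideal_gen; rewrite inE eqxx. Qed.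

Lemma torus_eq_in : torus_eq \in defining_ideal X.
Proof. by apply: mem_ideal_gen; rewrite !inE eqxx orbT. Qed.

Section Points.
Variables (L : fieldType) (iota : {rmorphism K -> L}).

Lemma mmap_circle_eq v : mmap iota v circle_eq =
  v (ix k) ^+ 2 + v (iy k) ^+ 2 - P1 (v (is_ ord0)) * P2 (v (is_ ord0)).
Proof.
by rewrite /circle_eq rmorphB rmorphD !rmorphXn rmorphM rmorph_P1 rmorph_P2 /= !mmapXU.
Qed.

Lemma mmap_torus_eq v : mmap iota v torus_eq = v (it k) * (\prod_l v (is_ l)) - 1.
Proof.
rewrite /torus_eq rmorphB rmorphM rmorph_prod rmorph1 /= mmapXU.
by under eq_bigr do rewrite mmapXU.
Qed.

Lemma on_X v : on_points iota X v <->
  v (ix k) ^+ 2 + v (iy k) ^+ 2 = P1 (v (is_ ord0)) * P2 (v (is_ ord0)) /\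
  v (it k) * (\prod_l v (is_ l)) = 1.
Proof.
split=> [Xv|[e1 e2] e].
  split; apply/eqP; rewrite -subr_eq0 -?mmap_circle_eq -?mmap_torus_eq Xv //.
    by rewrite inE eqxx.
  by rewrite !inE eqxx orbT.
rewrite !inE => /orP[]/eqP ->; rewrite ?mmap_circle_eq ?mmap_torus_eq ?e1 ?e2 subrr //.
Qed.
End Points.

Definition kill : N.-tuple {mpoly K[N]} :=
  [tuple if (i == ix k) || (i == it k) then 0 else 'X_i | i < N].
(** The polynomials that involve neither [x] nor [tau]. *)
Let free a := a \mPo kill = a.

Let freeD a b : free a -> free b -> free (a + b).
Proof. by rewrite /free comp_mpolyD => -> ->. Qed.
Let freeM a b : free a -> free b -> free (a * b).
Proof. by rewrite /free rmorphM /= => -> ->. Qed.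
Let freeC c : free c%:MP.
Proof. by rewrite /free comp_mpolyC. Qed.
Let freeX i : i != ix k -> i != it k -> free 'X_i.
Proof.
by move=> ixi iti; rewrite /free comp_mpolyXU -tnth_nth tnth_mktuple (negPf ixi) (negPf iti).
Qed.
Let free1 : free 1.
Proof. by rewrite -mpolyC1. Qed.
Let free0 : free 0.
Proof. by rewrite -mpolyC0. Qed.
Let freeS l : free (S_ l).
Proof. by apply: freeX. Qed.
Let freeN a : free a -> free (- a).
Proof. by rewrite /free comp_mpolyN => ->. Qed.
Let freeE a n : free a -> free (a ^+ n).
Proof. by rewrite /free rmorphXn /= => ->. Qed.
Let sigma : {mpoly K[N]} := \prod_l S_ l.
Let free_sigma : free sigma.
Proof. by rewrite /free rmorph_prod; apply: eq_bigr => l _; exact: freeS. Qed.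
Let xx : {mpoly K[N]} := P1 (S_ ord0) * P2 (S_ ord0) - X_ iy ^+ 2.
Let free_xx : free xx.
Proof.
have f2 : free 2%:R by rewrite -mpolyC_nat.
apply: freeD; last by apply/freeN/freeE/freeX.
apply: freeM; first by apply: freeD => //; exact: freeN.
by apply: freeM; apply: freeD => //; [exact: freeN | exact: freeE].
Qed.

(** The first equation is monic in [x], and the second one inverts [sigma]. *)
Let reduce f : exists n a b, [/\ free a, free b &
  sigma ^+ n * f - (a + X_ ix * b) \in defining_ideal X].
Proof.
elim/mpoly_ring_ind: f => [c|i|p q [n [a [b [fa fb E]]]] [m [c [d [fc fd F]]]]|
    p q [n [a [b [fa fb E]]]] [m [c [d [fc fd F]]]]].
- exists 0%N, c%:MP, 0; split=> //.
  by rewrite expr0 mul1r mulr0 addr0 subrr ideal_gen0.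
- have [->|ixi] := eqVneq i (ix k).
    exists 0%N, 0, 1; split=> //.
    by rewrite expr0 mul1r mulr1 add0r subrr ideal_gen0.
  have [->|iti] := eqVneq i (it k).
    exists 1%N, 1, 0; split=> //.
    by rewrite expr1 mulr0 addr0 mulrC; exact: torus_eq_in.
  exists 0%N, 'X_i, 0; split=> //; first exact: freeX.
  by rewrite expr0 mul1r mulr0 addr0 subrr ideal_gen0.
- exists (n + m)%N, (sigma ^+ m * a + sigma ^+ n * c), (sigma ^+ m * b + sigma ^+ n * d).
  split; try by apply: freeD; apply: freeM => //; exact: freeE.
  have -> : sigma ^+ (n + m) * (p + q) - (sigma ^+ m * a + sigma ^+ n * c +
      X_ ix * (sigma ^+ m * b + sigma ^+ n * d)) =
    sigma ^+ m * (sigma ^+ n * p - (a + X_ ix * b)) +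
    sigma ^+ n * (sigma ^+ m * q - (c + X_ ix * d)) by rewrite exprD; ring.
  by apply: ideal_genD; exact: ideal_genMl.
- exists (n + m)%N, (a * c + xx * (b * d)), (a * d + b * c).
  split.
  + by apply: freeD; apply: freeM => //; exact: freeM.
  + by apply: freeD; exact: freeM.
  + have -> : sigma ^+ (n + m) * (p * q) - (a * c + xx * (b * d) + X_ ix * (a * d + b * c)) =
      sigma ^+ n * p * (sigma ^+ m * q - (c + X_ ix * d)) +
      (c + X_ ix * d) * (sigma ^+ n * p - (a + X_ ix * b)) + (b * d) * circle_eq.
      by rewrite exprD /circle_eq /xx; ring.
    apply: ideal_genD; last exact/ideal_genMl/circle_eq_in.
    by apply: ideal_genD; exact: ideal_genMl.
Qed.

Variables (L : numClosedFieldType) (iota : {rmorphism K -> L}).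

Let free_eval a (v w : 'I_N -> L) : free a ->
  (forall i, i != ix k -> i != it k -> v i = w i) -> mmap iota v a = mmap iota w a.
Proof.
move=> fa vw; rewrite -fa !mmap_comp_mpoly; apply: eq_mmap => i; rewrite tnth_mktuple.
case: ifP => [_|/norP[ixi iti]]; first by rewrite !rmorph0.
by rewrite !mmapXU vw.
Qed.

Let Q : {mpoly L[N]} := P1 'X_(is_ ord0) * P2 'X_(is_ ord0).
Let QE v : Q.@[v] = P1 (v (is_ ord0)) * P2 (v (is_ ord0)).
Proof. by rewrite /Q mevalM rmorph_P1 rmorph_P2 /= mevalXU. Qed.

(** A point of the open set [P1 P2 != 0], which shows that it is not empty. *)
Lemma P1P2_3_neq0 : P1 (3%:R : L) * P2 3%:R != 0.
Proof.
have -> : P1 (3%:R : L) * P2 3%:R = - 20%:R by rewrite /P1 /P2; ring.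
by rewrite oppr_eq0 pnatr_eq0.
Qed.

(** Up to a power of the unit [s_0 .. s_k], a function on [X] is [a + x b] with
    [a] and [b] in the remaining coordinates; its values at the two points with
    opposite [x] then determine [a] and [b]. *)
Lemma X_ideal_of_points h :
  (forall v, on_points iota X v -> P1 (v (is_ ord0)) * P2 (v (is_ ord0)) != 0 ->
     mmap iota v h = 0) ->
  h \in defining_ideal X.
Proof.
move=> hv; have [n [a [b [fa fb E]]]] := reduce h.
pose G : {mpoly L[N]} := Q * \prod_l 'X_(is_ l).
have GE v : G.@[v] = P1 (v (is_ ord0)) * P2 (v (is_ ord0)) * \prod_l v (is_ l).
  by rewrite mevalM QE rmorph_prod; congr (_ * _); apply: eq_bigr => l _; rewrite /= mevalXU.
pose H : {mpoly L[N]} := G * (Q - 'X_(iy k) ^+ 2).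
have HE v : H.@[v] = G.@[v] * (P1 (v (is_ ord0)) * P2 (v (is_ ord0)) - v (iy k) ^+ 2).
  by rewrite mevalM mevalB QE rmorphXn /= mevalXU.
pose w0 : 'I_N -> L := pt 0 0 0 0 0 (fun=> 3%:R).
have Gw0 : G.@[w0] != 0.
  rewrite GE /w0 !ptE mulf_neq0 ?P1P2_3_neq0 //.
  by apply/prodf_neq0 => l _; rewrite ptE pnatr_eq0.
have G0 : G != 0 by apply: contraNneq Gw0 => ->; rewrite meval0.
have H0 : H != 0.
  suff: H.@[w0] != 0 by apply: contraNneq => ->; rewrite meval0.
  by rewrite HE mulf_neq0 // /w0 !ptE expr0n subr0 P1P2_3_neq0.
have key w : G.@[w] != 0 -> mmap iota w a = 0 /\
    (P1 (w (is_ ord0)) * P2 (w (is_ ord0)) - w (iy k) ^+ 2) * mmap iota w b = 0.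
  rewrite GE mulf_eq0 => /norP[Pw sw].
  pose r := sqrtC (P1 (w (is_ ord0)) * P2 (w (is_ ord0)) - w (iy k) ^+ 2).
  have rr : r ^+ 2 = P1 (w (is_ ord0)) * P2 (w (is_ ord0)) - w (iy k) ^+ 2 by exact: sqrtCK.
  pose v x : 'I_N -> L := pt x (w (iy k)) (\prod_l w (is_ l))^-1 (w (iu k)) (w (iv k))
    (fun l => w (is_ l)).
  have vw x i : i != ix k -> i != it k -> w i = v x i.
    by case: (ix_cases i) => [->|->|->|[->|->|[l ->]]]; rewrite ?eqxx // /v !ptE.
  have Ex x : x ^+ 2 = r ^+ 2 -> mmap iota w a + x * mmap iota w b = 0.
    move=> xr; have Xv : on_points iota X (v x).
      apply/on_X; rewrite /v !ptE xr rr subrK; split=> //.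
      by under [X in _ * X]eq_bigr do rewrite ptE; rewrite mulVf.
    have := ideal_on_points Xv E; rewrite rmorphB rmorphM rmorphD rmorphM /= hv //; last first.
      by rewrite /v !ptE.
    rewrite mulr0 sub0r mmapXU {2}/v ptE -(free_eval fa (@vw x)) -(free_eval fb (@vw x)).
    by move/eqP; rewrite oppr_eq0 => /eqP.
  have e1 := Ex r erefl; have e2 := Ex (- r) (sqrrN _).
  have a0 : mmap iota w a = 0.
    have : (mmap iota w a) *+ 2 = (mmap iota w a + r * mmap iota w b) +
       (mmap iota w a + - r * mmap iota w b) by ring.
    by rewrite e1 e2 addr0 => /eqP; rewrite mulrn_eq0 /= => /eqP.
  by split=> //; move: e1; rewrite -rr expr2 -mulrA a0 add0r => ->; rewrite mulr0.
have a0 : a = 0 by apply: (mmap_eq0_dense (iota := iota) G0) => w gw; have [] := key w gw.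
have b0 : b = 0.
  apply: (mmap_eq0_dense (iota := iota) H0) => w; rewrite HE mulf_eq0 => /norP[/key[_ bw] dw].
  by move/eqP: bw; rewrite mulf_eq0 (negPf dw) => /eqP.
rewrite a0 b0 mulr0 addr0 subr0 in E.
have -> : h = X_ it ^+ n * (sigma ^+ n * h) - h * ((X_ it * sigma) ^+ n - 1).
  by rewrite exprMn; ring.
apply: ideal_genB; apply: ideal_genMl => //.
by rewrite subrX1; apply/ideal_genMr/torus_eq_in.
Qed.

Lemma X_detected : detected_by_points iota X.
Proof. by move=> h hv; apply: X_ideal_of_points => v Xv _; exact: hv. Qed.

End Base.

(** * Irreducibility and dimension *)

Lemma eq_prime_ideal (K : fieldType) n (P Q : {pred {mpoly K[n]}}) :
  P =i Q -> prime_ideal P -> prime_ideal Q.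
Proof.
move=> PQ [[P0 P1 PD] Pm]; split; first split; rewrite -?PQ //.
  by move=> a u v; rewrite -!PQ; exact: PD.
by move=> u v; rewrite -!PQ; exact: Pm.
Qed.

Lemma rational_chart_comp (L : numFieldType) n r r' (g : {mpoly L[r]})
    (chart : ('I_r -> L) -> 'I_n -> L) (T : r.-tuple {mpoly L[r']}) :
  rational_chart g chart ->
  rational_chart (g \mPo T) (fun y => chart (fun i => (tnth T i).@[y])).
Proof.
move=> gc i; have [M [F FE]] := gc i; exists M, (F \mPo T) => y.
by rewrite !comp_mpoly_meval; exact: FE.
Qed.

Section Chart.
Variables (k : nat).
Definition jw : 'I_(3 + k.+1) := lshift k.+1 (@Ordinal 3 0 isT).
Definition ju : 'I_(3 + k.+1) := lshift k.+1 (@Ordinal 3 1 isT).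
Definition jv : 'I_(3 + k.+1) := lshift k.+1 (@Ordinal 3 2 isT).
Definition js (l : 'I_k.+1) : 'I_(3 + k.+1) := rshift 3 l.

Lemma jw_cases (i : 'I_(3 + k.+1)) : [\/ i = jw, i = ju | i = jv \/ exists l, i = js l].
Proof.
case: (split_ordP i) => [[j jlt] ->|l ->]; last by constructor 3; right; exists l.
by case: j jlt => [|[|[|//]]] jlt; [constructor 1|constructor 2|constructor 3; left];
  exact/val_inj.
Qed.

Definition P12 (A : comNzRingType) (s : A) : A := P1 s * P2 s.

Variable L : numClosedFieldType.

(** The point of the variety with [x + i y = w]. *)
Definition cpt (w u v : L) (s : 'I_k.+1 -> L) : 'I_(5 + k.+1) -> L :=
  pt ((w + P12 (s ord0) / w) / 2%:R) ((w - P12 (s ord0) / w) / (2%:R * 'i))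
     (\prod_l s l)^-1 u v s.

Definition sphere_chart (y : 'I_(3 + k.+1) -> L) : 'I_(5 + k.+1) -> L :=
  cpt (y jw) (y ju) (y jv) (fun l => y (js l)).

Definition chart_den : {mpoly L[3 + k.+1]} := 'X_jw * \prod_l 'X_(js l).

Lemma chart_denE y : chart_den.@[y] = y jw * \prod_l y (js l).
Proof.
rewrite /chart_den mevalM mevalXU; congr (_ * _); rewrite rmorph_prod.
by apply: eq_bigr => l _; rewrite /= mevalXU.
Qed.

Lemma sphere_chart_rational : rational_chart chart_den sphere_chart.
Proof.
have i0 : 2%:R * 'i != 0 :> L by rewrite mulf_neq0 ?pnatr_eq0 ?neq0Ci.
have t0 : 2%:R != 0 :> L by rewrite pnatr_eq0.
pose S : {mpoly L[3 + k.+1]} := \prod_l 'X_(js l).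
have SE y : S.@[y] = \prod_l y (js l).
  by rewrite /S rmorph_prod; apply: eq_bigr => l _; rewrite /= mevalXU.
pose Q : {mpoly L[3 + k.+1]} := P1 'X_(js ord0) * P2 'X_(js ord0).
have QE y : Q.@[y] = P12 (y (js ord0)).
  by rewrite /Q mevalM rmorph_P1 rmorph_P2 /= mevalXU.
move=> i; case: (ix_cases i) => [->|->|->|[->|->|[l ->]]].
- exists 1%N, ((2%:R)^-1%:MP * S * ('X_jw ^+ 2 + Q)) => y.
  rewrite chart_denE mulf_eq0 => /norP[w0 s0]; rewrite /sphere_chart /cpt ptE.
  rewrite !mevalM mevalD rmorphXn /= mevalC mevalXU SE QE.
  by field; rewrite w0.
- exists 1%N, ((2%:R * 'i)^-1%:MP * S * ('X_jw ^+ 2 - Q)) => y.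
  rewrite chart_denE mulf_eq0 => /norP[w0 s0]; rewrite /sphere_chart /cpt ptE.
  rewrite !mevalM mevalB rmorphXn /= mevalC mevalXU SE QE.
  by field; rewrite w0 neq0Ci.
- exists 1%N, 'X_jw => y.
  rewrite chart_denE mulf_eq0 => /norP[w0 s0]; rewrite /sphere_chart /cpt ptE mevalXU.
  by rewrite expr1 mulrCA mulVf // mulr1.
- by exists 0%N, 'X_ju => y _; rewrite /sphere_chart /cpt ptE mevalXU mulr1.
- by exists 0%N, 'X_jv => y _; rewrite /sphere_chart /cpt ptE mevalXU mulr1.
- by exists 0%N, 'X_(js l) => y _; rewrite /sphere_chart /cpt ptE mevalXU mulr1.
Qed.

Variables (K : fieldType) (iota : {rmorphism K -> L}).
Notation X := (sphere_torus_plane K k).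

Lemma cpt_on_X w u v s : w != 0 -> (forall l, s l != 0) -> on_points iota X (cpt w u v s).
Proof.
move=> w0 s0; apply/on_X; rewrite /cpt !ptE; split.
  have ii : ('i : L) ^+ 2 = -1 by exact: sqrCi.
  rewrite -/(P12 (s ord0)); set p := P12 _.
  rewrite !expr_div_n exprMn ii mulrN1 invrN mulrN.
  by field; rewrite w0.
under [X in _ * X]eq_bigr do rewrite ptE.
by rewrite mulVf //; apply/prodf_neq0 => l _.
Qed.

Lemma X_point_cases z : on_points iota X z -> (forall l, z (is_ l) != 0).
Proof.
move=> /on_X[_ e] l; apply/negP => /eqP z0.
by move: e; rewrite (bigD1 l) //= z0 mul0r mulr0 => /eqP; rewrite eq_sym oner_eq0.
Qed.

(** [x^2 + y^2] factors as [(x + i y) (x - i y)]. *)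
Lemma X_w_wbar z : on_points iota X z ->
  (z (ix k) + 'i * z (iy k)) * (z (ix k) - 'i * z (iy k)) = P12 (z (is_ ord0)).
Proof.
move=> /on_X[e _]; rewrite /P12 -e.
transitivity (z (ix k) ^+ 2 - 'i ^+ 2 * z (iy k) ^+ 2); first by ring.
by rewrite sqrCi; ring.
Qed.

Lemma X_point_cpt z : on_points iota X z -> z (ix k) + 'i * z (iy k) != 0 ->
  z =1 cpt (z (ix k) + 'i * z (iy k)) (z (iu k)) (z (iv k)) (fun l => z (is_ l)).
Proof.
move=> Xz w0 i; rewrite [LHS]pt_eta /cpt; have E := X_w_wbar Xz.
have i0 : 'i != 0 :> L by exact: neq0Ci.
case: (ix_cases i) => [->|->|->|[->|->|[l ->]]]; rewrite !ptE //.
- by rewrite -E mulrAC mulfV // mul1r; field.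
- by rewrite -E mulrAC mulfV // mul1r; field.
- have /on_X[_ e] := Xz; have s0 : \prod_l z (is_ l) != 0.
    by apply: contra_eq_neq e => ->; rewrite mulr0 eq_sym oner_neq0.
  by apply: (mulIf s0); rewrite mulVf.
Qed.

(** The chart covers the points with [w != 0], in particular all those over
    [P1 P2 != 0], which determine the ideal. *)
Lemma X_ideal_chart : defining_ideal X =i chart_ideal iota chart_den sphere_chart.
Proof.
move=> f; apply/idP/idP => [fX|/chart_idealP fX].
  apply/chart_idealP => y; rewrite chart_denE mulf_eq0 => /norP[w0 /prodf_neq0 s0].
  by apply: (ideal_on_points (iota := iota)) fX; apply: cpt_on_X => // l; exact: s0.
apply: (X_ideal_of_points (iota := iota)) => z Xz P0.
have E := X_w_wbar Xz; have w0 : z (ix k) + 'i * z (iy k) != 0.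
  by apply: contra_neq P0 => w0; rewrite -/(P12 _) -E w0 mul0r.
pose y : 'I_(3 + k.+1) -> L := fun i => match split i with
  | inl j => nth 0 [:: z (ix k) + 'i * z (iy k); z (iu k); z (iv k)] j
  | inr l => z (is_ l) end.
have yE : [/\ y jw = z (ix k) + 'i * z (iy k), y ju = z (iu k), y jv = z (iv k) &
    forall l, y (js l) = z (is_ l)].
  by split=> [|||l]; rewrite /y /jw /ju /jv /js ?(unsplitK (inl _)) ?(unsplitK (inr _)).
have [yw yu yv ys] := yE.
rewrite (eq_mmap _ _ (X_point_cpt Xz w0)) -yw -yu -yv.
have -> : (fun l => z (is_ l)) = (fun l => y (js l)) by apply/funext => l; rewrite ys.
apply: fX; rewrite chart_denE yw mulf_neq0 //; apply/prodf_neq0 => l _.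
by rewrite ys; exact: X_point_cases Xz l.
Qed.

Lemma chart_den_neq0 : chart_den != 0.
Proof.
suff: chart_den.@[fun=> 1] != 0 by apply: contraNneq => ->; rewrite meval0.
by rewrite chart_denE big1 ?mulr1 ?oner_neq0.
Qed.

Lemma X_integral : is_integral X.
Proof.
apply: (eq_prime_ideal (P := chart_ideal iota chart_den sphere_chart)).
  by move=> f; rewrite X_ideal_chart.
by apply: chart_ideal_prime; [exact: sphere_chart_rational | exact: chart_den_neq0].
Qed.

(** Specialising the coordinates [w, u, v, s_0, ..., s_k] of the chart one after
    the other gives a chain of irreducible closed subsets. *)
Definition special (i : 'I_(3 + k.+1)) : L :=
  if split i is inl j then (j == 0 :> nat)%:R else 1.

Definition specialisation (t : nat) : (3 + k.+1).-tuple {mpoly L[3 + k.+1]} :=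
  [tuple if (i < t)%N then (special i)%:MP else 'X_i | i < 3 + k.+1].

Definition special_chart t (y : 'I_(3 + k.+1) -> L) : 'I_(5 + k.+1) -> L :=
  sphere_chart (fun i => (tnth (specialisation t) i).@[y]).

Lemma specialE t y i : (tnth (specialisation t) i).@[y] = if (i < t)%N then special i else y i.
Proof. by rewrite tnth_mktuple; case: ifP => _; rewrite ?mevalC ?mevalXU. Qed.

Definition special_den t : {mpoly L[3 + k.+1]} := chart_den \mPo specialisation t.

Lemma special_values : [/\ special jw = 1, special ju = 0, special jv = 0 &
  forall l, special (js l) = 1].
Proof.
by split=> [|||l]; rewrite /special /jw /ju /jv /js ?(unsplitK (inl _)) ?(unsplitK (inr _)).
Qed.

Lemma special_den1 t : (special_den t).@[fun=> 1] != 0.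
Proof.
have [sw su sv ss] := special_values.
rewrite comp_mpoly_meval chart_denE specialE sw if_same mul1r.
by apply/prodf_neq0 => l _; rewrite specialE ss if_same oner_neq0.
Qed.

Definition special_ideal t := chart_ideal iota (special_den t) (special_chart t).

Lemma special_ideal_prime t : prime_ideal (special_ideal t).
Proof.
apply: chart_ideal_prime; first exact/rational_chart_comp/sphere_chart_rational.
by apply: contraNneq (special_den1 t) => ->; rewrite meval0.
Qed.

Lemma special_chart_on_X t y : (special_den t).@[y] != 0 -> on_points iota X (special_chart t y).
Proof.
rewrite comp_mpoly_meval chart_denE mulf_eq0 => /norP[w0 /prodf_neq0 s0].
by apply: cpt_on_X => // l; exact: s0.
Qed.

Lemma special_ideal_sub t : {subset special_ideal t <= special_ideal t.+1}.
Proof.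
move=> f /chart_idealP ft; apply/chart_idealP => y gy.
pose y' := fun i => (tnth (specialisation t.+1) i).@[y].
have yy' : (fun i => (tnth (specialisation t) i).@[y']) = y'.
  apply/funext => i; rewrite specialE; case: ifP => // it.
  by rewrite /y' specialE (leq_trans it (leqnSn t)).
have := ft y'; rewrite /special_den /special_chart !comp_mpoly_meval yy'; apply.
by move: gy; rewrite /special_den comp_mpoly_meval.
Qed.

(** The coordinates [u], [v] and [s_l - 1] separate the members of the chain, and so
    does, for [w], the polynomial [2 x - 1 - P1 P2 = (w - 1) (1 - P1 P2 / w)], which
    vanishes for [w = 1]. *)
Lemma special_ideal_strict (t : 'I_(3 + k.+1)) :
  exists2 f, f \in special_ideal t.+1 & f \notin special_ideal t.
Proof.
have [sw su sv ss] := special_values.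
pose e (i : 'I_(3 + k.+1)) : {mpoly K[5 + k.+1]} := match split i with
  | inl j => nth 0 [:: 2%:R * 'X_(ix k) - 1 - P1 'X_(is_ ord0) * P2 'X_(is_ ord0); 'X_(iu k); 'X_(iv k)] j
  | inr l => 'X_(is_ l) - 1 end.
pose y (i : 'I_(3 + k.+1)) : L := if i == t then 2%:R else special i.
have two0 : 2%:R != 0 :> L by rewrite pnatr_eq0.
have yt i : (tnth (specialisation t) i).@[y] = y i.
  by rewrite specialE /y; case: eqP => [->|]; rewrite ?ltnn ?if_same.
have gy : (special_den t).@[y] != 0.
  rewrite /special_den comp_mpoly_meval chart_denE !yt mulf_neq0 //.
    by rewrite /y sw; case: ifP => _ //; exact: oner_neq0.
  by apply/prodf_neq0 => l _; rewrite yt /y ss; case: ifP => _ //; exact: oner_neq0.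
have jus : jw != ju /\ jw != jv by [].
have eE : [/\ e jw = 2%:R * 'X_(ix k) - 1 - P1 'X_(is_ ord0) * P2 'X_(is_ ord0),
      e ju = 'X_(iu k), e jv = 'X_(iv k) & forall l, e (js l) = 'X_(is_ l) - 1].
    by split=> [|||l]; rewrite /e /jw /ju /jv /js ?(unsplitK (inl _)) ?(unsplitK (inr _)).
have [ew eu ev es] := eE.
exists (e t).
  apply/chart_idealP => z gz; rewrite /special_chart /sphere_chart.
  have zt : (tnth (specialisation t.+1) t).@[z] = special t by rewrite specialE ltnSn.
  case: (jw_cases t) zt => [->|->|[->|[l ->]]] zt.
  - rewrite ew !rmorphB rmorphM rmorphM rmorph_P1 rmorph_P2 rmorph_nat rmorph1 /= !mmapXU.
    by rewrite /cpt !ptE zt sw /P12 divr1; field.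
  - by rewrite eu mmapXU /cpt !ptE zt su.
  - by rewrite ev mmapXU /cpt !ptE zt sv.
  - by rewrite es rmorphB rmorph1 /= mmapXU /cpt !ptE zt ss subrr.
apply/chart_idealP => /(_ y gy); rewrite /special_chart.
have -> : (fun i => (tnth (specialisation t) i).@[y]) = y by apply/funext => i; exact: yt.
rewrite /sphere_chart; have yyt : y t = 2%:R by rewrite /y eqxx.
case: (jw_cases t) yyt => [tE|tE|[tE|[l tE]]]; rewrite tE => yyt.
- have ys l : y (js l) = 1 by rewrite /y tE ss.
  rewrite ew !rmorphB rmorphM rmorphM rmorph_P1 rmorph_P2 rmorph_nat rmorph1 /= !mmapXU.
  rewrite /cpt !ptE /P12 !ys yyt /P1 subrr !mul0r addr0 subr0 divff // mulr1.
  by move=> /eqP; rewrite subr_eq0 (eqr_nat _ 2 1).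
- by rewrite eu mmapXU /cpt !ptE yyt; exact/eqP.
- by rewrite ev mmapXU /cpt !ptE yyt; exact/eqP.
- rewrite es rmorphB rmorph1 /= mmapXU /cpt !ptE yyt => /eqP.
  by rewrite subr_eq0 (eqr_nat _ 2 1).
Qed.

Lemma X_prime_chain : has_prime_chain X (3 + k.+1).
Proof.
exists special_ideal; split=> t tk.
  split; first exact: special_ideal_prime.
  move=> f fX; apply/chart_idealP => y gy.
  exact: (ideal_on_points (special_chart_on_X gy) fX).
split; first exact: special_ideal_sub.
exact: (special_ideal_strict (Ordinal tk)).
Qed.

Definition tau_chart (z : 'I_(5 + k.+1) -> L) : 'I_(5 + k.+1) -> L :=
  fun i => if i == it k then (\prod_l z (is_ l))^-1 else z i.

(** A chain of primes of the coordinate ring of [X] is preceded in the polynomial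
    ring by [0] and by the ideal of the hypersurface [tau * s_0 * ... * s_k = 1]. *)
Lemma X_no_prime_chain : ~ has_prime_chain X (3 + k.+1).+1.
Proof.
move=> [P [Pp Pi]].
pose g : {mpoly L[5 + k.+1]} := \prod_l 'X_(is_ l).
have gE z : g.@[z] = \prod_l z (is_ l).
  by rewrite /g rmorph_prod; apply: eq_bigr => l _; rewrite /= mevalXU.
have g1 : g.@[fun=> 1] != 0 by rewrite gE big1 ?oner_neq0.
have gr : rational_chart g tau_chart.
  move=> i; have [->|ii] := eqVneq i (it k).
    by exists 1%N, 1 => z; rewrite /tau_chart eqxx meval1 gE expr1 => g0; rewrite mulVf.
  by exists 0%N, 'X_i => z _; rewrite /tau_chart (negPf ii) mevalXU mulr1.
pose T := chart_ideal iota g tau_chart.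
have Tp : prime_ideal T.
  by apply: chart_ideal_prime => //; apply: contraNneq g1 => ->; rewrite meval0.
have TX f : f \in T -> f \in defining_ideal X.
  move=> /chart_idealP fT; apply: (X_detected (iota := iota)) => z Xz.
  have /on_X[_ tE] := Xz.
  have s0 : \prod_l z (is_ l) != 0.
    by apply: contra_eq_neq tE => ->; rewrite mulr0 eq_sym oner_neq0.
  have -> : mmap iota z f = mmap iota (tau_chart z) f.
    apply: eq_mmap => i; rewrite /tau_chart; case: eqP => // ->.
    by apply: (mulIf s0); rewrite mulVf.
  by apply: fT; rewrite gE.
have tT : torus_eq K k \in T.
  apply/chart_idealP => z gz; rewrite mmap_torus_eq {1}/tau_chart eqxx.
  have -> : \prod_l tau_chart z (is_ l) = \prod_l z (is_ l) by apply: eq_bigr.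
  by rewrite mulVf ?subrr // -gE.
have cT : circle_eq K k \notin T.
  pose z : 'I_(5 + k.+1) -> L := pt 1 0 0 0 0 (fun=> 1).
  apply/chart_idealP => /(_ z); rewrite gE big1 ?oner_neq0 => [/(_ isT)|l _]; last by rewrite /z ptE.
  rewrite mmap_circle_eq /tau_chart /= /z !ptE /P1 subrr mul0r expr0n expr1n.
  by rewrite addr0 subr0 => /eqP; rewrite oner_eq0.
have t0 : torus_eq K k != 0.
  apply/negP => /eqP t0; have := mmap_torus_eq (k := k) iota (fun=> 0).
  by rewrite t0 rmorph0 mul0r sub0r => /eqP; rewrite eq_sym oppr_eq0 oner_eq0.
pose Z : {pred {mpoly K[5 + k.+1]}} := pred1 0.
have zp : prime_ideal Z.
  split; first split; rewrite ?inE ?eqxx ?oner_eq0 //.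
    by move=> a u v; rewrite !inE => /eqP -> /eqP ->; rewrite mulr0 addr0.
  by move=> u v; rewrite !inE mulf_eq0.
pose P' t : {pred {mpoly K[5 + k.+1]}} := match t with 0 => Z | 1 => T | t.+2 => P t end.
apply: (@no_long_prime_chain _ _ P') => [[|[|t]]|[|[|t]]] tk //=.
- by apply: (Pp t _).1.
- by split; [move=> f; rewrite inE => /eqP ->; case: Tp => [[]] | exists (torus_eq K k) => //; rewrite inE].
- split; first by move=> f /TX; exact: (Pp 0%N isT).2.
  by exists (circle_eq K k) => //; apply: (Pp 0%N isT).2; exact: circle_eq_in.
- exact: Pi.
Qed.

Lemma X_dimension : has_dimension X (4 + k).
Proof.
have -> : (4 + k = 3 + k.+1)%N by rewrite addnS.
by split; [exact: X_prime_chain | exact: X_no_prime_chain].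
Qed.

End Chart.

(** * Smoothness and rationality *)

Section Smooth.
Variables (k : nat).

Lemma mderivXU (K : nzRingType) n (i j : 'I_n) :
  ('X_i : {mpoly K[n]})^`M(j) = ((i == j)%:R : K)%:MP.
Proof.
rewrite mderivX mnm1E; case: eqP => [->|_]; last by rewrite scale0r mpolyC0.
by rewrite scale1r /= -[X in (X - _)%MM]addm0 addmC addmK mpolyX0 mpolyC1.
Qed.

Lemma complexification_X (R : realType) :
  complexification (sphere_torus_plane R k) = sphere_torus_plane R[i] k.
Proof.
rewrite /complexification /sphere_torus_plane /=; congr (AffineScheme [:: _; _]).
  rewrite /circle_eq rmorphB rmorphD !rmorphXn rmorphM rmorph_P1 rmorph_P2 /=.
  by rewrite !map_mpolyX.
rewrite /torus_eq rmorphB rmorphM rmorph_prod rmorph1 /= !map_mpolyX.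
by under eq_bigr do rewrite map_mpolyX.
Qed.

Variable K : numClosedFieldType.
Notation N := (5 + k.+1)%N.
Notation X := (sphere_torus_plane K k).

(** The derivative of [P1 P2], at a root. *)
Lemma P12_separable (s : K) : P12 s = 0 ->
  (2%:R - s) * (s ^+ 2 + 1) - (s - 1) * (s ^+ 2 + 1) + (s - 1) * (2%:R - s) * (s *+ 2) != 0.
Proof.
have nz (n : nat) : (0 < n)%N -> n%:R != 0 :> K by rewrite pnatr_eq0 -lt0n.
rewrite /P12 /P1 /P2 => /eqP; rewrite !mulf_eq0 !subr_eq0 => /or3P[/eqP ->|/eqP <-|/eqP s2].
- have -> : (2%:R - 1) * (1 ^+ 2 + 1) - (1 - 1) * (1 ^+ 2 + 1) + (1 - 1) * (2%:R - 1) * 2%:R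
    = 2%:R :> K by ring.
  exact: nz.
- have -> : (2%:R - 2%:R) * (2%:R ^+ 2 + 1) - (2%:R - 1) * (2%:R ^+ 2 + 1) +
    (2%:R - 1) * (2%:R - 2%:R) * (2%:R *+ 2) = - 5%:R :> K by ring.
  by rewrite oppr_eq0; exact: nz.
- rewrite s2 !mulr0 subr0 add0r.
  have -> : (s - 1) * (2%:R - s) * (s *+ 2) =
      (s ^+ 2 + 1) * (6%:R - s *+ 2) - 2%:R * (s + 3%:R) by ring.
  rewrite s2 mul0r sub0r oppr_eq0 mulf_neq0 ?nz //.
  apply: contra_eq_neq s2 => /eqP; rewrite addr_eq0 => /eqP ->.
  have -> : (- 3%:R) ^+ 2 + 1 = 10%:R :> K by ring.
  exact: nz.
Qed.

(** The derivative with respect to [tau] involves the second equation only, and is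
    nonzero; the differential of the first one vanishes only at [x = y = 0], over
    a multiple root of [P1 P2]. *)
Lemma X_jacobian_rank (a : 'I_N -> K) :
  (forall p, p \in equations X -> p.@[a] = 0) ->
  (\rank (@jacobian K X a) + (4 + k) = N)%N.
Proof.
move=> Xa; have {}Xa : on_points idfun X a by [].
have /on_X[e1 e2] := Xa.
have s0 : \prod_l a (is_ l) != 0.
  by apply: contra_eq_neq e2 => ->; rewrite mulr0 eq_sym oner_neq0.
suff : row_free (@jacobian K X a) by move=> /eqP ->; rewrite /= !addSn addnS.
rewrite -kermx_eq0; apply/rowV0P => c /sub_kermxP cJ.
pose r0 : 'I_(size (equations X)) := @Ordinal 2 0 isT.
pose r1 : 'I_(size (equations X)) := @Ordinal 2 1 isT.
have cE j : c 0 r0 * (circle_eq K k)^`M(j).@[a] + c 0 r1 * (torus_eq K k)^`M(j).@[a] = 0.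
  have := congr1 (fun M : 'rV_N => M 0 j) cJ; rewrite !mxE => <-.
  rewrite (bigD1 r0) //= (bigD1 r1) //= big1 ?addr0 => [|i]; first by rewrite !mxE.
  by case: i => [[|[|//]]].
have dC j : (circle_eq K k)^`M(j).@[a] = (a (ix k) *+ 2) * (ix k == j)%:R +
    (a (iy k) *+ 2) * (iy k == j)%:R -
    ((2%:R - a (is_ ord0)) * (a (is_ ord0) ^+ 2 + 1) -
     (a (is_ ord0) - 1) * (a (is_ ord0) ^+ 2 + 1) +
     (a (is_ ord0) - 1) * (2%:R - a (is_ ord0)) * (a (is_ ord0) *+ 2)) *
     (is_ (ord0 : 'I_k.+1) == j)%:R.
  have d1 : (1 : {mpoly K[N]})^`M(j) = 0 by rewrite -mpolyC1 mderivC.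
  have d2 : (2%:R : {mpoly K[N]})^`M(j) = 0 by rewrite -mpolyC_nat mderivC.
  pose S : {mpoly K[N]} := 'X_(is_ ord0).
  have dS : S^`M(j) = ((is_ ord0 == j)%:R : K)%:MP by exact: mderivXU.
  have dA1 : (S - 1)^`M(j) = ((is_ ord0 == j)%:R : K)%:MP by rewrite mderivB d1 subr0.
  have dA2 : (2%:R - S)^`M(j) = - ((is_ ord0 == j)%:R : K)%:MP by rewrite mderivB d2 sub0r dS.
  have dA3 : (S ^+ 2 + 1)^`M(j) = ((is_ ord0 == j)%:R : K)%:MP * S *+ 2.
    by rewrite mderivD d1 addr0 expr2 mderivM dS; ring.
  have -> : circle_eq K k = 'X_(ix k) * 'X_(ix k) + 'X_(iy k) * 'X_(iy k) -
    (S - 1) * ((2%:R - S) * (S ^+ 2 + 1)) by rewrite /circle_eq /P1 /P2 !expr2.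
  have e2' : (2%:R : {mpoly K[N]}).@[a] = 2%:R by exact: rmorph_nat.
  have v1 : (S - 1).@[a] = a (is_ ord0) - 1 by rewrite mevalB meval1 mevalXU.
  have v2 : (2%:R - S).@[a] = 2%:R - a (is_ ord0) by rewrite mevalB e2' mevalXU.
  have v3 : (S ^+ 2 + 1).@[a] = a (is_ ord0) ^+ 2 + 1 by rewrite mevalD meval1 rmorphXn /= mevalXU.
  have v4 : S.@[a] = a (is_ ord0) by exact: mevalXU.
  rewrite mderivB mderivD !mderivM dA1 dA2 dA3 !mderivXU.
  clear dS dA1 dA2 dA3.
  move: S (S - 1) (2%:R - S) (S ^+ 2 + 1) v1 v2 v3 v4 => A4 A1 A2 A3 v1 v2 v3 v4.
  rewrite mevalB !mevalD !mevalM mevalD !mevalM mevalN mevalMn mevalM !mevalC !mevalXU v1 v2 v3 v4.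
  by ring.
have dT : (torus_eq K k)^`M(it k).@[a] = \prod_l a (is_ l).
  have dS : (\prod_l 'X_(is_ l) : {mpoly K[N]})^`M(it k) = 0.
    elim/big_ind: _ => [|p q dp dq|l _]; first by rewrite -mpolyC1 mderivC.
      by rewrite mderivM dp dq mul0r mulr0 addr0.
    by rewrite mderivXU mpolyC0.
  rewrite /torus_eq mderivB mderivM dS mderivXU eqxx -{2}mpolyC1 mderivC mulr0 addr0 subr0.
  rewrite mpolyC1 mul1r rmorph_prod; apply: eq_bigr => l _; exact: mevalXU.
have c1 : c 0 r1 = 0.
  have := cE (it k); rewrite dC dT !mulr0 addr0 subr0 mulr0 add0r => /eqP.
  by rewrite mulf_eq0 (negPf s0) orbF => /eqP.
have c0 : c 0 r0 = 0.
  apply/eqP/negPn/negP => c0.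
  have cE0 j : (circle_eq K k)^`M(j).@[a] = 0.
    by have := cE j; rewrite c1 mul0r addr0 => /eqP; rewrite mulf_eq0 (negPf c0) => /eqP.
  have x0 : a (ix k) = 0.
    have := cE0 (ix k); rewrite dC eqxx /= !mulr0 mulr1 addr0 subr0 => /eqP.
    by rewrite mulrn_eq0 => /eqP.
  have y0 : a (iy k) = 0.
    have := cE0 (iy k); rewrite dC eqxx /= !mulr0 mulr1 add0r subr0 => /eqP.
    by rewrite mulrn_eq0 => /eqP.
  have P0 : P12 (a (is_ ord0)) = 0 by rewrite /P12 -e1 x0 y0 expr0n addr0.
  have := cE0 (is_ ord0); rewrite dC eqxx /= !mulr0 mulr1 addr0 sub0r => /eqP.
  by rewrite oppr_eq0 (negPf (P12_separable P0)).
apply/rowP => i; rewrite mxE; case: i => [[|[|//]]] il.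
  by rewrite -[RHS]c0; congr (c 0 _); exact/val_inj.
by rewrite -[RHS]c1; congr (c 0 _); exact/val_inj.
Qed.

End Smooth.

Section Rational.
Variables (k : nat) (K : fieldType) (L : numClosedFieldType) (iota : {rmorphism K -> L}).
Notation N := (5 + k.+1)%N.
Notation X := (sphere_torus_plane K k).
Notation A := (affine_space K (4 + k)).

(** A principal open subscheme has one more coordinate, placed last. *)
Definition adjoin (T : Type) n (p : 'I_n -> T) (t : T) : 'I_n.+1 -> T :=
  fun i => if unlift ord_max i is Some j then p j else t.

Lemma adjoin_widen T n (p : 'I_n -> T) t i : adjoin p t (widen_ord (leqnSn n) i) = p i.
Proof.
suff -> : widen_ord (leqnSn n) i = lift ord_max i by rewrite /adjoin liftK.
by apply/val_inj; rewrite /= /bump leqNgt ltn_ord.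
Qed.

Lemma adjoin_max T n (p : 'I_n -> T) t : adjoin p t ord_max = t.
Proof. by rewrite /adjoin unlift_none. Qed.

Lemma eq_adjoin T n (p : 'I_n -> T) t (v : 'I_n.+1 -> T) :
  (forall i, p i = v (widen_ord (leqnSn n) i)) -> t = v ord_max -> adjoin p t =1 v.
Proof.
move=> pv tv i; case: (unliftP ord_max i) => [j ->|->]; last by rewrite adjoin_max.
suff -> : lift ord_max j = widen_ord (leqnSn n) j by rewrite adjoin_widen.
by apply/val_inj; rewrite /= /bump leqNgt ltn_ord.
Qed.

Definition pa (T : Type) (a b u v : T) (s : 'I_k -> T) : 'I_(4 + k) -> T :=
  fun i => match split i with
    | inl j => nth a [:: a; b; u; v] j
    | inr l => s l
    end.
Definition ja : 'I_(4 + k) := lshift k (@Ordinal 4 0 isT).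
Definition jb : 'I_(4 + k) := lshift k (@Ordinal 4 1 isT).
Definition jc : 'I_(4 + k) := lshift k (@Ordinal 4 2 isT).
Definition jd : 'I_(4 + k) := lshift k (@Ordinal 4 3 isT).
Definition jl (l : 'I_k) : 'I_(4 + k) := rshift 4 l.

Lemma paE (T : Type) (a b u v : T) s (p := pa a b u v s) :
  ((p ja = a) * (p jb = b) * (p jc = u) * (p jd = v) * (forall l, p (jl l) = s l))%type.
Proof.
by rewrite /p /pa /ja /jb /jc /jd /jl; do !split;
   rewrite ?(unsplitK (inl _)) // => l; rewrite (unsplitK (inr _)).
Qed.

Lemma ja_cases (i : 'I_(4 + k)) : [\/ i = ja, i = jb | [\/ i = jc, i = jd | exists l, i = jl l]].
Proof.
case: (split_ordP i) => [[j jlt] ->|l ->]; last by constructor 3; constructor 3; exists l.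
by case: j jlt => [|[|[|[|//]]]] jlt; [constructor 1|constructor 2|constructor 3; constructor 1|
   constructor 3; constructor 2]; exact/val_inj.
Qed.

Definition first_then (T : Type) (s0 : T) (s : 'I_k -> T) : 'I_k.+1 -> T :=
  fun l => if unlift ord0 l is Some l' then s l' else s0.

Lemma first_then0 T s0 (s : 'I_k -> T) : first_then s0 s ord0 = s0.
Proof. by rewrite /first_then unlift_none. Qed.

Lemma first_thenS T s0 (s : 'I_k -> T) l : first_then s0 s (lift ord0 l) = s l.
Proof. by rewrite /first_then liftK. Qed.

(** The parametrisation behind rationality. Put [a + i b = (x + i y) / ((s_0 - 1) (s_0 - i))],
    so that [q = a^2 + b^2 = (2 - s_0) / (s_0 - 1)], whence [s_0 = (2 + q) / (1 + q)].
    The formulas are polynomials in the inverse [T] of [cut s_0] in one direction,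
    and in the inverse [t] of [den a b m] in the other one, where [m] stands for
    the product [s_1 ... s_k] and [inv1q] for [1 / (1 + q)]. *)
Section Formulas.
Variable C : comNzRingType.
Definition cut (s0 : C) := (s0 - 1) * (s0 ^+ 2 + 1).
Definition den (a b m : C) := (1 + (a ^+ 2 + b ^+ 2)) * (2%:R + (a ^+ 2 + b ^+ 2)) *
  ((2%:R + (a ^+ 2 + b ^+ 2)) ^+ 2 + (1 + (a ^+ 2 + b ^+ 2)) ^+ 2) * m.
Definition inv1q (a b m t : C) := (2%:R + (a ^+ 2 + b ^+ 2)) *
  ((2%:R + (a ^+ 2 + b ^+ 2)) ^+ 2 + (1 + (a ^+ 2 + b ^+ 2)) ^+ 2) * m * t.
Definition par_s (a b m t : C) := (2%:R + (a ^+ 2 + b ^+ 2)) * inv1q a b m t.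
Definition par_x (a b m t : C) := par_s a b m t * (a * inv1q a b m t) + b * inv1q a b m t.
Definition par_y (a b m t : C) := par_s a b m t * (b * inv1q a b m t) - a * inv1q a b m t.
Definition par_tau (a b m t : C) := (1 + (a ^+ 2 + b ^+ 2)) ^+ 2 *
  ((2%:R + (a ^+ 2 + b ^+ 2)) ^+ 2 + (1 + (a ^+ 2 + b ^+ 2)) ^+ 2) * t.
Definition par_cut (a b m t : C) := (1 + (a ^+ 2 + b ^+ 2)) ^+ 4 * (2%:R + (a ^+ 2 + b ^+ 2)) * m * t.
Definition ste_a (x y s0 T : C) := (x * s0 - y) * T.
Definition ste_b (x y s0 T : C) := (x + y * s0) * T.
Definition ste_den (s0 tau T : C) := (s0 - 1) ^+ 5 * tau * T.
End Formulas.

Lemma unique_inv (d t : L) : d * t = 1 -> d != 0 /\ t = d^-1.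
Proof.
move=> e; have d0 : d != 0 by apply: contra_eq_neq e => ->; rewrite mul0r eq_sym oner_neq0.
by split=> //; apply: (mulfI d0); rewrite e mulfV.
Qed.

Lemma par_on (a b m t : L) : den a b m * t = 1 ->
  [/\ par_x a b m t ^+ 2 + par_y a b m t ^+ 2 = P12 (par_s a b m t),
      par_tau a b m t * (par_s a b m t * m) = 1 &
      cut (par_s a b m t) * par_cut a b m t = 1].
Proof.
move=> /unique_inv[+ ->].
rewrite /par_x /par_y /par_s /par_tau /par_cut /inv1q /cut /P12 /P1 /P2 /den.
set q := a ^+ 2 + b ^+ 2.
rewrite !mulf_eq0 -!orbA => /norP[q1 /norP[q2 /norP[q3 m0]]].
have qE : a ^+ 2 = q - b ^+ 2 by rewrite /q addrK.
split.
- transitivity (q * ((2%:R + q) ^+ 2 + (1 + q) ^+ 2) / (1 + q) ^+ 4).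
    by rewrite /q; field; rewrite -/q q1 q2 q3 m0.
  by field; rewrite q1 q2 q3 m0.
- by field; rewrite q1 q2 q3 m0.
- by field; rewrite q1 q2 q3 m0.
Qed.

Lemma ste_par (a b m t : L) : den a b m * t = 1 ->
  let s := par_s a b m t in let x := par_x a b m t in let y := par_y a b m t in
  let T := par_cut a b m t in
  [/\ ste_a x y s T = a, ste_b x y s T = b & ste_den s (par_tau a b m t) T = t].
Proof.
move=> /unique_inv[+ ->] /=.
rewrite /ste_a /ste_b /ste_den /par_x /par_y /par_s /par_tau /par_cut /inv1q /den.
set q := a ^+ 2 + b ^+ 2.
rewrite !mulf_eq0 -!orbA => /norP[q1 /norP[q2 /norP[q3 m0]]].
by split; field; rewrite q1 q2 q3 m0.
Qed.

Lemma par_ste (x y s0 m tau T : L) :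
  x ^+ 2 + y ^+ 2 = P12 s0 -> tau * (s0 * m) = 1 -> cut s0 * T = 1 ->
  let a := ste_a x y s0 T in let b := ste_b x y s0 T in let t := ste_den s0 tau T in
  den a b m * t = 1 /\ [/\ par_s a b m t = s0, par_x a b m t = x, par_y a b m t = y,
    par_tau a b m t = tau & par_cut a b m t = T].
Proof.
move=> e1; rewrite mulrC => /unique_inv[+ ->] /unique_inv[+ ->] /=.
rewrite !mulf_eq0 => /norP[s0n m0] /norP[s1 s2].
have qE : ste_a x y s0 (cut s0)^-1 ^+ 2 + ste_b x y s0 (cut s0)^-1 ^+ 2 = (2%:R - s0) / (s0 - 1).
  transitivity ((x ^+ 2 + y ^+ 2) * (s0 ^+ 2 + 1) / cut s0 ^+ 2).
    by rewrite /ste_a /ste_b /cut; field; rewrite s1 s2.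
  by rewrite e1 /P12 /P1 /P2 /cut; field; rewrite s1 s2.
rewrite /par_x /par_y /par_s /par_tau /par_cut /inv1q /den /ste_den qE.
have s1' : s0 - 1 != 0 by [].
split; first by rewrite /cut; field; rewrite s1 s2 s0n m0.
by split; rewrite ?/ste_a ?/ste_b /cut; field; rewrite s1 s2 s0n m0.
Qed.

Lemma rmorph_cut (B C : comNzRingType) (f : {rmorphism B -> C}) s : f (cut s) = cut (f s).
Proof. by rewrite /cut rmorphM rmorphB rmorphD rmorphXn !rmorph1. Qed.

Section FormulaMorphism.
Variables (B C : comNzRingType) (f : {rmorphism B -> C}).
Lemma rmorph_den a b m : f (den a b m) = den (f a) (f b) (f m).
Proof. by rewrite /den !(rmorph_nat, rmorphM, rmorphD, rmorphXn, rmorph1). Qed.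
Lemma rmorph_inv1q a b m t : f (inv1q a b m t) = inv1q (f a) (f b) (f m) (f t).
Proof. by rewrite /inv1q !(rmorph_nat, rmorphM, rmorphD, rmorphXn, rmorph1). Qed.
Lemma rmorph_par_s a b m t : f (par_s a b m t) = par_s (f a) (f b) (f m) (f t).
Proof. by rewrite /par_s rmorphM rmorph_inv1q !(rmorph_nat, rmorphD, rmorphXn). Qed.
Lemma rmorph_par_x a b m t : f (par_x a b m t) = par_x (f a) (f b) (f m) (f t).
Proof. by rewrite /par_x !(rmorph_inv1q, rmorph_par_s, rmorphM, rmorphD). Qed.
Lemma rmorph_par_y a b m t : f (par_y a b m t) = par_y (f a) (f b) (f m) (f t).
Proof. by rewrite /par_y !(rmorph_inv1q, rmorph_par_s, rmorphM, rmorphB). Qed.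
Lemma rmorph_par_tau a b m t : f (par_tau a b m t) = par_tau (f a) (f b) (f m) (f t).
Proof. by rewrite /par_tau !(rmorph_nat, rmorphM, rmorphD, rmorphXn, rmorph1). Qed.
Lemma rmorph_par_cut a b m t : f (par_cut a b m t) = par_cut (f a) (f b) (f m) (f t).
Proof. by rewrite /par_cut !(rmorph_nat, rmorphM, rmorphD, rmorphXn, rmorph1). Qed.
Lemma rmorph_ste_a x y s T : f (ste_a x y s T) = ste_a (f x) (f y) (f s) (f T).
Proof. by rewrite /ste_a !(rmorphM, rmorphB). Qed.
Lemma rmorph_ste_b x y s T : f (ste_b x y s T) = ste_b (f x) (f y) (f s) (f T).
Proof. by rewrite /ste_b !(rmorphM, rmorphD). Qed.
Lemma rmorph_ste_den s t T : f (ste_den s t T) = ste_den (f s) (f t) (f T).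
Proof. by rewrite /ste_den !(rmorphM, rmorphB, rmorphXn, rmorph1). Qed.
End FormulaMorphism.

Section Naturality.
Variables (T U : Type) (h : T -> U).
Lemma adjoin_map n (p : 'I_n -> T) t i : h (adjoin p t i) = adjoin (h \o p) (h t) i.
Proof. by rewrite /adjoin; case: unlift. Qed.
Lemma pa_map a b u v s i : h (pa a b u v s i) = pa (h a) (h b) (h u) (h v) (h \o s) i.
Proof. by case: (ja_cases i) => [->|->|[->|->|[l ->]]]; rewrite !paE. Qed.
Lemma pt_map x y t u v s i : h (@pt k T x y t u v s i) = pt (h x) (h y) (h t) (h u) (h v) (h \o s) i.
Proof. by case: (ix_cases i) => [->|->|->|[->|->|[l ->]]]; rewrite !ptE. Qed.
Lemma first_then_map s0 s l : h (first_then s0 s l) = first_then (h s0) (h \o s) l.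
Proof. by rewrite /first_then; case: unlift. Qed.
End Naturality.

Notation W := (widen_ord (leqnSn _)).

Definition sphere_to_space : (4 + k).+1.-tuple {mpoly K[N.+1]} :=
  let x := 'X_(W (ix k)) in let y := 'X_(W (iy k)) in let s := 'X_(W (is_ ord0)) in
  let T := 'X_ord_max in
  mktuple (adjoin (pa (ste_a x y s T) (ste_b x y s T) 'X_(W (iu k)) 'X_(W (iv k))
    (fun l => 'X_(W (is_ (lift ord0 l))))) (ste_den s 'X_(W (it k)) T)).

Definition space_to_sphere : N.+1.-tuple {mpoly K[(4 + k).+1]} :=
  let a := 'X_(W ja) in let b := 'X_(W jb) in let m := \prod_l 'X_(W (jl l)) in
  let t := 'X_ord_max in
  mktuple (adjoin (pt (par_x a b m t) (par_y a b m t) (par_tau a b m t) 'X_(W jc) 'X_(W jd)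
    (first_then (par_s a b m t) (fun l => 'X_(W (jl l))))) (par_cut a b m t)).

Lemma sphere_to_spaceE v : (fun j => mmap iota v (tnth sphere_to_space j)) =
  adjoin (pa (ste_a (v (W (ix k))) (v (W (iy k))) (v (W (is_ ord0))) (v ord_max))
     (ste_b (v (W (ix k))) (v (W (iy k))) (v (W (is_ ord0))) (v ord_max))
     (v (W (iu k))) (v (W (iv k))) (fun l => v (W (is_ (lift ord0 l)))))
     (ste_den (v (W (is_ ord0))) (v (W (it k))) (v ord_max)).
Proof.
apply/funext => j; rewrite tnth_mktuple (adjoin_map (mmap iota v)).
apply: (f_equal2 (fun p t => adjoin p t j)).
  apply/funext => i; rewrite /= (pa_map (mmap iota v)).
  case: (ja_cases i) => [->|->|[->|->|[l ->]]];
    by rewrite !paE ?rmorph_ste_a ?rmorph_ste_b /= !mmapXU.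
by rewrite rmorph_ste_den /= !mmapXU.
Qed.

Lemma space_to_sphereE v (a := v (W ja)) (b := v (W jb)) (m := \prod_l v (W (jl l)))
    (t := v ord_max) : (fun j => mmap iota v (tnth space_to_sphere j)) =
  adjoin (pt (par_x a b m t) (par_y a b m t) (par_tau a b m t) (v (W jc)) (v (W jd))
    (first_then (par_s a b m t) (fun l => v (W (jl l))))) (par_cut a b m t).
Proof.
have mE : mmap iota v (\prod_l 'X_(W (jl l))) = m.
  by rewrite rmorph_prod; apply: eq_bigr => l _; rewrite /= mmapXU.
apply/funext => j; rewrite tnth_mktuple (adjoin_map (mmap iota v)).
move: mE; move: (\prod_l 'X_(W (jl l)) : {mpoly K[(4 + k).+1]}) => mp mE.
apply: (f_equal2 (fun p t => adjoin p t j)).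
  apply/funext => i; rewrite /= (pt_map (mmap iota v)).
  case: (ix_cases i) => [->|->|->|[->|->|[l ->]]]; rewrite !ptE /=.
  - by rewrite rmorph_par_x /= mE !mmapXU.
  - by rewrite rmorph_par_y /= mE !mmapXU.
  - by rewrite rmorph_par_tau /= mE !mmapXU.
  - by rewrite mmapXU.
  - by rewrite mmapXU.
  rewrite (first_then_map (mmap iota v)); case: (unliftP ord0 l) => [l' ->|->].
    by rewrite !first_thenS /= mmapXU.
  by rewrite !first_then0 rmorph_par_s /= mE !mmapXU.
by rewrite rmorph_par_cut /= mE !mmapXU.
Qed.

Lemma X_rational : birational X A.
Proof.
pose f : {mpoly K[N]} := cut 'X_(is_ ord0).
pose g : {mpoly K[4 + k]} := den 'X_ja 'X_jb (\prod_l 'X_(jl l)).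
have fE v : mmap iota v f = cut (v (is_ ord0)) by rewrite rmorph_cut /= mmapXU.
have gE v : mmap iota v g = den (v ja) (v jb) (\prod_l v (jl l)).
  rewrite rmorph_den /= !mmapXU rmorph_prod.
  by congr den; apply: eq_bigr => l _; rewrite /= mmapXU.
have nz (n : nat) : (0 < n)%N -> n%:R != 0 :> L by rewrite pnatr_eq0 -lt0n.
exists f, g; split.
- apply/negP => fX.
  have Xc : on_points iota X (cpt 1 0 0 (fun=> 3%:R)).
    by apply: cpt_on_X => [|l]; [exact: oner_neq0 | exact: nz].
  have := ideal_on_points Xc fX; rewrite fE /cpt ptE.
  have -> : cut (3%:R : L) = 20%:R by rewrite /cut; ring.
  by move=> /eqP; apply/negP/nz.
- apply/negP => gA; have Ac : on_points iota A (pa 0 0 0 0 (fun=> 1)) by move=> e; rewrite in_nil.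
  have := ideal_on_points Ac gA.
  rewrite gE !paE big1 => [|l _]; last by rewrite paE.
  have -> : den 0 0 1 = 10%:R :> L by rewrite /den; ring.
  by move=> /eqP; apply/negP/nz.
have onXf v : on_points iota (principal_open (X := X) f) v ->
    [/\ v (W (ix k)) ^+ 2 + v (W (iy k)) ^+ 2 = P12 (v (W (is_ ord0))),
      v (W (it k)) * (v (W (is_ ord0)) * \prod_l v (W (is_ (lift ord0 l)))) = 1 &
      cut (v (W (is_ ord0))) * v ord_max = 1].
  move=> /on_principal_open[/on_X[e1 e2] e3]; rewrite fE in e3.
  by split; [exact: e1 | rewrite -[RHS]e2 big_ord_recl | exact: e3].
have onAg v : on_points iota (principal_open (X := A) g) v ->
    den (v (W ja)) (v (W jb)) (\prod_l v (W (jl l))) * v ord_max = 1.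
  by move=> /on_principal_open[_]; rewrite gE.
apply: (isomorphic_by_points (iota := iota) (X := principal_open (X := X) f)
  (Y := principal_open (X := A) g) (F := sphere_to_space) (G := space_to_sphere)).
- exact/principal_open_detected/X_detected.
- exact/principal_open_detected/affine_space_detected.
- move=> v /onXf[e1 e2 e3]; rewrite sphere_to_spaceE; apply/on_principal_open; split=> [e|].
    by rewrite in_nil.
  rewrite gE !adjoin_widen adjoin_max !paE.
  under eq_bigr do rewrite adjoin_widen paE.
  by have [] := par_ste e1 e2 e3.
- move=> v /onAg e; rewrite space_to_sphereE; apply/on_principal_open.
  have [p1 p2 p3] := par_on e; split.
    apply/on_X; rewrite !adjoin_widen !ptE first_then0; split=> //.
    rewrite -[RHS]p2; congr (_ * _); rewrite big_ord_recl !adjoin_widen ptE first_then0.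
    by congr (_ * _); apply: eq_bigr => l _; rewrite adjoin_widen ptE first_thenS.
  by rewrite fE adjoin_widen adjoin_max ptE first_then0.
- move=> v /onXf[e1 e2 e3] i.
  rewrite sphere_to_spaceE -[LHS]/((fun i => mmap iota _ (tnth space_to_sphere i)) i).
  rewrite space_to_sphereE !adjoin_widen adjoin_max !paE.
  have -> : \prod_l adjoin (pa (ste_a (v (W (ix k))) (v (W (iy k))) (v (W (is_ ord0))) (v ord_max))
     (ste_b (v (W (ix k))) (v (W (iy k))) (v (W (is_ ord0))) (v ord_max))
     (v (W (iu k))) (v (W (iv k))) (fun l => v (W (is_ (lift ord0 l)))))
     (ste_den (v (W (is_ ord0))) (v (W (it k))) (v ord_max)) (W (jl l)) =
     \prod_l v (W (is_ (lift ord0 l))).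
    by apply: eq_bigr => l _; rewrite adjoin_widen paE.
  have [_ [-> -> -> -> ->]] := par_ste e1 e2 e3.
  apply: eq_adjoin => // j; case: (ix_cases j) => [->|->|->|[->|->|[l ->]]]; rewrite !ptE //.
  case: (unliftP ord0 l) => [l' ->|->]; last by rewrite first_then0.
  by rewrite first_thenS adjoin_widen paE.
- move=> v /onAg e i.
  rewrite space_to_sphereE -[LHS]/((fun i => mmap iota _ (tnth sphere_to_space i)) i).
  rewrite sphere_to_spaceE !adjoin_widen adjoin_max !ptE first_then0.
  have [-> -> ->] := ste_par e.
  apply: eq_adjoin => // j; case: (ja_cases j) => [->|->|[->|->|[l ->]]]; rewrite !paE //.
  by rewrite adjoin_widen ptE first_thenS.
Qed.

End Rational.

(** * Real forms that are plane bundles over a sphere *)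

Section IsomorphicIntegral.
Variable K : fieldType.

Lemma comp_mpolyA n m l (F : n.-tuple {mpoly K[m]}) (G : m.-tuple {mpoly K[l]}) p :
  (p \mPo F) \mPo G = p \mPo [tuple tnth F i \mPo G | i < n].
Proof.
elim/mpoly_ring_ind: p => [c|i|p q IHp IHq|p q IHp IHq].
- by rewrite !comp_mpolyC.
- by rewrite !comp_mpolyXU -!tnth_nth tnth_mktuple.
- by rewrite !comp_mpolyD IHp IHq.
- by rewrite !rmorphM /= IHp IHq.
Qed.

(** The ideals correspond to each other under the morphism of polynomial rings. *)
Lemma isomorphic_integral (X Y : affine_scheme K) :
  isomorphic X Y -> is_integral X -> is_integral Y.
Proof.
move=> [F [G [FXY GYX _ FG]]] [[X0 X1 XD] Xm].
have IE p : (p \in defining_ideal Y) = (p \mPo F \in defining_ideal X).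
  apply/idP/idP => [/FXY //|/GYX]; rewrite comp_mpolyA => H.
  have E : (p \mPo [tuple tnth F i \mPo G | i < ambient Y]) -
      (p \mPo [tuple 'X_i | i < ambient Y]) \in defining_ideal Y.
    by apply: comp_mpoly_congr => i; rewrite !tnth_mktuple; exact: FG.
  by have := ideal_genB H E; rewrite opprB addrC subrK comp_mpoly_id.
split; first split.
- exact: ideal_gen0.
- by rewrite IE comp_mpoly1.
- by move=> a u v; rewrite !IE comp_mpolyD rmorphM; exact: XD.
- by move=> u v; rewrite !IE rmorphM; exact: Xm.
Qed.

End IsomorphicIntegral.

Section Coordinates.
Variable k : nat.

(** A form has real coordinates [u1, u2] and [v1, v2] for [u = u1 + i u2] and
    [v = v1 + i v2]. *)
Definition hx : 'I_(7 + k.+1) := lshift k.+1 (@Ordinal 7 0 isT).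
Definition hy : 'I_(7 + k.+1) := lshift k.+1 (@Ordinal 7 1 isT).
Definition ht : 'I_(7 + k.+1) := lshift k.+1 (@Ordinal 7 2 isT).
Definition hu1 : 'I_(7 + k.+1) := lshift k.+1 (@Ordinal 7 3 isT).
Definition hu2 : 'I_(7 + k.+1) := lshift k.+1 (@Ordinal 7 4 isT).
Definition hv1 : 'I_(7 + k.+1) := lshift k.+1 (@Ordinal 7 5 isT).
Definition hv2 : 'I_(7 + k.+1) := lshift k.+1 (@Ordinal 7 6 isT).
Definition hs (l : 'I_k.+1) : 'I_(7 + k.+1) := rshift 7 l.

Definition rpt (T : Type) (x y t u1 u2 v1 v2 : T) (s : 'I_k.+1 -> T) : 'I_(7 + k.+1) -> T :=
  fun i => match split i with
    | inl j => nth x [:: x; y; t; u1; u2; v1; v2] j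
    | inr l => s l
    end.

Lemma rptE (T : Type) (x y t u1 u2 v1 v2 : T) s (p := rpt x y t u1 u2 v1 v2 s) :
  ((p hx = x) * (p hy = y) * (p ht = t) * (p hu1 = u1) * (p hu2 = u2) * (p hv1 = v1) *
   (p hv2 = v2) * (forall l, p (hs l) = s l))%type.
Proof.
by rewrite /p /rpt /hx /hy /ht /hu1 /hu2 /hv1 /hv2 /hs; do !split;
   rewrite ?(unsplitK (inl _)) // => l; rewrite (unsplitK (inr _)).
Qed.

Lemma hx_cases (i : 'I_(7 + k.+1)) :
  [\/ i = hx, i = hy, i = ht | [\/ i = hu1, i = hu2 | [\/ i = hv1, i = hv2 | exists l, i = hs l]]].
Proof.
case: (split_ordP i) => [[j jlt] ->|l ->];
  last by constructor 4; constructor 3; constructor 3; exists l.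
case: j jlt => [|[|[|[|[|[|[|//]]]]]]] jlt;
  [constructor 1|constructor 2|constructor 3|constructor 4; constructor 1|
   constructor 4; constructor 2|constructor 4; constructor 3; constructor 1|
   constructor 4; constructor 3; constructor 2]; exact/val_inj.
Qed.

Lemma rpt_map (T U : Type) (h : T -> U) x y t u1 u2 v1 v2 s i :
  h (rpt x y t u1 u2 v1 v2 s i) = rpt (h x) (h y) (h t) (h u1) (h u2) (h v1) (h v2) (h \o s) i.
Proof. by case: (hx_cases i) => [->|->|->|[->|->|[->|->|[l ->]]]]; rewrite !rptE. Qed.

End Coordinates.

Definition base_change (K L : fieldType) (iota : {rmorphism K -> L}) (X : affine_scheme K) :
    affine_scheme L :=
  AffineScheme [seq map_mpoly iota p | p <- equations X].

Lemma on_base_change (K L : fieldType) (iota : {rmorphism K -> L}) (X : affine_scheme K) v :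
  on_points idfun (base_change iota X) v <-> on_points iota X v.
Proof.
split=> Xv e eX; first by rewrite -meval_map_mpoly; apply: Xv; exact: map_f.
by case/mapP: eX => e' e'X ->; rewrite -[LHS]/((map_mpoly iota e').@[v]) meval_map_mpoly Xv.
Qed.

(** Complex numbers as pairs, over a ring that need not contain [i]. *)
Section Pairs.
Variable A : comNzRingType.
Implicit Types p q : A * A.

Definition cmul p q : A * A := (p.1 * q.1 - p.2 * q.2, p.1 * q.2 + p.2 * q.1).
Definition reim (x y : A) n : A * A := iter n (cmul (x, y)) (1, 0).
Definition cval (I : A) p : A := p.1 + I * p.2.

Lemma cval_mul I p q : I ^+ 2 = -1 -> cval I (cmul p q) = cval I p * cval I q.
Proof.
move=> I2; rewrite /cval /=.
transitivity (p.1 * q.1 + I ^+ 2 * (p.2 * q.2) + I * (p.1 * q.2 + p.2 * q.1)); last by ring.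
by rewrite I2; ring.
Qed.

Lemma cval_reim I x y n : I ^+ 2 = -1 -> cval I (reim x y n) = (x + I * y) ^+ n.
Proof.
move=> I2; elim: n => [|n IH]; first by rewrite expr0 /cval mulr0 addr0.
by rewrite exprS -IH; exact: (cval_mul (x, y) _ I2).
Qed.
End Pairs.

Lemma rmorph_reim (A B : comNzRingType) (f : {rmorphism A -> B}) x y n :
  reim (f x) (f y) n = (f (reim x y n).1, f (reim x y n).2).
Proof.
elim: n => [|n IH]; first by rewrite /= rmorph1 rmorph0.
by rewrite /reim !iterS -/(reim _ _ _) IH /cmul /= rmorphB rmorphD !rmorphM.
Qed.

Section EquationMorphism.
Variables (K : fieldType) (k : nat) (B : comNzRingType).
Variable f : {rmorphism {mpoly K[5 + k.+1]} -> B}.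

Lemma rmorph_circle_eq : f (circle_eq K k) =
  f 'X_(ix k) ^+ 2 + f 'X_(iy k) ^+ 2 - P1 (f 'X_(is_ ord0)) * P2 (f 'X_(is_ ord0)).
Proof. by rewrite /circle_eq rmorphB rmorphD !rmorphXn rmorphM rmorph_P1 rmorph_P2. Qed.

Lemma rmorph_torus_eq : f (torus_eq K k) = f 'X_(it k) * (\prod_l f 'X_(is_ l)) - 1.
Proof. by rewrite /torus_eq rmorphB rmorphM rmorph_prod rmorph1. Qed.

End EquationMorphism.

Section Twist.
Variables (K : fieldType) (a b : {poly K}) (n : nat).

Section Coefficients.
Variables (A : comNzRingType) (j : {rmorphism K -> A}).
(** The entries of the gluing matrix [[[- e wbar^n, g], [h, e w^n]]]. It is the matrix
    [conj(G) J G^-1], where the columns of [G] are the values of [frame_u, frame_v]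
    below at [(1, 0)] and [(0, 1)] and where [J] exchanges the two coordinates. *)
Definition te (s : A) := 1 + (map_poly j a).[s] * (map_poly j b).[s].
Definition tg (s : A) := P1 s ^+ n - (map_poly j b).[s] ^+ 2 * P2 s ^+ n.
Definition th (s : A) := (map_poly j a).[s] ^+ 2 * P1 s ^+ n - P2 s ^+ n.

Hypothesis bez : a * P1 'X ^+ n + b * P2 'X ^+ n = 1.

Lemma bezout_at s : (map_poly j a).[s] * P1 s ^+ n + (map_poly j b).[s] * P2 s ^+ n = 1.
Proof.
have := congr1 (fun p => (map_poly j p).[s]) bez.
rewrite rmorphD !rmorphM !rmorphXn rmorph_P1 rmorph_P2 rmorph1 /= map_polyX.
rewrite hornerD !hornerM !horner_exp hornerC.
have -> : (P1 'X).[s] = P1 s by rewrite /P1 !hornerE.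
have -> : (P2 'X).[s] = P2 s.
  have -> : P2 ('X : {poly A}) = ((2%:R : A)%:P - 'X) * ('X * 'X + 1) by rewrite /P2 expr2 polyC_natr.
  by rewrite /P2 !hornerE expr2.
by [].
Qed.

(** The determinant of the gluing matrix, up to sign, which is why its entries
    are those of its inverse up to conjugation ([glue_glue]). *)
Lemma twist_det s : te s ^+ 2 * (P12 s) ^+ n + tg s * th s = 1.
Proof.
rewrite /te /tg /th /P12 exprMn.
transitivity (((map_poly j a).[s] * P1 s ^+ n + (map_poly j b).[s] * P2 s ^+ n) ^+ 2);
  first by ring.
by rewrite bezout_at expr1n.
Qed.

End Coefficients.

Lemma rmorph_te (A B : comNzRingType) (j : {rmorphism K -> A}) (f : {rmorphism A -> B})
  (i : {rmorphism K -> B}) s : f \o j =1 i -> f (te j s) = te i (f s).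
Proof.
move=> fj; rewrite /te rmorphD rmorphM rmorph1 -!horner_map -!map_poly_comp.
by rewrite !(eq_map_poly fj).
Qed.

Lemma rmorph_tg (A B : comNzRingType) (j : {rmorphism K -> A}) (f : {rmorphism A -> B})
  (i : {rmorphism K -> B}) s : f \o j =1 i -> f (tg j s) = tg i (f s).
Proof.
move=> fj; rewrite /tg rmorphB rmorphM !rmorphXn rmorph_P1 rmorph_P2 /= -horner_map -map_poly_comp.
by rewrite (eq_map_poly fj).
Qed.

Lemma rmorph_th (A B : comNzRingType) (j : {rmorphism K -> A}) (f : {rmorphism A -> B})
  (i : {rmorphism K -> B}) s : f \o j =1 i -> f (th j s) = th i (f s).
Proof.
move=> fj; rewrite /th rmorphB rmorphM !rmorphXn rmorph_P1 rmorph_P2 /= -horner_map -map_poly_comp.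
by rewrite (eq_map_poly fj).
Qed.

Section Gluing.
Variables (A : comNzRingType) (j : {rmorphism K -> A}) (x y s0 : A).

Definition glue_u (I u v : A) := - (te j s0 * (x - I * y) ^+ n * u) + tg j s0 * v.
Definition glue_v (I u v : A) := th j s0 * u + te j s0 * (x + I * y) ^+ n * v.

(** The real and imaginary parts of [ubar - glue_u] and [vbar - glue_v]. *)
Definition twist (u v : A * A) : (A * A) * (A * A) :=
  let z := cmul (reim x (- y) n) u in let z' := cmul (reim x y n) v in
  ((u.1 + te j s0 * z.1 - tg j s0 * v.1, - u.2 + te j s0 * z.2 - tg j s0 * v.2),
   (v.1 - th j s0 * u.1 - te j s0 * z'.1, - v.2 - th j s0 * u.2 - te j s0 * z'.2)).
Definition twist_eqs u v : seq A :=
  let t := twist u v in [:: t.1.1; t.1.2; t.2.1; t.2.2].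

Lemma cval_twist I u v : I ^+ 2 = -1 ->
  cval I (twist u v).1 = (u.1 - I * u.2) - glue_u I (cval I u) (cval I v) /\
  cval I (twist u v).2 = (v.1 - I * v.2) - glue_v I (cval I u) (cval I v).
Proof.
move=> I2; have zE := cval_mul (reim x (- y) n) u I2; have zE' := cval_mul (reim x y n) v I2.
rewrite !cval_reim // mulrN in zE zE'; rewrite /glue_u /glue_v /twist.
rewrite -[te j s0 * _ * cval I u]mulrA -[te j s0 * _ * cval I v]mulrA -zE -zE'.
by move: (cmul _ _) (cmul _ _) => z z'; rewrite /cval /=; split; ring.
Qed.

Lemma twist_eqs0 u v : (forall e, e \in twist_eqs u v -> e = 0) -> twist u v = ((0, 0), (0, 0)).
Proof.
rewrite /twist_eqs; case: (twist u v) => [[a1 a2] [b1 b2]] H.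
have [-> -> -> ->] : [/\ a1 = 0, a2 = 0, b1 = 0 & b2 = 0]; last by [].
by split; apply: H; rewrite !inE eqxx ?orbT.
Qed.
End Gluing.

Lemma rmorph_twist_eqs (A B : comNzRingType) (j : {rmorphism K -> A}) (f : {rmorphism A -> B})
    (i : {rmorphism K -> B}) x y s0 u v : f \o j =1 i ->
  [seq f e | e <- twist_eqs j x y s0 u v] =
  twist_eqs i (f x) (f y) (f s0) (f u.1, f u.2) (f v.1, f v.2).
Proof.
move=> fj; have yE : - f y = f (- y) by rewrite rmorphN.
rewrite /twist_eqs /twist /= yE !rmorph_reim.
rewrite -!(rmorph_te _ fj) -!(rmorph_tg _ fj) -!(rmorph_th _ fj).
move: (te j s0) (tg j s0) (th j s0) (reim _ _ _) (reim _ _ _) => e g h z z'.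
by rewrite !(rmorphB, rmorphD, rmorphM) !rmorphN.
Qed.

Variable k : nat.
Notation N' := (7 + k.+1)%N.
Notation Y_ i := ('X_(i k) : {mpoly K[N']}).

Definition proj_vars : (5 + k.+1).-tuple {mpoly K[N']} :=
  mktuple (pt (Y_ hx) (Y_ hy) (Y_ ht) 0 0 (fun l => 'X_(hs l))).

Definition form_twist : seq {mpoly K[N']} :=
  twist_eqs (@mpolyC N' K) (Y_ hx) (Y_ hy) 'X_(hs ord0) (Y_ hu1, Y_ hu2) (Y_ hv1, Y_ hv2).

(** The plane bundle over the sphere times a torus whose fibre is
    [{(u, v) | ubar = - e wbar^n u + g v, vbar = h u + e w^n v}]. *)
Definition plane_bundle : affine_scheme K :=
  AffineScheme [:: circle_eq K k \mPo proj_vars, torus_eq K k \mPo proj_vars & form_twist].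

Section Points.
Variables (L : fieldType) (iota : {rmorphism K -> L}).

Lemma proj_varsE v : (fun i => mmap iota v (tnth proj_vars i)) =
  pt (v (hx k)) (v (hy k)) (v (ht k)) 0 0 (fun l => v (hs l)).
Proof.
apply/funext => i; rewrite tnth_mktuple (pt_map (mmap iota v)).
by case: (ix_cases i) => [->|->|->|[->|->|[l ->]]]; rewrite !ptE /= ?mmapXU ?rmorph0.
Qed.

Lemma on_plane_bundle v (s0 := v (hs ord0)) : on_points iota plane_bundle v <->
  [/\ v (hx k) ^+ 2 + v (hy k) ^+ 2 = P12 s0,
      v (ht k) * (\prod_l v (hs l)) = 1 &
      twist iota (v (hx k)) (v (hy k)) s0 (v (hu1 k), v (hu2 k)) (v (hv1 k), v (hv2 k)) =
        ((0, 0), (0, 0))].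
Proof.
have E1 : mmap iota v (circle_eq K k \mPo proj_vars) =
    v (hx k) ^+ 2 + v (hy k) ^+ 2 - P12 s0.
  by rewrite mmap_comp_mpoly proj_varsE mmap_circle_eq !ptE.
have E2 : mmap iota v (torus_eq K k \mPo proj_vars) = v (ht k) * (\prod_l v (hs l)) - 1.
  rewrite mmap_comp_mpoly proj_varsE mmap_torus_eq ptE; congr (_ * _ - _).
  by apply: eq_bigr => l _; rewrite ptE.
have jv : mmap iota v \o @mpolyC N' K =1 iota by move=> x /=; rewrite mmapC.
have E3 : [seq mmap iota v e | e <- form_twist] = twist_eqs iota (v (hx k)) (v (hy k)) s0
    (v (hu1 k), v (hu2 k)) (v (hv1 k), v (hv2 k)).
  by rewrite (rmorph_twist_eqs _ _ _ _ _ jv) /= !mmapXU.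
split=> [Yv|[e1 e2 e3] e].
  split; try by apply/eqP; rewrite -subr_eq0 -?E1 -?E2 Yv // !inE eqxx ?orbT.
  by apply: twist_eqs0 => e; rewrite -E3 => /mapP[e' e'T ->]; rewrite Yv //= 2!in_cons e'T !orbT.
rewrite /= 2!in_cons => /or3P[/eqP ->|/eqP ->|eT].
- by rewrite E1 e1 subrr.
- by rewrite E2 e2 subrr.
have : mmap iota v e \in [seq mmap iota v e | e <- form_twist] by exact: map_f.
by rewrite E3 /twist_eqs e3 !inE !orbb => /eqP.
Qed.
End Points.

Section ComplexForm.
Hypothesis bez : a * P1 'X ^+ n + b * P2 'X ^+ n = 1.
Variables (L : numClosedFieldType) (iota : {rmorphism K -> L}).
Notation N := (5 + k.+1)%N.
Notation X := (sphere_torus_plane L k).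
Notation Y := (base_change iota plane_bundle).

Lemma rmorph_glue_u (A B : comNzRingType) (j : {rmorphism K -> A}) (f : {rmorphism A -> B})
    (i : {rmorphism K -> B}) I x y s0 u v : f \o j =1 i ->
  f (glue_u j x y s0 I u v) = glue_u i (f x) (f y) (f s0) (f I) (f u) (f v).
Proof.
move=> fj; rewrite /glue_u.
by rewrite !(rmorph_te _ fj, rmorph_tg _ fj, rmorphN, rmorphXn, rmorphB, rmorphD, rmorphM).
Qed.

Lemma rmorph_glue_v (A B : comNzRingType) (j : {rmorphism K -> A}) (f : {rmorphism A -> B})
    (i : {rmorphism K -> B}) I x y s0 u v : f \o j =1 i ->
  f (glue_v j x y s0 I u v) = glue_v i (f x) (f y) (f s0) (f I) (f u) (f v).
Proof.
move=> fj; rewrite /glue_v.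
by rewrite !(rmorph_te _ fj, rmorph_th _ fj, rmorphXn, rmorphD, rmorphM).
Qed.

Let j5 : {rmorphism K -> {mpoly L[N]}} := @mpolyC N L \o iota.
Let j7 : {rmorphism K -> {mpoly L[N']}} := @mpolyC N' L \o iota.

(** The coordinates [u1 = (u + ubar) / 2] and [u2 = (u - ubar) / 2 i], where [ubar]
    stands for its expression [glue_u] in [u] and [v]. *)
Definition to_bundle : N'.-tuple {mpoly L[N]} :=
  let x := 'X_(ix k) in let y := 'X_(iy k) in let u := 'X_(iu k) in let v := 'X_(iv k) in
  let s0 := 'X_(is_ ord0) in
  let ub := glue_u j5 x y s0 ('i)%:MP u v in let vb := glue_v j5 x y s0 ('i)%:MP u v in
  mktuple (rpt x y 'X_(it k) ((2%:R^-1)%:MP * (u + ub)) (((2%:R * 'i)^-1)%:MP * (u - ub))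
    ((2%:R^-1)%:MP * (v + vb)) (((2%:R * 'i)^-1)%:MP * (v - vb)) (fun l => 'X_(is_ l))).

Definition of_bundle : N.-tuple {mpoly L[N']} :=
  mktuple (pt 'X_(hx k) 'X_(hy k) 'X_(ht k) ('X_(hu1 k) + ('i)%:MP * 'X_(hu2 k))
    ('X_(hv1 k) + ('i)%:MP * 'X_(hv2 k)) (fun l => 'X_(hs l))).

Definition bundle_point (z : 'I_N -> L) : 'I_N' -> L :=
  let ub := glue_u iota (z (ix k)) (z (iy k)) (z (is_ ord0)) 'i (z (iu k)) (z (iv k)) in
  let vb := glue_v iota (z (ix k)) (z (iy k)) (z (is_ ord0)) 'i (z (iu k)) (z (iv k)) in
  rpt (z (ix k)) (z (iy k)) (z (it k)) (2%:R^-1 * (z (iu k) + ub)) ((2%:R * 'i)^-1 * (z (iu k) - ub))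
     (2%:R^-1 * (z (iv k) + vb)) ((2%:R * 'i)^-1 * (z (iv k) - vb)) (fun l => z (is_ l)).

Definition point_of_bundle (z : 'I_N' -> L) : 'I_N -> L :=
  pt (z (hx k)) (z (hy k)) (z (ht k)) (z (hu1 k) + 'i * z (hu2 k)) (z (hv1 k) + 'i * z (hv2 k))
    (fun l => z (hs l)).

Lemma to_bundleE z : (fun i => (tnth to_bundle i).@[z]) = bundle_point z.
Proof.
have fj : meval z \o j5 =1 iota by move=> c /=; rewrite mevalC.
apply/funext => i; rewrite tnth_mktuple (rpt_map (meval z)) /bundle_point.
case: (hx_cases i) => [->|->|->|[->|->|[->|->|[l ->]]]]; rewrite !rptE.
- exact: mevalXU.
- exact: mevalXU.
- exact: mevalXU.
- by rewrite mevalM mevalC mevalD (rmorph_glue_u _ _ _ _ _ _ fj) /= mevalC !mevalXU.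
- by rewrite mevalM mevalC mevalB (rmorph_glue_u _ _ _ _ _ _ fj) /= mevalC !mevalXU.
- by rewrite mevalM mevalC mevalD (rmorph_glue_v _ _ _ _ _ _ fj) /= mevalC !mevalXU.
- by rewrite mevalM mevalC mevalB (rmorph_glue_v _ _ _ _ _ _ fj) /= mevalC !mevalXU.
- exact: mevalXU.
Qed.

Lemma of_bundleE z : (fun i => (tnth of_bundle i).@[z]) = point_of_bundle z.
Proof.
apply/funext => i; rewrite tnth_mktuple (pt_map (meval z)) /point_of_bundle.
case: (ix_cases i) => [->|->|->|[->|->|[l ->]]]; rewrite !ptE.
- exact: mevalXU.
- exact: mevalXU.
- exact: mevalXU.
- by rewrite mevalD mevalM mevalC !mevalXU.
- by rewrite mevalD mevalM mevalC !mevalXU.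
- exact: mevalXU.
Qed.

Let i0 : ('i : L) != 0. Proof. exact: neq0Ci. Qed.
Let i2 : ('i : L) ^+ 2 = -1. Proof. exact: sqrCi. Qed.

Lemma bundle_pointK z : on_points idfun X z -> point_of_bundle (bundle_point z) =1 z.
Proof.
move=> _ i; rewrite /point_of_bundle /bundle_point !rptE.
by case: (ix_cases i) => [->|->|->|[->|->|[l ->]]]; rewrite !ptE ?rptE //; field.
Qed.

Lemma cval_eq0 (p : L * L) : cval 'i p = 0 -> cval (- 'i) p = 0 -> p = (0, 0).
Proof.
case: p => c1 c2; rewrite /cval /= mulNr => h1 h2.
have : c1 *+ 2 = 0 by rewrite -[RHS](addr0 0) -{1}h1 -h2; ring.
move/eqP; rewrite mulrn_eq0 /= => /eqP c10; rewrite c10; congr (_, _).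
by move/eqP: h1; rewrite c10 add0r mulf_eq0 (negPf i0) => /eqP.
Qed.

(** The equations are combined in pairs, as real and imaginary parts. *)
Lemma on_bundle_glue (z : 'I_N' -> L) (x := z (hx k)) (y := z (hy k)) (s0 := z (hs ord0))
    (u := z (hu1 k) + 'i * z (hu2 k)) (v := z (hv1 k) + 'i * z (hv2 k)) :
  on_points iota plane_bundle z ->
  [/\ x ^+ 2 + y ^+ 2 = P12 s0, z (ht k) * (\prod_l z (hs l)) = 1,
    z (hu1 k) - 'i * z (hu2 k) = glue_u iota x y s0 'i u v &
    z (hv1 k) - 'i * z (hv2 k) = glue_v iota x y s0 'i u v].
Proof.
move=> /on_plane_bundle[e1 e2 e3]; split=> //.
  have [+ _] := cval_twist iota x y s0 (z (hu1 k), z (hu2 k)) (z (hv1 k), z (hv2 k)) i2.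
  by rewrite e3 /cval /= mulr0 addr0 => /esym/eqP; rewrite subr_eq0 => /eqP.
have [_] := cval_twist iota x y s0 (z (hu1 k), z (hu2 k)) (z (hv1 k), z (hv2 k)) i2.
by rewrite e3 /cval /= mulr0 addr0 => /esym/eqP; rewrite subr_eq0 => /eqP.
Qed.

(** The gluing is semilinear of square one: conjugating it twice gives back [(u, v)]. *)
Lemma glue_glue (x y s0 u v : L) (ub := glue_u iota x y s0 'i u v)
    (vb := glue_v iota x y s0 'i u v) : x ^+ 2 + y ^+ 2 = P12 s0 ->
  u = - (te iota s0 * (x + 'i * y) ^+ n * ub) + tg iota s0 * vb /\
  v = th iota s0 * ub + te iota s0 * (x - 'i * y) ^+ n * vb.
Proof.
move=> e; have D := twist_det iota bez s0.
have W : (x + 'i * y) ^+ n * (x - 'i * y) ^+ n = P12 s0 ^+ n.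
  rewrite -exprMn -e; congr (_ ^+ n).
  by transitivity (x ^+ 2 - 'i ^+ 2 * y ^+ 2); [ring | rewrite i2; ring].
split.
  transitivity ((te iota s0 ^+ 2 * ((x + 'i * y) ^+ n * (x - 'i * y) ^+ n) +
    tg iota s0 * th iota s0) * u); first by rewrite W D mul1r.
  by rewrite /ub /vb /glue_u /glue_v; ring.
transitivity ((te iota s0 ^+ 2 * ((x + 'i * y) ^+ n * (x - 'i * y) ^+ n) +
    tg iota s0 * th iota s0) * v); first by rewrite W D mul1r.
by rewrite /ub /vb /glue_u /glue_v; ring.
Qed.

(** Of the four real equations, two say that [ubar] and [vbar] are given by the
    gluing, and their conjugates follow from [glue_glue]. *)
Lemma bundle_point_on z : on_points idfun X z -> on_points iota plane_bundle (bundle_point z).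
Proof.
move=> /on_X[e1 e2]; apply/on_plane_bundle; rewrite /bundle_point !rptE.
set x := z (ix k) in e1 *; set y := z (iy k) in e1 *; set s0 := z (is_ ord0) in e1 *.
set u := z (iu k); set v := z (iv k).
set ub := glue_u _ _ _ _ _ _ _; set vb := glue_v _ _ _ _ _ _ _.
have [gu gv] := glue_glue u v e1; rewrite -/ub -/vb in gu gv.
set u1 := _^-1 * (u + ub); set u2 := _^-1 * (u - ub).
set v1 := _^-1 * (v + vb); set v2 := _^-1 * (v - vb).
have [U1 U2] : u1 + 'i * u2 = u /\ u1 - 'i * u2 = ub by rewrite /u1 /u2; split; field.
have [V1 V2] : v1 + 'i * v2 = v /\ v1 - 'i * v2 = vb by rewrite /v1 /v2; split; field.
split=> //.
- by rewrite -[RHS]e2; congr (_ * _); apply: eq_bigr => l _; rewrite rptE.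
- have [t1 t2] := cval_twist iota x y s0 (u1, u2) (v1, v2) i2.
  have [|t1' t2'] := @cval_twist _ iota x y s0 (- 'i) (u1, u2) (v1, v2); first by rewrite sqrrN.
  rewrite /cval /= !mulNr !opprK in t1 t2 t1' t2'; rewrite U1 U2 V1 V2 in t1 t2 t1' t2'.
  rewrite [LHS]surjective_pairing; congr (_, _); apply: cval_eq0; rewrite /cval ?mulNr.
  + by rewrite t1 subrr.
  + by rewrite t1' {1}gu /glue_u mulNr opprK; ring.
  + by rewrite t2 subrr.
  + by rewrite t2' {1}gv /glue_v mulNr; ring.
Qed.

(** On one side the ideal is detected by points. On the other one, the memberships
    are exhibited: half sums and differences of the equations and their conjugates. *)
Lemma plane_bundle_isomorphic : isomorphic X Y.
Proof.
pose I := defining_ideal Y; have eI e : e \in equations Y -> e \in I by exact: mem_ideal_gen.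
have cE : circle_eq L k \mPo of_bundle = map_mpoly iota (circle_eq K k \mPo proj_vars).
  rewrite rmorph_circle_eq -[RHS]/((map_mpoly iota \o comp_mpoly proj_vars) _) rmorph_circle_eq /=.
  by rewrite !comp_mpolyXU -!tnth_nth !tnth_mktuple !ptE !map_mpolyX.
have tE : torus_eq L k \mPo of_bundle = map_mpoly iota (torus_eq K k \mPo proj_vars).
  rewrite rmorph_torus_eq -[RHS]/((map_mpoly iota \o comp_mpoly proj_vars) _) rmorph_torus_eq /=.
  rewrite !comp_mpolyXU -!tnth_nth !tnth_mktuple !ptE !map_mpolyX; congr (_ * _ - _).
  by apply: eq_bigr => l _; rewrite /= !comp_mpolyXU -!tnth_nth !tnth_mktuple !ptE map_mpolyX.
exists to_bundle, of_bundle; split.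
- move=> p pY; apply: (X_detected (iota := idfun)) => z Xz.
  rewrite -[LHS]/((p \mPo to_bundle).@[z]) comp_mpoly_meval to_bundleE.
  apply: (ideal_on_points (iota := idfun) (X := Y)) pY; apply/on_base_change.
  exact: bundle_point_on.
- apply: (ideal_gen_map (phi := comp_mpoly of_bundle)) => e.
  rewrite !inE => /orP[]/eqP -> /=; rewrite ?cE ?tE; by apply: eI; rewrite /= 2!in_cons eqxx ?orbT.
- move=> i; apply: (X_detected (iota := idfun)) => z Xz.
  rewrite -[LHS]/((tnth of_bundle i \mPo to_bundle - 'X_i).@[z]) mevalB comp_mpoly_meval to_bundleE mevalXU.
  rewrite -[X in X - _]/((fun i => (tnth of_bundle i).@[bundle_point z]) i) of_bundleE.
  by rewrite bundle_pointK // subrr.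
have ij : ('i%:MP : {mpoly L[N']}) ^+ 2 = -1.
  by rewrite -rmorphXn /= i2 rmorphN rmorph1.
have oj : comp_mpoly of_bundle \o j5 =1 j7 by move=> c /=; rewrite comp_mpolyC.
have mj : map_mpoly iota \o @mpolyC N' K =1 j7 by move=> c /=; rewrite map_mpolyC.
have oX i : 'X_i \mPo of_bundle = pt 'X_(hx k) 'X_(hy k) 'X_(ht k) ('X_(hu1 k) + ('i)%:MP * 'X_(hu2 k))
    ('X_(hv1 k) + ('i)%:MP * 'X_(hv2 k)) (fun l => 'X_(hs l)) i.
  by rewrite comp_mpolyXU -tnth_nth tnth_mktuple.
pose s0 : {mpoly L[N']} := 'X_(hs ord0).
pose x : {mpoly L[N']} := 'X_(hx k). pose y : {mpoly L[N']} := 'X_(hy k).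
pose u1 : {mpoly L[N']} := 'X_(hu1 k). pose u2 : {mpoly L[N']} := 'X_(hu2 k).
pose v1 : {mpoly L[N']} := 'X_(hv1 k). pose v2 : {mpoly L[N']} := 'X_(hv2 k).
have tI e : e \in twist_eqs j7 x y s0 (u1, u2) (v1, v2) -> e \in I.
  have := rmorph_twist_eqs (Y_ hx) (Y_ hy) 'X_(hs ord0) (Y_ hu1, Y_ hu2) (Y_ hv1, Y_ hv2) mj.
  rewrite /= !map_mpolyX => <- eT; apply: eI.
  by rewrite /= 2!in_cons eT !orbT.
have [T12 T34] := cval_twist j7 x y s0 (u1, u2) (v1, v2) ij.
have cI (p : {mpoly L[N']} * {mpoly L[N']}) : p.1 \in I -> p.2 \in I -> cval 'i%:MP p \in I.
  by move=> p1 p2; apply: ideal_genD => //; exact: ideal_genMl.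
have {}T12 : (u1 - 'i%:MP * u2) - glue_u j7 x y s0 'i%:MP (u1 + 'i%:MP * u2) (v1 + 'i%:MP * v2) \in I.
  by rewrite -[X in X \in _]T12; apply: cI; apply: tI; rewrite !inE eqxx ?orbT.
have {}T34 : (v1 - 'i%:MP * v2) - glue_v j7 x y s0 'i%:MP (u1 + 'i%:MP * u2) (v1 + 'i%:MP * v2) \in I.
  by rewrite -[X in X \in _]T34; apply: cI; apply: tI; rewrite !inE eqxx ?orbT.
pose h : {mpoly L[N']} := (2%:R^-1)%:MP.
pose h' : {mpoly L[N']} := ((2%:R * 'i)^-1)%:MP.
have hh : h * 2%:R = 1 by rewrite /h -mpolyC_nat -mpolyCM mulVf ?pnatr_eq0 ?mpolyC1.
have hh' : h' * (2%:R * 'i%:MP) = 1.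
  by rewrite /h' -mpolyC_nat -!mpolyCM mulVf ?mpolyC1 // mulf_neq0 ?pnatr_eq0.
have half1 (p1 p2 q : {mpoly L[N']}) : (p1 - 'i%:MP * p2) - q \in I ->
    h * ((p1 + 'i%:MP * p2) + q) - p1 \in I.
  move=> qI; have -> : h * ((p1 + 'i%:MP * p2) + q) - p1 =
    (h * 2%:R - 1) * p1 - h * ((p1 - 'i%:MP * p2) - q) by ring.
  by rewrite hh subrr mul0r sub0r; apply/ideal_genN/ideal_genMl.
have half2 (p1 p2 q : {mpoly L[N']}) : (p1 - 'i%:MP * p2) - q \in I ->
    h' * ((p1 + 'i%:MP * p2) - q) - p2 \in I.
  move=> qI; have -> : h' * ((p1 + 'i%:MP * p2) - q) - p2 =
    (h' * (2%:R * 'i%:MP) - 1) * p2 + h' * ((p1 - 'i%:MP * p2) - q) by ring.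
  by rewrite hh' subrr mul0r add0r; apply/ideal_genMl.
move=> i; rewrite tnth_mktuple (rpt_map (comp_mpoly of_bundle)).
case: (hx_cases i) => [->|->|->|[->|->|[->|->|[l ->]]]]; rewrite !rptE.
- by rewrite oX ptE subrr ideal_gen0.
- by rewrite oX ptE subrr ideal_gen0.
- by rewrite oX ptE subrr ideal_gen0.
- rewrite rmorphM rmorphD (rmorph_glue_u _ _ _ _ _ _ oj) /= !comp_mpolyC !oX !ptE.
  exact: half1.
- rewrite rmorphM rmorphB (rmorph_glue_u _ _ _ _ _ _ oj) /= !comp_mpolyC !oX !ptE.
  exact: half2.
- rewrite rmorphM rmorphD (rmorph_glue_v _ _ _ _ _ _ oj) /= !comp_mpolyC !oX !ptE.
  exact: half1.
- rewrite rmorphM rmorphB (rmorph_glue_v _ _ _ _ _ _ oj) /= !comp_mpolyC !oX !ptE.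
  exact: half2.
- by rewrite /= oX ptE subrr ideal_gen0.
Qed.

End ComplexForm.

End Twist.

(** * Rigidity of the automorphisms of the complexification *)

Section Lines.
Variable L : numFieldType.

Lemma meval_line n (f : {mpoly L[n]}) (p q : 'I_n -> L) :
  exists P : {poly L}, forall t, f.@[fun i => p i + t * q i] = P.[t].
Proof.
elim/mpoly_ring_ind: f => [c|i|f g [P PE] [Q QE]|f g [P PE] [Q QE]].
- by exists c%:P => t; rewrite mevalC hornerC.
- by exists ((p i)%:P + (q i) *: 'X) => t; rewrite mevalXU !hornerE mulrC.
- by exists (P + Q) => t; rewrite mevalD hornerD PE QE.
- by exists (P * Q) => t; rewrite mevalM hornerM PE QE.
Qed.

Lemma poly_eq_inf (P Q : {poly L}) : (forall t, t != 0 -> P.[t] = Q.[t]) -> P = Q.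
Proof. by move=> PQ; apply: poly_eq_nat => k; rewrite PQ // pnatr_eq0. Qed.

(** Such a polynomial is a monomial, and vanishes if the exponent is negative. *)
Lemma horner0_homog (P : {poly L}) (e : int) c : (forall t, t != 0 -> P.[t] = t ^ e * c) ->
  [/\ e = 0 -> P.[0] = c, 0 < e -> P.[0] = 0 & e < 0 -> c = 0 /\ P.[0] = 0].
Proof.
case: e => n Pt.
  have -> : P = c *: 'X^n.
    by apply: poly_eq_inf => t t0; rewrite Pt // hornerZ hornerXn mulrC.
  rewrite hornerZ hornerXn; split=> // [[->]|]; first by rewrite expr0 mulr1.
  by case: n {Pt} => // n _; rewrite expr0n mulr0.
have E : P * 'X^(n.+1) = c%:P.
  apply: poly_eq_inf => t t0; rewrite hornerM hornerXn Pt // hornerC NegzE -exprnN.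
  by rewrite mulrAC mulVf ?mul1r // expf_neq0.
have c0 : c = 0.
  by have := congr1 (fun p => p.[0]) E; rewrite hornerM hornerXn expr0n mulr0 hornerC.
split=> // _; split=> //; move/eqP: E; rewrite c0 polyC0 mulf_eq0.
by rewrite -[('X^_ == 0)]size_poly_eq0 size_polyXn orbF => /eqP ->; rewrite horner0.
Qed.

Lemma exp2z_eq1 (e : int) : (2%:R : L) ^ e = 1 -> e = 0.
Proof.
have H n : (2%:R : L) ^+ n = 1 -> n = 0%N.
  by move/eqP; rewrite -natrX (eqr_nat _ _ 1) -(expn0 2) eqn_exp2l // => /eqP.
case: e => n; first by rewrite -exprnP => /H ->.
rewrite NegzE -exprnN => /(congr1 GRing.inv); rewrite invrK invr1 => /H.
by [].
Qed.

Lemma homog_unique (e e' : int) (c c' : L) : c != 0 ->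
  (forall t, t != 0 -> t ^ e * c = t ^ e' * c') -> e = e'.
Proof.
move=> c0 H; have cc : c = c' by have := H 1 (oner_neq0 _); rewrite !exp1rz !mul1r.
have t2 : (2%:R : L) != 0 by rewrite pnatr_eq0.
have := H _ t2; rewrite -cc => /(mulIf c0) E.
have n0 : (2%:R : L) ^ e' != 0 by exact: expfz_neq0.
apply/eqP; rewrite -subr_eq0; apply/eqP/exp2z_eq1/(mulIf n0).
by rewrite -expfzDr // subrK E mul1r.
Qed.

End Lines.

Section Units.
Variables (k : nat) (L : numClosedFieldType).
Notation N := (5 + k.+1)%N.
Notation X := (sphere_torus_plane L k).
Notation den := (chart_den k L).
Notation onX := (on_points idfun X).
Notation chart := (@sphere_chart k L).

Let den_scale i t y : den.@[scale_coord i t y] =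
  t ^+ (~~ ((i == ju k) || (i == jv k))) * den.@[y].
Proof.
rewrite !chart_denE /scale_coord.
case: (jw_cases i) => [->|->|[->|[l ->]]].
- by rewrite eqxx /= expr1 mulrA.
- by rewrite eqxx /= expr0 mul1r.
- by rewrite eqxx orbT /= expr0 mul1r.
rewrite [_ || _](_ : _ = false) //= expr1 mulrCA; congr (_ * _).
rewrite (bigD1 l) //= eqxx [in RHS](bigD1 l) //= -mulrA.
congr (_ * (_ * _)); apply: eq_bigr => l' ll'.
by rewrite /js eq_rshift (negPf ll').
Qed.

(** Clearing denominators turns the product into one that is homogeneous in the
    coordinate [i], so that [meval_scale_factor] applies to the factors. *)
Lemma factor_homogeneous (f g : {mpoly L[N]}) i (h : ('I_(3 + k.+1) -> L) -> L) :
  (forall y, den.@[y] != 0 -> f.@[chart y] * g.@[chart y] = h y) ->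
  (forall t y, t != 0 -> den.@[y] != 0 -> h (scale_coord i t y) = h y) ->
  (exists2 y, den.@[y] != 0 & h y != 0) ->
  exists2 e : int, (i = ju k \/ i = jv k -> 0 <= e) &
    forall t y, t != 0 -> den.@[y] != 0 ->
      f.@[chart (scale_coord i t y)] = t ^ e * f.@[chart y].
Proof.
move=> fg hi [y0 dy0 hy0]; have cr := @sphere_chart_rational k L.
have [M [F FE]] := chart_clear_denominators idfun cr f.
have [M' [G GE]] := chart_clear_denominators idfun cr g.
pose d : nat := ~~ ((i == ju k) || (i == jv k)).
have dE t y : den.@[scale_coord i t y] = t ^+ d * den.@[y] by exact: den_scale.
have FG y : den.@[y] != 0 -> (F * G).@[y] = h y * den.@[y] ^+ (M + M').
  move=> dy; rewrite mevalM -FE // -GE // exprD mulrACA; congr (_ * _); exact: fg.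
have d0 : F * G != 0.
  suff: (F * G).@[y0] != 0 by apply: contraNneq => ->; rewrite meval0.
  by rewrite FG // mulf_neq0 // expf_neq0.
have H t y : t != 0 -> den.@[y] != 0 ->
    (F * G).@[scale_coord i t y] = t ^+ (d * (M + M')) * (F * G).@[y].
  move=> t0 dy; rewrite !FG // ?dE ?mulf_neq0 ?expf_neq0 // hi // exprMn -exprM mulnC.
  by rewrite mulrCA.
have [e eE] := meval_scale_factor d0 (@chart_den_neq0 k L) erefl H.
exists (e%:Z - (d * M)%:Z).
  by rewrite /d => -[] ->; rewrite !eqxx ?orbT /= mul0n subr0.
move=> t y t0 dy; have dty : den.@[scale_coord i t y] != 0.
  by rewrite dE mulf_neq0 // expf_neq0.
have := eE t y; rewrite -FE // -FE // dE exprMn -exprM => E.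
have nz : t ^+ (d * M) * den.@[y] ^+ M != 0 by rewrite mulf_neq0 // expf_neq0.
apply: (mulIf nz); rewrite -[LHS]/(mmap idfun _ f * _) E expfzDr // -exprnN -!exprnP.
have nz' : t ^+ (d * M) != 0 by rewrite expf_neq0.
by rewrite -[f.@[_]]/(mmap idfun (chart y) f); field.
Qed.

Lemma chart_cpt y : chart y = cpt (y (jw k)) (y (ju k)) (y (jv k)) (fun l => y (js l)).
Proof. by []. Qed.

Definition coords (w u v : L) (s : 'I_k.+1 -> L) : 'I_(3 + k.+1) -> L :=
  fun i => match split i with inl j => nth w [:: w; u; v] j | inr l => s l end.

Lemma coordsE w u v s : ((coords w u v s (jw k) = w) * (coords w u v s (ju k) = u) *
  (coords w u v s (jv k) = v) * (forall l, coords w u v s (js l) = s l))%type.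
Proof.
by rewrite /coords /jw /ju /jv /js; do !split;
   rewrite ?(unsplitK (inl _)) // => l; rewrite (unsplitK (inr _)).
Qed.

Lemma chart_coords w u v s : chart (coords w u v s) = cpt w u v s.
Proof.
rewrite /sphere_chart !coordsE; congr cpt; apply/funext => l; by rewrite coordsE.
Qed.

Lemma den_coords w u v s : w != 0 -> (forall l, s l != 0) -> den.@[coords w u v s] != 0.
Proof.
move=> w0 s0; rewrite chart_denE coordsE mulf_neq0 //.
by apply/prodf_neq0 => l _; rewrite coordsE.
Qed.

Definition upd (s : 'I_k.+1 -> L) l0 t : 'I_k.+1 -> L :=
  fun l => if l == l0 then t * s l else s l.

Lemma scale_coords w u v s :
  [/\ forall t, scale_coord (jw k) t (coords w u v s) = coords (t * w) u v s,
      forall t, scale_coord (ju k) t (coords w u v s) = coords w (t * u) v s,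
      forall t, scale_coord (jv k) t (coords w u v s) = coords w u (t * v) s &
      forall l t, scale_coord (js l) t (coords w u v s) = coords w u v (upd s l t)].
Proof.
split=> [t|t|t|l0 t]; apply/funext => i; rewrite /scale_coord /upd;
  case: (jw_cases i) => [->|->|[->|[l ->]]]; rewrite ?eqxx !coordsE //.
Qed.

(** The functions considered from now on have a product depending on [s] only. *)
Section Factor.
Variables (f g : {mpoly L[N]}) (h : ('I_k.+1 -> L) -> L).
Hypothesis fg : forall w u v s, w != 0 -> (forall l, s l != 0) ->
  f.@[cpt w u v s] * g.@[cpt w u v s] = h s.
Hypothesis h0 : exists2 s, (forall l, s l != 0) & h s != 0.

Let fgc y : den.@[y] != 0 -> f.@[chart y] * g.@[chart y] = h (fun l => y (js l)).
Proof.
move=> dy; have := dy; rewrite chart_denE mulf_eq0 => /norP[w0 /prodf_neq0 s0].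
by rewrite chart_cpt fg // => l; exact: s0.
Qed.

Let fgc' y : den.@[y] != 0 -> g.@[chart y] * f.@[chart y] = h (fun l => y (js l)).
Proof. by move=> dy; rewrite mulrC fgc. Qed.

Let hex : exists2 y, den.@[y] != 0 & h (fun l => y (js l)) != 0.
Proof.
have [s s0 hs] := h0; exists (coords 1 0 0 s); first by apply: den_coords => //; exact: oner_neq0.
by rewrite (_ : (fun l => _) = s) //; apply/funext => l; rewrite coordsE.
Qed.

Let hinv i : (i = jw k \/ (i = ju k \/ i = jv k)) -> forall t y, t != 0 -> den.@[y] != 0 ->
  h (fun l => scale_coord i t y (js l)) = h (fun l => y (js l)).
Proof.
by move=> ii t y _ _; congr h; apply/funext => l; rewrite /scale_coord; case: ii => [|[]] ->.
Qed.

Let opposite_degrees i : (i = jw k \/ (i = ju k \/ i = jv k)) ->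
  exists e : int, [/\ i = ju k \/ i = jv k -> e = 0,
    forall t y, t != 0 -> den.@[y] != 0 ->
      f.@[chart (scale_coord i t y)] = t ^ e * f.@[chart y] &
    forall t y, t != 0 -> den.@[y] != 0 ->
      g.@[chart (scale_coord i t y)] = t ^ (- e) * g.@[chart y]].
Proof.
move=> ii; have hi := hinv ii.
have [e e0 eE] := factor_homogeneous fgc hi hex.
have [e' e0' eE'] := factor_homogeneous fgc' hi hex.
have [y dy hy] := hex.
have ee : e + e' = 0.
  apply: (@homog_unique L _ _ (h (fun l => y (js l))) (h (fun l => y (js l))) hy) => t t0.
  have dty : den.@[scale_coord i t y] != 0 by rewrite den_scale mulf_neq0 // expf_neq0.
  rewrite expr0z mul1r -[RHS](hi t y) // -[RHS]fgc // eE // eE' // mulrACA fgc //.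
  by rewrite expfzDr.
exists e; have -> : - e = e' by lia.
by split=> // jj; move: (e0 jj) (e0' jj); lia.
Qed.

(** In [u] and [v], which take the value zero on the chart, the degrees of two factors
    of a function of [s] are nonnegative and opposite, hence zero. *)
Lemma factor_plane_constant w u v s : w != 0 -> (forall l, s l != 0) ->
  f.@[cpt w u v s] = f.@[cpt w 0 0 s].
Proof.
move=> w0 s0.
have cst (p q : 'I_N -> L) : (forall t, t != 0 ->
    f.@[fun i => p i + t * q i] = f.@[fun i => p i + 1 * q i]) ->
    f.@[fun i => p i + 1 * q i] = f.@[p].
  move=> H; have [P PE] := meval_line f p q.
  have := @horner0_homog _ P 0 f.@[fun i => p i + 1 * q i].
  case=> [t t0|/(_ erefl) <- _ _]; first by rewrite -PE H // expr0z mul1r.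
  by rewrite -PE; apply: meval_eq => i; rewrite mul0r addr0.
have cu t : cpt w (t * u) v s =1 (fun i => cpt w 0 v s i + t * pt 0 0 0 u 0 (fun=> 0) i).
  by move=> i; rewrite /cpt; case: (ix_cases i) => [->|->|->|[->|->|[l ->]]];
    rewrite !ptE ?mulr0 ?addr0 ?add0r.
have cv t : cpt w 0 (t * v) s =1 (fun i => cpt w 0 0 s i + t * pt 0 0 0 0 v (fun=> 0) i).
  by move=> i; rewrite /cpt; case: (ix_cases i) => [->|->|->|[->|->|[l ->]]];
    rewrite !ptE ?mulr0 ?addr0 ?add0r.
have [_ su sv _] := scale_coords w u v s.
have [_ _ sv0 _] := scale_coords w 0 v s.
transitivity (f.@[cpt w 0 v s]).
  rewrite -{1}(mul1r u) (meval_eq _ (cu 1)) cst // => t t0.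
  rewrite -(meval_eq _ (cu t)) -(meval_eq _ (cu 1)) mul1r -!chart_coords -su.
  have [e [/(_ (or_introl erefl)) -> eE _]] := opposite_degrees (or_intror (or_introl erefl)).
  by rewrite eE ?expr0z ?mul1r //; exact: den_coords.
rewrite -{1}(mul1r v) (meval_eq _ (cv 1)) cst // => t t0.
rewrite -(meval_eq _ (cv t)) -(meval_eq _ (cv 1)) mul1r -!chart_coords -sv0.
have [e [/(_ (or_intror erefl)) -> eE _]] := opposite_degrees (or_intror (or_intror erefl)).
by rewrite eE ?expr0z ?mul1r //; exact: den_coords.
Qed.

Lemma factor_circle_homogeneous : exists e : int, forall t w s,
  t != 0 -> w != 0 -> (forall l, s l != 0) ->
  f.@[cpt (t * w) 0 0 s] = t ^ e * f.@[cpt w 0 0 s] /\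
  g.@[cpt (t * w) 0 0 s] = t ^ (- e) * g.@[cpt w 0 0 s].
Proof.
have [e [_ eE eE']] := opposite_degrees (or_introl erefl).
exists e => t w s t0 w0 s0; have [sw _ _ _] := scale_coords w 0 0 s.
by rewrite -!chart_coords -sw eE ?eE' //; exact: den_coords.
Qed.

End Factor.

Lemma unit_homogeneous (f g : {mpoly L[N]}) l :
  (forall w u v s, w != 0 -> (forall l, s l != 0) ->
     f.@[cpt w u v s] * g.@[cpt w u v s] = 1) ->
  exists e : int, forall t w u v s, t != 0 -> w != 0 -> (forall l, s l != 0) ->
    f.@[cpt w u v (upd s l t)] = t ^ e * f.@[cpt w u v s].
Proof.
move=> fg; have fgc y : den.@[y] != 0 -> f.@[chart y] * g.@[chart y] = 1.
  move=> dy; have := dy; rewrite chart_denE mulf_eq0 => /norP[w0 /prodf_neq0 s0].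
  by rewrite chart_cpt fg // => l'; exact: s0.
have one : forall s : 'I_k.+1 -> L, (forall l, s l != 0) -> den.@[coords 1 0 0 s] != 0.
  by move=> s s0; apply: den_coords => //; exact: oner_neq0.
have ex : exists2 y : 'I_(3 + k.+1) -> L, den.@[y] != 0 & (1 : L) != 0.
  by exists (coords 1 0 0 (fun=> 1)); [apply: one => l'|]; exact: oner_neq0.
have [e _ eE] := factor_homogeneous (i := js l) fgc (fun _ _ _ _ => erefl) ex.
exists e => t w u v s t0 w0 s0; have [_ _ _ ss] := scale_coords w u v s.
by rewrite -!chart_coords -ss eE //; exact: den_coords.
Qed.

(** At the points where [s_0] is a root of [P1 P2], the punctured line
    [w != 0, wbar = 0] is completed by the point [w = wbar = 0]. *)
Definition root_point (u v : L) (s : 'I_k.+1 -> L) : 'I_N -> L :=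
  pt 0 0 (\prod_l s l)^-1 u v s.

Lemma root_point_onX u v s : P12 (s ord0) = 0 -> (forall l, s l != 0) -> onX (root_point u v s).
Proof.
move=> s00 s0; apply/on_X; rewrite /root_point !ptE expr0n addr0 -s00; split=> //.
under [X in _ * X]eq_bigr do rewrite ptE.
by rewrite mulVf //; apply/prodf_neq0 => l _.
Qed.

Lemma cpt_root_line t u v s : P12 (s ord0) = 0 ->
  cpt t u v s =1 (fun i => root_point u v s i +
    t * pt (2%:R^-1) ((2%:R * 'i)^-1) 0 0 0 (fun=> 0) i).
Proof.
move=> s00 i; rewrite /cpt /root_point s00 mul0r addr0 subr0.
by case: (ix_cases i) => [->|->|->|[->|->|[l ->]]]; rewrite !ptE ?mulr0 ?addr0 ?add0r.
Qed.

Lemma root_point_limit (f : {mpoly L[N]}) (e : int) u v s : P12 (s ord0) = 0 ->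
  (forall t, t != 0 -> f.@[cpt t u v s] = t ^ e * f.@[cpt 1 u v s]) ->
  [/\ e = 0 -> f.@[root_point u v s] = f.@[cpt 1 u v s],
      0 < e -> f.@[root_point u v s] = 0 & e < 0 -> f.@[root_point u v s] = 0].
Proof.
move=> s00 H.
have [P PE] := meval_line f (root_point u v s) (pt (2%:R^-1) ((2%:R * 'i)^-1) 0 0 0 (fun=> 0)).
have P0 : P.[0] = f.@[root_point u v s].
  by rewrite -PE; apply: meval_eq => i; rewrite mul0r addr0.
have [|e0 ep en] := @horner0_homog _ P e f.@[cpt 1 u v s].
  by move=> t t0; rewrite -PE -(meval_eq _ (cpt_root_line t u v s00)) H.
by rewrite -P0; split=> // /en[].
Qed.

Section Automorphism.
Variables Phi Psi : N.-tuple {mpoly L[N]}.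
Definition act (T : N.-tuple {mpoly L[N]}) (z : 'I_N -> L) : 'I_N -> L :=
  fun i => (tnth T i).@[z].
Hypotheses (PhiX : forall z, onX z -> onX (act Phi z))
  (PsiX : forall z, onX z -> onX (act Psi z))
  (PsiPhi : forall z, onX z -> act Psi (act Phi z) =1 z)
  (PhiPsi : forall z, onX z -> act Phi (act Psi z) =1 z).

Lemma tau_s_unit z l : onX z -> z (is_ l) * (z (it k) * \prod_(l' | l' != l) z (is_ l')) = 1.
Proof. by move=> /on_X[_ E]; rewrite mulrCA -[RHS]E; congr (_ * _); rewrite [RHS](bigD1 l). Qed.

Definition unit_cofactor l : {mpoly L[N]} :=
  tnth Phi (it k) * \prod_(l' | l' != l) tnth Phi (is_ l').

Lemma unit_cofactorP l z : onX z -> (tnth Phi (is_ l)).@[z] * (unit_cofactor l).@[z] = 1.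
Proof.
move=> /PhiX Xz; rewrite -(tau_s_unit l Xz) mevalM; congr (_ * (_ * _)).
by rewrite rmorph_prod.
Qed.

Let onX_cpt w u v s : w != 0 -> (forall l, s l != 0) -> onX (cpt w u v s).
Proof. exact: cpt_on_X. Qed.

Let sol w u v s : w != 0 -> (forall l, s l != 0) -> forall l,
  (tnth Phi (is_ l)).@[cpt w u v s] * (unit_cofactor l).@[cpt w u v s] = 1.
Proof. by move=> w0 s0 l; exact/unit_cofactorP/onX_cpt. Qed.

Let ones_ok : exists2 s : 'I_k.+1 -> L, (forall l, s l != 0) & (1 : L) != 0.
Proof. by exists (fun=> 1) => [l|]; exact: oner_neq0. Qed.

Let P12_2 : P12 (2%:R : L) = 0. Proof. by rewrite /P12 /P2 subrr mul0r mulr0. Qed.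

Let two0 : (2%:R : L) != 0. Proof. by rewrite pnatr_eq0. Qed.

(** A unit does not depend on [u] and [v]. Its degree in [w] vanishes too: at the
    point [w = wbar = 0] over a root of [P1 P2], a limit for [w] tending to zero,
    the unit would otherwise vanish. *)
Lemma s_comp w u v s l : w != 0 -> (forall l, s l != 0) ->
  (tnth Phi (is_ l)).@[cpt w u v s] = (tnth Phi (is_ l)).@[cpt 1 0 0 s].
Proof.
move=> w0 s0.
have H w u v s := fun w0 s0 => @sol w u v s w0 s0 l.
rewrite (factor_plane_constant H ones_ok) //.
have [e eE] := factor_circle_homogeneous H ones_ok.
suff e0 : e = 0.
  by have [] := eE w 1 s w0 (oner_neq0 _) s0; rewrite mulr1 e0 expr0z mul1r.
pose s2 : 'I_k.+1 -> L := fun=> 2%:R.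
have s20 l' : s2 l' != 0 by [].
have := @root_point_limit (tnth Phi (is_ l)) e 0 0 s2 P12_2.
case=> [t t0|_ ep en].
  by have [] := eE t 1 s2 t0 (oner_neq0 _) s20; rewrite mulr1.
have nz : (tnth Phi (is_ l)).@[root_point 0 0 s2] != 0.
  have := unit_cofactorP l (root_point_onX 0 0 P12_2 s20).
  by apply: contra_eq_neq => ->; rewrite mul0r eq_sym oner_neq0.
apply/eqP/negPn/negP => e0; case/negP: nz; apply/eqP.
by have [/en|/ep|] := ltrgtP e 0 => // e00; rewrite e00 eqxx in e0.
Qed.

Lemma s_comp_root u v s l : P12 (s ord0) = 0 -> (forall l, s l != 0) ->
  (tnth Phi (is_ l)).@[root_point u v s] = (tnth Phi (is_ l)).@[cpt 1 0 0 s].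
Proof.
move=> s00 s0; have [|-> //] := @root_point_limit (tnth Phi (is_ l)) 0 u v s s00.
  by move=> t t0; rewrite expr0z mul1r s_comp // [RHS]s_comp // oner_neq0.
by rewrite s_comp // oner_neq0.
Qed.

Definition s0_at (s : 'I_k.+1 -> L) := (tnth Phi (is_ ord0)).@[cpt 1 0 0 s].

(** Otherwise [P1 P2] would vanish on the image of [Phi], which is all of [X]. *)
Lemma P12_s0_neq0 : exists2 s, (forall l, s l != 0) & P12 (s0_at s) != 0.
Proof.
apply: contrapT => nH.
have H' s : (forall l, s l != 0) -> P12 (s0_at s) = 0.
  by move=> s0; apply/eqP/negPn/negP => P0; apply: nH; exists s.
pose q : {mpoly L[N]} := P1 (tnth Phi (is_ ord0)) * P2 (tnth Phi (is_ ord0)).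
have qE z : q.@[z] = P12 (tnth Phi (is_ ord0)).@[z].
  by rewrite mevalM rmorph_P1 rmorph_P2.
have qI : q \in defining_ideal X.
  apply: (X_ideal_of_points (iota := idfun)) => z Xz Pz.
  have w0 : z (ix k) + 'i * z (iy k) != 0.
    by apply: contra_neq Pz => w0; rewrite -/(P12 _) -(X_w_wbar Xz) w0 mul0r.
  rewrite (eq_mmap _ _ (X_point_cpt Xz w0)) -[LHS]/(q.@[_]) qE s_comp ?H' //.
    exact: X_point_cases Xz.
  exact: X_point_cases Xz.
pose z3 : 'I_N -> L := cpt 1 0 0 (fun=> 3%:R).
have X3 : onX z3 by apply: onX_cpt => [|l]; rewrite ?oner_neq0 // pnatr_eq0.
have := ideal_on_points (PsiX X3) qI; rewrite -[LHS]/(q.@[_]) qE.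
rewrite -[(tnth Phi _).@[_]]/(act Phi (act Psi z3) (is_ ord0)) PhiPsi // /z3 /cpt ptE.
by move/eqP; rewrite (negPf (P1P2_3_neq0 L)).
Qed.

Definition w_comp : {mpoly L[N]} := tnth Phi (ix k) + ('i)%:MP * tnth Phi (iy k).
Definition wbar_comp : {mpoly L[N]} := tnth Phi (ix k) - ('i)%:MP * tnth Phi (iy k).

Lemma w_compE z : w_comp.@[z] = act Phi z (ix k) + 'i * act Phi z (iy k).
Proof. by rewrite mevalD mevalM mevalC. Qed.

Lemma wbar_compE z : wbar_comp.@[z] = act Phi z (ix k) - 'i * act Phi z (iy k).
Proof. by rewrite mevalB mevalM mevalC. Qed.

Lemma w_wbar_comp w u v s : w != 0 -> (forall l, s l != 0) ->
  w_comp.@[cpt w u v s] * wbar_comp.@[cpt w u v s] = P12 (s0_at s).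
Proof.
move=> w0 s0; rewrite w_compE wbar_compE (X_w_wbar (PhiX (onX_cpt u v w0 s0))).
by rewrite -[act _ _ _]/((tnth Phi (is_ ord0)).@[_]) s_comp.
Qed.

Lemma wbar_w_comp w u v s : w != 0 -> (forall l, s l != 0) ->
  wbar_comp.@[cpt w u v s] * w_comp.@[cpt w u v s] = P12 (s0_at s).
Proof. by move=> w0 s0; rewrite mulrC w_wbar_comp. Qed.

Lemma w_comp_plane w u v s : w != 0 -> (forall l, s l != 0) ->
  w_comp.@[cpt w u v s] = w_comp.@[cpt w 0 0 s] /\
  wbar_comp.@[cpt w u v s] = wbar_comp.@[cpt w 0 0 s].
Proof.
move=> w0 s0; split.
  exact: (factor_plane_constant w_wbar_comp P12_s0_neq0).
exact: (factor_plane_constant wbar_w_comp P12_s0_neq0).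
Qed.

(** The degrees of [w o Phi] and [wbar o Phi] in [w] are opposite, as their product
    is a function of [s]. *)
Definition w_exponent (e : int) : Prop := forall t w s,
  t != 0 -> w != 0 -> (forall l, s l != 0) ->
  w_comp.@[cpt (t * w) 0 0 s] = t ^ e * w_comp.@[cpt w 0 0 s] /\
  wbar_comp.@[cpt (t * w) 0 0 s] = t ^ (- e) * wbar_comp.@[cpt w 0 0 s].

Lemma w_exponent_exists : exists e, w_exponent e.
Proof. exact: (factor_circle_homogeneous w_wbar_comp P12_s0_neq0). Qed.

Lemma scale_s0 : exists e : int, forall t s, t != 0 -> (forall l, s l != 0) ->
  s0_at (upd s ord0 t) = t ^ e * s0_at s.
Proof.
have H w u v s := fun w0 s0 => @sol w u v s w0 s0 ord0.
have [e eE] := unit_homogeneous ord0 H; exists e => t s t0 s0.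
by apply: eE => //; exact: oner_neq0.
Qed.

End Automorphism.

Section Rigidity.
Variables Phi Psi : N.-tuple {mpoly L[N]}.
Hypotheses (PhiX : forall z, onX z -> onX (act Phi z))
  (PsiX : forall z, onX z -> onX (act Psi z))
  (PsiPhi : forall z, onX z -> act Psi (act Phi z) =1 z)
  (PhiPsi : forall z, onX z -> act Phi (act Psi z) =1 z).

Lemma cpt_w (w u v : L) s : w != 0 -> cpt w u v s (ix k) + 'i * cpt w u v s (iy k) = w.
Proof.
move=> w0; have i0 : ('i : L) != 0 by exact: neq0Ci.
by rewrite /cpt !ptE; field; rewrite w0 i0.
Qed.

(** [w o Phi] and [w o Psi] are [w] to the powers [e] and [e'], up to functions
    of [s], so their composition [w] is homogeneous of degree [e e']. *)
Lemma exponents_inverse e e' : w_exponent Phi e -> w_exponent Psi e' -> e * e' = 1.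
Proof.
move=> He He'; have [s s0 Ps] := P12_s0_neq0 PsiX PhiX PsiPhi.
have n1 : (1 : L) != 0 by exact: oner_neq0.
have Xq t : t != 0 -> onX (cpt t 0 0 s) by move=> t0; exact: cpt_on_X.
have wq t : t != 0 -> (w_comp Psi).@[cpt t 0 0 s] != 0.
  move=> t0; apply: contra_neq Ps => w0.
  by rewrite -(w_wbar_comp PsiX 0 0 t0 s0) w0 mul0r.
pose s1 l := act Psi (cpt 1 0 0 s) (is_ l).
have s1E t l : t != 0 -> act Psi (cpt t 0 0 s) (is_ l) = s1 l.
  by move=> t0; rewrite /s1 /act (s_comp PsiX).
have s10 l : s1 l != 0 by exact: X_point_cases (PsiX (Xq 1 n1)) l.
pose c := (w_comp Psi).@[cpt 1 0 0 s].
have c0 : c != 0 by exact: wq.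
have key t : t != 0 -> t = (t ^ e' * c) ^ e * (w_comp Phi).@[cpt 1 0 0 s1].
  move=> t0; have Xt := PsiX (Xq t t0).
  have wt : act Psi (cpt t 0 0 s) (ix k) + 'i * act Psi (cpt t 0 0 s) (iy k) = t ^ e' * c.
    rewrite -w_compE; have [<- _] := He' t 1 s t0 n1 s0; by rewrite mulr1.
  have wt0 : t ^ e' * c != 0 by rewrite mulf_neq0 // expfz_neq0.
  have E : (w_comp Phi).@[act Psi (cpt t 0 0 s)] = t.
    by rewrite w_compE !(PhiPsi (Xq t t0)) cpt_w.
  rewrite -[LHS]E.
  have nz : act Psi (cpt t 0 0 s) (ix k) + 'i * act Psi (cpt t 0 0 s) (iy k) != 0 by rewrite wt.
  rewrite (meval_eq _ (X_point_cpt Xt nz)) wt.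
  have -> : (fun l => act Psi (cpt t 0 0 s) (is_ l)) = s1 by apply/funext => l; rewrite s1E.
  have [-> _] := w_comp_plane PhiX PsiX PhiPsi (act Psi (cpt t 0 0 s) (iu k))
    (act Psi (cpt t 0 0 s) (iv k)) wt0 s10.
  by have [] := He (t ^ e' * c) 1 s1 wt0 n1 s10; rewrite mulr1.
have one := key 1 n1; rewrite exp1rz mul1r in one.
apply: (@homog_unique L _ _ 1 1 n1) => t t0.
by rewrite expr1z !mulr1 [RHS]key // expfzMl -mulrA -one mulr1 exprz_exp mulrC.
Qed.

(** Over a root, [w o Phi] or [wbar o Phi] is homogeneous of positive degree in [w],
    hence vanishes at the point [w = wbar = 0]. *)
Lemma root_to_root e s : w_exponent Phi e -> e = 1 \/ e = -1 ->
  (forall l, s l != 0) -> P12 (s ord0) = 0 -> P12 (s0_at Phi s) = 0.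
Proof.
move=> He ee s0 s00; have n1 : (1 : L) != 0 by exact: oner_neq0.
have X0 := PhiX (root_point_onX 0 0 s00 s0).
have E : (w_comp Phi).@[root_point 0 0 s] * (wbar_comp Phi).@[root_point 0 0 s] =
    P12 (s0_at Phi s).
  rewrite w_compE wbar_compE (X_w_wbar X0); congr P12.
  exact: (s_comp_root PhiX).
rewrite -E; case: ee => ee; rewrite ee in He.
  have [|_ -> //] := @root_point_limit (w_comp Phi) 1 0 0 s s00; last by rewrite mul0r.
  by move=> t t0; have [] := He t 1 s t0 n1 s0; rewrite mulr1.
have [|_ -> //] := @root_point_limit (wbar_comp Phi) 1 0 0 s s00; last by rewrite mulr0.
by move=> t t0; have [] := He t 1 s t0 n1 s0; rewrite mulr1 opprK.
Qed.

Lemma P12_roots (x : L) : P12 x = 0 -> [\/ x = 1, x = 2%:R | x ^+ 2 = -1].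
Proof.
rewrite /P12 /P1 /P2 => /eqP; rewrite !mulf_eq0 !subr_eq0 addr_eq0.
by case/or3P => /eqP; [constructor 1 | constructor 2 | constructor 3].
Qed.

Lemma P12_norm (x : L) : P12 x = 0 -> `|x| = 1 \/ `|x| = 2%:R /\ x = 2%:R.
Proof.
case/P12_roots => [->|->|x2]; [left; exact: normr1|right; by rewrite normr_nat|left].
have : `|x| ^+ 2 = 1 by rewrite -normrX x2 normrN1.
by move=> /eqP; rewrite sqrp_eq1 // => /eqP.
Qed.

(** Every root of [P1 P2] has modulus [1], but for [2]. If [1], [2] and [i] are sent
    to roots, comparing moduli leaves the identity and [s |-> 2 / s], and the
    latter sends [i] to [- 2 i]. This is what the factor [s^2 + 1] of [P2] is for. *)
Lemma roots_rigid (lam : L) (e : int) : e != 0 -> P12 lam = 0 ->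
  P12 (2%:R ^ e * lam) = 0 -> P12 ('i ^ e * lam) = 0 -> e = 1 /\ lam = 1.
Proof.
move=> e0 r1 r2 ri.
have two : `|(2%:R : L)| = 2%:R by exact: normr_nat.
have nz (n : nat) : (0 < n)%N -> n%:R != 0 :> L by rewrite pnatr_eq0 -lt0n.
have ne (a b : nat) : a != b -> a%:R <> b%:R :> L by move=> ab /eqP; rewrite eqr_nat (negPf ab).
have n2 : `|(2%:R : L) ^ e * lam| = 2%:R ^ e * `|lam|.
  rewrite normrM; congr (_ * _); case: (e) => n; first by rewrite -exprnP normrX two.
  by rewrite NegzE -exprnN normfV normrX two.
have t0 : (2%:R : L) != 0 by exact: nz.
have norm12 (x : L) : P12 x = 0 -> exists a : nat, ((a == 1%N) || (a == 2%N)) /\ `|x| = a%:R.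
  by move=> x0; have [->|[-> _]] := P12_norm x0; [exists 1%N | exists 2%N].
have [e1|[e1|[e2|e2]]] : e = 1 \/ e = -1 \/ (2 <= e) \/ (e <= -2) by lia.
- split=> //; subst e; case: (P12_norm r2) => [|[_]].
    rewrite n2 expr1z; case: (P12_norm r1) => [->|[-> _]].
      by rewrite mulr1 => /(ne 2 1 isT).
    by rewrite -natrM => /(ne 4 1 isT).
  by rewrite expr1z -{2}(mulr1 2%:R) => /(mulfI t0).
- subst e; have lam2 : lam = 2%:R.
    case: (P12_norm r1) => [l1|[_ //]]; case: (P12_norm r2); rewrite n2 l1 mulr1 exprN1.
      move=> /(congr1 (fun z => z * 2%:R)); rewrite mulVf // mul1r => E.
      by case: (ne 1%N 2%N isT); rewrite -E.
    case=> E _; move: E => /(congr1 (fun z => z * 2%:R)); rewrite mulVf // -natrM => E.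
    by case: (ne 1%N 4%N isT); rewrite -E.
  have ni : `|'i ^ (-1) * lam| = 2%:R.
    by rewrite lam2 normrM exprN1 normfV normCi invr1 mul1r two.
  case: (P12_norm ri) => [|[_]]; rewrite ?ni; first by move/(ne 2 1 isT).
  rewrite lam2 exprN1 -{2}(mul1r 2%:R) => /(mulIf t0) ii.
  have i1 : ('i : L) = 1 by rewrite -[LHS]invrK ii invr1.
  have := sqrCi L; rewrite i1 expr1n => /eqP; rewrite -subr_eq0 opprK -natr1.
  by rewrite (negPf (nz 2 isT)).
- exfalso; have [n en] : exists n : nat, e = n.+2 by exists (absz e - 2)%N; lia.
  have [a [a12 aE]] := norm12 _ r1; have [b [b12 bE]] := norm12 _ r2.
  move: bE; rewrite n2 aE en -exprnP -natrX -natrM => /eqP; rewrite eqr_nat => /eqP.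
  have : (0 < 2 ^ n)%N by rewrite expn_gt0.
  by rewrite !expnS; move: a12 b12 => /orP[] /eqP -> /orP[] /eqP ->; lia.
- exfalso; have [n en] : exists n : nat, e = - (n.+2)%:Z by exists (absz e - 2)%N; lia.
  have [a [a12 aE]] := norm12 _ r1; have [b [b12 bE]] := norm12 _ r2.
  move: bE; rewrite n2 aE en -exprnN => /(congr1 (fun z => 2%:R ^+ n.+2 * z)).
  rewrite mulrA mulfV ?mul1r ?expf_neq0 // -natrX -natrM => /eqP; rewrite eqr_nat => /eqP.
  have : (0 < 2 ^ n)%N by rewrite expn_gt0.
  by rewrite !expnS; move: a12 b12 => /orP[] /eqP -> /orP[] /eqP ->; lia.
Qed.

Definition ones (t : L) : 'I_k.+1 -> L := upd (fun=> 1) ord0 t.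

Lemma ones0 t : ones t ord0 = t.
Proof. by rewrite /ones /upd eqxx mulr1. Qed.

Lemma ones_neq0 t : t != 0 -> forall l, ones t l != 0.
Proof. by move=> t0 l; rewrite /ones /upd; case: ifP => _; rewrite ?mulr1 // oner_neq0. Qed.

(** The function [s_0 o Phi] is a monomial in [s_0], and maps roots of [P1 P2] to roots. *)
Lemma s0_fixed : (exists e, w_exponent Phi e /\ (e = 1 \/ e = -1)) ->
  forall t, t != 0 -> s0_at Phi (ones t) = t.
Proof.
move=> [e [He ee]]; have [d dE] := scale_s0 PhiX.
have n1 : (1 : L) != 0 by exact: oner_neq0.
have o1 (l : 'I_k.+1) : (1 : L) != 0 by [].
have r1 : P12 (1 : L) = 0 by rewrite /P12 /P1 subrr mul0r.
have r2 : P12 (2%:R : L) = 0 by rewrite /P12 /P2 subrr mul0r mulr0.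
have ri : P12 ('i : L) = 0 by rewrite /P12 /P2 sqrCi addNr !mulr0.
have two0 : (2%:R : L) != 0 by rewrite pnatr_eq0.
have i0 : ('i : L) != 0 by exact: neq0Ci.
pose lam := s0_at Phi (fun=> 1).
have lamE t : t != 0 -> s0_at Phi (ones t) = t ^ d * lam by move=> t0; rewrite dE.
have rt t : t != 0 -> P12 t = 0 -> P12 (t ^ d * lam) = 0.
  move=> t0 tr; rewrite -lamE //; apply: root_to_root He ee (ones_neq0 t0) _.
  by rewrite ones0.
(* A constant [s_0 o Phi] would always be a root, as it is one over [s_0 = 1]. *)
have d0 : d != 0.
  apply/negP => /eqP d0; have [s s0 /negP] := P12_s0_neq0 PhiX PsiX PhiPsi; case; apply/eqP.
  have s00 := s0 ord0.
  have := dE (s ord0)^-1 s; rewrite invr_eq0 d0 expr0z mul1r => <- //.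
  apply: root_to_root He ee _ _ => [l|]; last by rewrite /upd eqxx mulVf.
  by rewrite /upd; case: (l == ord0); rewrite ?mulf_neq0 ?invr_eq0.
have lam1 := rt 1 n1 r1; rewrite exp1rz mul1r in lam1.
have [d1 l1] := roots_rigid d0 lam1 (rt _ two0 r2) (rt _ i0 ri).
by move=> t t0; rewrite lamE // d1 l1 expr1z mulr1.
Qed.

(** The exponents of [Phi] and of its inverse have product one. *)
Lemma w_comp_dichotomy : exists e, w_exponent Phi e /\ (e = 1 \/ e = -1).
Proof.
have [e He] := w_exponent_exists PhiX PsiX PhiPsi.
have [e' He'] := w_exponent_exists PsiX PhiX PsiPhi.
exists e; split=> //; have := exponents_inverse He He' => ee.
have : (absz e * absz e')%N = 1%N by rewrite -abszM ee.
by move/eqP; rewrite muln_eq1 => /andP[/eqP a _]; lia.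
Qed.

Definition zero_section (z : 'I_N -> L) : 'I_N -> L :=
  fun i => if (i == iu k) || (i == iv k) then 0 else z i.

Lemma zero_section_cpt w u v s : zero_section (cpt w u v s) =1 cpt w 0 0 s.
Proof.
by move=> i; rewrite /zero_section /cpt; case: (ix_cases i) => [->|->|->|[->|->|[l ->]]];
  rewrite ?eqxx ?orbT ?ptE.
Qed.

Lemma zero_section_onX z : onX z -> onX (zero_section z).
Proof. by move=> /on_X[e1 e2]; apply/on_X. Qed.

Lemma plane_constant_on_X (f : {mpoly L[N]}) :
  (forall w u v s, w != 0 -> (forall l, s l != 0) ->
     f.@[cpt w u v s] = f.@[cpt w 0 0 s]) ->
  forall z, onX z -> f.@[z] = f.@[zero_section z].
Proof.
move=> ff z Xz.
pose F : N.-tuple {mpoly L[N]} := [tuple if (i == iu k) || (i == iv k) then 0 else 'X_i | i < N].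
have FE z' : (f \mPo F).@[z'] = f.@[zero_section z'].
  rewrite comp_mpoly_meval; apply: meval_eq => i; rewrite tnth_mktuple /zero_section.
  by case: ifP => _; rewrite ?meval0 ?mevalXU.
apply/eqP; rewrite -subr_eq0 -FE -mevalB; apply/eqP.
apply: (ideal_on_points (iota := idfun) Xz).
apply: (X_ideal_of_points (iota := idfun)) => z' Xz' Pz.
have w0 : z' (ix k) + 'i * z' (iy k) != 0.
  by apply: contra_neq Pz => w0; rewrite -/(P12 _) -(X_w_wbar Xz') w0 mul0r.
rewrite (eq_mmap _ _ (X_point_cpt Xz' w0)) -[LHS]/((f - _).@[_]) mevalB FE.
rewrite (meval_eq _ (zero_section_cpt _ _ _ _)) ff ?subrr //; exact: X_point_cases Xz'.
Qed.

(** All components but [u] and [v] are determined by functions that are constant on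
    the planes [w, s = constant], so [Phi] induces a map of the bases. *)
Lemma base_comp_zero_section z i : onX z -> i != iu k -> i != iv k ->
  act Phi z i = act Phi (zero_section z) i.
Proof.
move=> Xz; have Xf := zero_section_onX Xz; have two0 : (2%:R : L) != 0 by rewrite pnatr_eq0.
have i0 : ('i : L) != 0 by exact: neq0Ci.
have n1 : (1 : L) != 0 by exact: oner_neq0.
have W : (w_comp Phi).@[z] = (w_comp Phi).@[zero_section z].
  apply: plane_constant_on_X => // w u v s w0 s0.
  by have [] := w_comp_plane PhiX PsiX PhiPsi u v w0 s0.
have W' : (wbar_comp Phi).@[z] = (wbar_comp Phi).@[zero_section z].
  apply: plane_constant_on_X => // w u v s w0 s0.
  by have [] := w_comp_plane PhiX PsiX PhiPsi u v w0 s0.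
have S l : act Phi z (is_ l) = act Phi (zero_section z) (is_ l).
  apply: plane_constant_on_X => // w u v s w0 s0.
  by rewrite (s_comp PhiX) // [RHS](s_comp PhiX).
rewrite !w_compE in W; rewrite !wbar_compE in W'.
case: (ix_cases i) => [->|->|->|[->|->|[l ->]]]; rewrite ?eqxx // => _ _.
- apply: (mulfI two0); transitivity ((act Phi z (ix k) + 'i * act Phi z (iy k)) + (act Phi z (ix k) - 'i * act Phi z (iy k))); first by ring.
  by rewrite W W'; ring.
- apply: (mulfI (mulf_neq0 two0 i0)); transitivity ((act Phi z (ix k) + 'i * act Phi z (iy k)) - (act Phi z (ix k) - 'i * act Phi z (iy k))); first by ring.
  by rewrite W W'; ring.
- have /on_X[_ t1] := PhiX Xz; have /on_X[_ t2] := PhiX Xf.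
  have p0 : \prod_l act Phi z (is_ l) != 0.
    by apply: contra_eq_neq t1 => ->; rewrite mulr0 eq_sym.
  have pE : \prod_l act Phi z (is_ l) = \prod_l act Phi (zero_section z) (is_ l).
    by apply: eq_bigr => l _; rewrite S.
  by apply: (mulIf p0); rewrite t1 pE t2.
Qed.

End Rigidity.

End Units.

(** * Isomorphisms between forms as automorphisms of the complexification *)

Section Curves.
Variables (L : fieldType) (n : nat).
Implicit Types (f : {mpoly L[n]}) (c : 'I_n -> {poly L}).

(** The restriction of a polynomial to a parametrised curve. *)
Definition along c f : {poly L} := mmap (@polyC L) c f.

Lemma along_horner c f t : (along c f).[t] = f.@[fun i => (c i).[t]].
Proof.
rewrite /along; elim/mpoly_ring_ind: f => [x|i|f g IHf IHg|f g IHf IHg].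
- by rewrite mmapC hornerC mevalC.
- by rewrite mmapX mmap1U mevalXU.
- by rewrite mmapD hornerD IHf IHg mevalD.
- by rewrite rmorphM hornerM IHf IHg mevalM.
Qed.

Lemma along_coef1 c f : (along c f)`_1 = \sum_i f^`M(i).@[fun i => (c i)`_0] * (c i)`_1.
Proof.
have at0 g : (along c g)`_0 = g.@[fun i => (c i)`_0].
  by rewrite -horner_coef0 along_horner; apply: meval_eq => i; rewrite horner_coef0.
elim/mpoly_ring_ind: f => [x|j|f g IHf IHg|f g IHf IHg].
- rewrite /along mmapC coefC /= big1 // => i _.
  by rewrite mderivC meval0 mul0r.
- rewrite /along mmapX mmap1U (bigD1 j) //= mderivXU eqxx mevalC mul1r big1 ?addr0 // => i ij.
  by rewrite mderivXU eq_sym (negPf ij) mevalC mul0r.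
- rewrite {1}/along mmapD coefD -/(along c f) -/(along c g) IHf IHg -big_split /=.
  by apply: eq_bigr => i _; rewrite mderivD mevalD mulrDl.
rewrite {1}/along rmorphM -/(along c f) -/(along c g) coefM big_ord_recl big_ord1 /=.
rewrite !at0 IHf IHg mulr_sumr mulr_suml -big_split /=.
by apply: eq_bigr => i _; rewrite mderivM mevalD !mevalM; ring.
Qed.

End Curves.

Section Transport.
Variables (K : fieldType) (k : nat) (L : numClosedFieldType) (iota : {rmorphism K -> L}).
Notation N := (5 + k.+1)%N.
Notation N' := (7 + k.+1)%N.
Notation X := (sphere_torus_plane L k).
Notation onX := (on_points idfun X).

Lemma morphism_on_points (Y Z : affine_scheme K) (F : (ambient Z).-tuple {mpoly K[ambient Y]}) v :
  is_morphism F -> on_points iota Y v -> on_points iota Z (fun j => mmap iota v (tnth F j)).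
Proof.
move=> FM Yv e eZ; rewrite -mmap_comp_mpoly.
by apply: (ideal_on_points Yv); apply/FM/mem_ideal_gen.
Qed.

Lemma inverse_on_points (Y Z : affine_scheme K) (F : (ambient Z).-tuple {mpoly K[ambient Y]})
    (G : (ambient Y).-tuple {mpoly K[ambient Z]}) v i :
  tnth G i \mPo F - 'X_i \in defining_ideal Y -> on_points iota Y v ->
  mmap iota (fun j => mmap iota v (tnth F j)) (tnth G i) = v i.
Proof.
move=> GF Yv; have := ideal_on_points Yv GF.
by rewrite mmapB mmap_comp_mpoly mmapXU => /eqP; rewrite subr_eq0 => /eqP.
Qed.

Lemma point_of_bundle_onX a b n y :
  on_points iota (plane_bundle a b n k) y -> onX (point_of_bundle y).
Proof.
move=> /on_bundle_glue[e1 e2 _ _]; apply/on_X; rewrite /point_of_bundle !ptE; split=> //.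
by under eq_bigr do rewrite ptE.
Qed.

Lemma bundle_point_ofK a b n (y : 'I_N' -> L) :
  on_points iota (plane_bundle a b n k) y ->
  bundle_point a b n iota (point_of_bundle y) =1 y.
Proof.
move=> /on_bundle_glue[_ _ gu gv] i; rewrite /bundle_point /point_of_bundle !ptE -gu -gv.
have i0 : ('i : L) != 0 by exact: neq0Ci.
by case: (hx_cases i) => [->|->|->|[->|->|[->|->|[l ->]]]]; rewrite !rptE ?ptE //; field.
Qed.

(** The self-map of [X] that corresponds to a morphism between two of its forms. *)
Definition transport (a b : {poly K}) n (F : N'.-tuple {mpoly K[N']}) : N.-tuple {mpoly L[N]} :=
  [tuple (tnth (of_bundle k L) i \mPo [tuple map_mpoly iota (tnth F j) | j < N'])
    \mPo to_bundle a b n k iota | i < N].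

Lemma act_transport a b n F z :
  act (transport a b n F) z =
  point_of_bundle (fun j => mmap iota (bundle_point a b n iota z) (tnth F j)).
Proof.
rewrite -of_bundleE; apply/funext => i; rewrite /act tnth_mktuple !comp_mpoly_meval.
by apply: meval_eq => j; rewrite tnth_mktuple meval_map_mpoly to_bundleE.
Qed.

Section Isomorphism.
Variables (a b a' b' : {poly K}) (n m : nat).
Hypotheses (bez : a * P1 'X ^+ n + b * P2 'X ^+ n = 1).
Hypotheses (bez' : a' * P1 'X ^+ m + b' * P2 'X ^+ m = 1).
Notation Y := (plane_bundle a b n k).
Notation Y' := (plane_bundle a' b' m k).
Variables (F G : N'.-tuple {mpoly K[N']}).
Hypotheses (FM : @is_morphism K Y Y' F) (GM : @is_morphism K Y' Y G).
Hypotheses (GF : forall i, tnth G i \mPo F - 'X_i \in defining_ideal Y).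

Lemma transport_onX z : onX z -> onX (act (transport a b n F) z).
Proof.
move=> Xz; rewrite act_transport; apply: (@point_of_bundle_onX a' b' m).
by apply: (morphism_on_points FM); exact: bundle_point_on.
Qed.

Lemma transportK z : onX z ->
  act (transport a' b' m G) (act (transport a b n F) z) =1 z.
Proof.
move=> Xz i; 
  have Yz : on_points iota Y (bundle_point a b n iota z) by exact: bundle_point_on.
rewrite !act_transport -[RHS](bundle_pointK a b n iota Xz).
suff E : (fun j => mmap iota (bundle_point a' b' m iota
    (point_of_bundle (fun j => mmap iota (bundle_point a b n iota z) (tnth F j)))) (tnth G j))
    = bundle_point a b n iota z by rewrite E.
apply/funext => j; rewrite (eq_mmap _ _ (bundle_point_ofK (morphism_on_points FM Yz))).
exact: (@inverse_on_points Y Y' F G _ j (GF j) Yz).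
Qed.

End Isomorphism.
End Transport.

(** * Real structures *)

Section RealStructure.
Variables (K : fieldType) (k : nat) (L : numClosedFieldType) (iota : {rmorphism K -> L}).
Hypothesis iota_real : forall c, (iota c)^* = iota c.
Notation N := (5 + k.+1)%N.
Notation N' := (7 + k.+1)%N.
Notation X := (sphere_torus_plane L k).
Notation onX := (on_points idfun X).

Lemma conj_mmap n (y : 'I_n -> L) (p : {mpoly K[n]}) : (forall i, (y i)^* = y i) ->
  (mmap iota y p)^* = mmap iota y p.
Proof.
move=> yr; elim/mpoly_ring_ind: p => [c|i|p q IHp IHq|p q IHp IHq].
- by rewrite mmapC iota_real.
- by rewrite mmapXU yr.
- by rewrite mmapD rmorphD /= IHp IHq.
- by rewrite !rmorphM /= IHp IHq.
Qed.

Lemma conj_map_horner (a : {poly K}) s : s^* = s -> ((map_poly iota a).[s])^* = (map_poly iota a).[s].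
Proof.
move=> sr; rewrite -{2}sr -[LHS]horner_map -map_poly_comp; congr _.[_].
by apply: eq_map_poly => c /=; rewrite iota_real.
Qed.

Definition fibre_eqs a b n (x y s0 u v : L) : Prop :=
  u^* = glue_u a b n iota x y s0 'i u v /\ v^* = glue_v a b n iota x y s0 'i u v.

(** The points of [X] that correspond to the real points of a form. *)
Definition real_pt a b n (z : 'I_N -> L) : Prop :=
  (forall i, i != iu k -> i != iv k -> (z i)^* = z i) /\
  fibre_eqs a b n (z (ix k)) (z (iy k)) (z (is_ ord0)) (z (iu k)) (z (iv k)).

Lemma base_index : [/\ ix k != iu k, ix k != iv k, iy k != iu k & iy k != iv k] /\
  [/\ it k != iu k, it k != iv k & forall l, is_ l != iu k /\ is_ l != iv k].
Proof. by split; split=> // l; rewrite !eq_rlshift. Qed.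

(** The real points of a form are those whose coordinates are all real. *)
Lemma bundle_point_real a b n z : real_pt a b n z ->
  forall j, (bundle_point a b n iota z j)^* = bundle_point a b n iota z j.
Proof.
have [[xu xv yu yv] [tu tv su]] := base_index.
move=> [zr [eu ev]] j; rewrite /bundle_point -eu -ev.
have i0 : ('i : L) != 0 by exact: neq0Ci.
have h1 (w : L) : (2%:R^-1 * (w + w^*))^* = 2%:R^-1 * (w + w^*).
  by rewrite rmorphM rmorphD fmorphV rmorph_nat /= conjCK addrC.
have h2 (w : L) : ((2%:R * 'i)^-1 * (w - w^*))^* = (2%:R * 'i)^-1 * (w - w^*).
  by rewrite rmorphM rmorphB fmorphV rmorphM rmorph_nat /= conjCK conjCi; field.
case: (hx_cases j) => [->|->|->|[->|->|[->|->|[l ->]]]]; rewrite !rptE.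
all: try exact: h1.
all: try exact: h2.
all: try exact: zr.
Qed.

Lemma real_point_of_bundle a b n y : on_points iota (plane_bundle a b n k) y ->
  (forall j, (y j)^* = y j) -> real_pt a b n (point_of_bundle y).
Proof.
move=> Yy yr; have [_ _ gu gv] := on_bundle_glue Yy.
split=> [i iu0 iv0|].
  move: iu0 iv0; rewrite /point_of_bundle; case: (ix_cases i) => [->|->|->|[->|->|[l ->]]];
    by rewrite ?ptE ?eqxx.
rewrite /fibre_eqs /point_of_bundle !ptE -gu -gv.
by rewrite !rmorphD !rmorphM /= conjCi !yr !mulNr.
Qed.

Lemma transport_real a b n a' b' m (F : N'.-tuple {mpoly K[N']}) z :
  a * P1 'X ^+ n + b * P2 'X ^+ n = 1 ->
  @is_morphism K (plane_bundle a b n k) (plane_bundle a' b' m k) F ->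
  onX z -> real_pt a b n z -> real_pt a' b' m (act (transport iota a b n F) z).
Proof.
move=> bez FM Xz zr; rewrite act_transport; apply: real_point_of_bundle.
  by apply: (morphism_on_points FM); exact: bundle_point_on.
by move=> j; apply: conj_mmap; exact: bundle_point_real.
Qed.

Section Frame.
Variables (a b : {poly K}) (n : nat) (x y s S T : L).
Hypothesis bez : a * P1 'X ^+ n + b * P2 'X ^+ n = 1.
Hypotheses (Sr : S^* = S) (sr : s^* = s) (wE : x + 'i * y = S * T) (wE' : x - 'i * y = S * T^*)
  (SP : S ^+ 2 = P1 s) (TP : T * T^* = P2 s).
Let al := (map_poly iota a).[s].
Let be := (map_poly iota b).[s].

Definition frame_u (c d : L) := S ^+ n * c - be * T ^+ n * d.
Definition frame_v (c d : L) := T^* ^+ n * c + al * S ^+ n * d.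

Let alr : al^* = al. Proof. exact: conj_map_horner. Qed.
Let ber : be^* = be. Proof. exact: conj_map_horner. Qed.

Let TT : T ^+ n * T^* ^+ n = P2 s ^+ n. Proof. by rewrite -exprMn TP. Qed.
Let SS : (S ^+ n) ^+ 2 = P1 s ^+ n. Proof. by rewrite -exprM mulnC exprM SP. Qed.
Let D : al * (S ^+ n) ^+ 2 + be * (T ^+ n * T^* ^+ n) = 1.
Proof. by rewrite TT SS; exact: bezout_at. Qed.
Let eE : te a b iota s = 1 + al * be. Proof. by []. Qed.
Let gE : tg b n iota s = (S ^+ n) ^+ 2 - be ^+ 2 * (T ^+ n * T^* ^+ n).
Proof. by rewrite TT SS. Qed.
Let hE : th a n iota s = al ^+ 2 * (S ^+ n) ^+ 2 - (T ^+ n * T^* ^+ n).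
Proof. by rewrite TT SS. Qed.

(** The frame trivialises the real fibre over [w = S T]; the proof homogenises with
    the help of the Bezout relation. *)
Lemma frame_real c : fibre_eqs a b n x y s (frame_u c c^*) (frame_v c c^*).
Proof.
rewrite /fibre_eqs /glue_u /glue_v eE gE hE wE wE' /frame_u /frame_v.
rewrite rmorphB rmorphD !rmorphM !rmorphXn /= !conjCK alr ber Sr !exprMn.
move: D; move: (S ^+ n) (T ^+ n) (T^* ^+ n) => p q q' E.
split.
  transitivity ((al * p ^+ 2 + be * (q * q')) * (p * c^* - be * q' * c)); first by rewrite E mul1r.
  by ring.
transitivity ((al * p ^+ 2 + be * (q * q')) * (q * c^* + al * p * c)); first by rewrite E mul1r.
by ring.
Qed.

(** The first row of the inverse of the frame, which has determinant one, recovers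
    the coordinate [c]. *)
Lemma coframe_real u v (c := al * S ^+ n * u + be * T ^+ n * v) :
  fibre_eqs a b n x y s u v -> u = frame_u c c^* /\ v = frame_v c c^*.
Proof.
rewrite /fibre_eqs /glue_u /glue_v eE gE hE wE wE' !exprMn => -[eu ev].
have cE : c^* = - (T^* ^+ n) * u + S ^+ n * v.
  rewrite /c rmorphD !rmorphM !rmorphXn /= alr ber Sr eu ev.
  move: D; move: (S ^+ n) (T ^+ n) (T^* ^+ n) => p q q' E.
  transitivity ((al * p ^+ 2 + be * (q * q')) * (- q' * u + p * v)); last by rewrite E mul1r.
  by ring.
rewrite /frame_u /frame_v cE /c.
move: D; move: (S ^+ n) (T ^+ n) (T^* ^+ n) => p q q' E.
split.
  transitivity ((al * p ^+ 2 + be * (q * q')) * u); first by rewrite E mul1r.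
  by ring.
transitivity ((al * p ^+ 2 + be * (q * q')) * v); first by rewrite E mul1r.
by ring.
Qed.

End Frame.
End RealStructure.

(** * The derivative of an automorphism along the fibres *)

Section FibreDerivative.
Variables (K : fieldType) (k : nat) (L : numClosedFieldType) (iota : {rmorphism K -> L}).
Hypothesis iota_real : forall c, (iota c)^* = iota c.
Notation N := (5 + k.+1)%N.
Notation X := (sphere_torus_plane L k).
Notation onX := (on_points idfun X).
Variables Phi Psi : N.-tuple {mpoly L[N]}.
Hypotheses (PhiX : forall z, onX z -> onX (act Phi z))
  (PsiX : forall z, onX z -> onX (act Psi z))
  (PsiPhi : forall z, onX z -> act Psi (act Phi z) =1 z)
  (PhiPsi : forall z, onX z -> act Phi (act Psi z) =1 z).
Variables (a b a' b' : {poly K}) (n m : nat).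
Hypothesis Phi_real : forall z, onX z -> real_pt iota a b n z -> real_pt iota a' b' m (act Phi z).

Variable z0 : 'I_N -> L.
Hypotheses (Xz0 : onX z0) (z0u : z0 (iu k) = 0) (z0v : z0 (iv k) = 0).

Definition fibre_dir (u v : L) : 'I_N -> L := pt 0 0 0 u v (fun=> 0).
Definition fibre_curve u v : 'I_N -> {poly L} := fun i => (z0 i)%:P + fibre_dir u v i *: 'X.

Lemma fibre_curve_horner u v t : (fun i => (fibre_curve u v i).[t]) =1
  pt (z0 (ix k)) (z0 (iy k)) (z0 (it k)) (t * u) (t * v) (fun l => z0 (is_ l)).
Proof.
move=> i; rewrite /fibre_curve hornerD hornerC hornerZ hornerX /fibre_dir.
by case: (ix_cases i) => [->|->|->|[->|->|[l ->]]]; rewrite !ptE ?z0u ?z0v ?mul0r ?addr0 ?add0r // mulrC.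
Qed.

Lemma fibre_curve_onX u v t : onX (fun i => (fibre_curve u v i).[t]).
Proof.
have [e1 e2] := (on_X _ _).1 Xz0; rewrite (funext (fibre_curve_horner u v t)).
by apply/on_X; rewrite !ptE; split=> //; under eq_bigr do rewrite ptE.
Qed.

Lemma fibre_curve_zero_section u v t : zero_section (fun i => (fibre_curve u v i).[t]) =1 z0.
Proof.
move=> i; rewrite (funext (fibre_curve_horner u v t)) /zero_section.
by case: (ix_cases i) => [->|->|->|[->|->|[l ->]]]; rewrite ?eqxx ?orbT ?ptE.
Qed.

Definition fibre_diff i u v : L :=
  (tnth Phi i)^`M(iu k).@[z0] * u + (tnth Phi i)^`M(iv k).@[z0] * v.

Lemma fibre_diffE i u v : fibre_diff i u v = (along (fibre_curve u v) (tnth Phi i))`_1.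
Proof.
have c0 j : (fibre_curve u v j)`_0 = z0 j.
  by rewrite coefD coefC coefZ coefX mulr0 addr0.
have c1 j : (fibre_curve u v j)`_1 = fibre_dir u v j.
  by rewrite coefD coefC coefZ coefX mulr1 add0r.
rewrite along_coef1 (funext c0) (bigD1 (iu k)) //= (bigD1 (iv k)) //= !c1 /fibre_dir !ptE.
rewrite big1 ?addr0 // => j /andP[ju jv]; rewrite c1 /fibre_dir.
move: ju jv; case: (ix_cases j) => [->|->|->|[->|->|[l ->]]]; rewrite ?eqxx // ptE mulr0 //.
Qed.

Lemma act_base u v t i : i != iu k -> i != iv k ->
  act Phi (fun i => (fibre_curve u v i).[t]) i = act Phi z0 i.
Proof.
move=> iu0 iv0; rewrite (base_comp_zero_section PhiX PsiX PhiPsi (fibre_curve_onX u v t) iu0 iv0).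
by apply: meval_eq; exact: fibre_curve_zero_section.
Qed.

(** An identity between a polynomial and its conjugate at all natural numbers may be
    differentiated at zero. *)
Lemma conj_coef1 (P Q V : {poly L}) (al be : L) :
  (forall j : nat, (P.[j%:R])^* = al * Q.[j%:R] + be * V.[j%:R]) ->
  (P`_1)^* = al * Q`_1 + be * V`_1.
Proof.
move=> H; have E : map_poly Num.conj P = al *: Q + be *: V.
  apply: poly_eq_nat => j; rewrite hornerD !hornerZ -H -[in LHS](rmorph_nat (Num.conj : {rmorphism L -> L})).
  by rewrite horner_map.
by rewrite -coef_map E coefD !coefZ.
Qed.

Lemma glue_u_lin n0 (c d : {poly K}) (x y s u v : L) : glue_u c d n0 iota x y s 'i u v =
  - (te c d iota s * (x - 'i * y) ^+ n0) * u + tg d n0 iota s * v.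
Proof. by rewrite /glue_u mulNr. Qed.

Lemma glue_v_lin n0 (c d : {poly K}) (x y s u v : L) : glue_v c d n0 iota x y s 'i u v =
  th c n0 iota s * u + (te c d iota s * (x + 'i * y) ^+ n0) * v.
Proof. by []. Qed.

Notation eqs_at c d n0 z := (fibre_eqs iota c d n0 (z (ix k)) (z (iy k)) (z (is_ ord0))).

(** The conditions defining the real fibres are linear, and so pass from [Phi] to its
    derivative. *)
Lemma fibre_diff_real u v : (forall i, i != iu k -> i != iv k -> (z0 i)^* = z0 i) ->
  eqs_at a b n z0 u v -> eqs_at a' b' m (act Phi z0) (fibre_diff (iu k) u v) (fibre_diff (iv k) u v).
Proof.
move=> z0r [eu ev]; have [[xu xv yu yv] [tu tv su]] := base_index k.
have [su0 sv0] := su ord0.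
have R (j : nat) : real_pt iota a b n (fun i => (fibre_curve u v i).[j%:R]).
  rewrite (funext (fibre_curve_horner u v j%:R)); split=> [i|].
    case: (ix_cases i) => [->|->|->|[->|->|[l ->]]]; rewrite ?eqxx // => _ _; rewrite ptE z0r //.
  rewrite !ptE; split; rewrite rmorphM rmorph_nat /= ?eu ?ev ?glue_u_lin ?glue_v_lin; ring.
have H j := Phi_real (fibre_curve_onX u v j%:R) (R j).
split; rewrite ?glue_u_lin ?glue_v_lin !fibre_diffE; apply: conj_coef1 => j; rewrite !along_horner;
  have [_ [hu hv]] := H j; rewrite (act_base _ _ _ xu xv) (act_base _ _ _ yu yv) (act_base _ _ _ su0 sv0) in hu hv.
- by rewrite -glue_u_lin; exact: hu.
- by rewrite -glue_v_lin; exact: hv.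
Qed.

(** The chain rule for the inverse map along the image of a line of the fibre. *)
Lemma fibre_diff_inj u v : fibre_diff (iu k) u v = 0 -> fibre_diff (iv k) u v = 0 -> u = 0 /\ v = 0.
Proof.
move=> du dv; pose c i := along (fibre_curve u v) (tnth Phi i).
have cE t : (fun i => (c i).[t]) = act Phi (fun i => (fibre_curve u v i).[t]).
  by apply/funext => i; rewrite /c along_horner.
have c1 i : (c i)`_1 = 0.
  have [->|iu0] := eqVneq i (iu k); first by rewrite -fibre_diffE.
  have [->|iv0] := eqVneq i (iv k); first by rewrite -fibre_diffE.
  have -> : c i = (act Phi z0 i)%:P; last by rewrite coefC.
  apply: poly_eq_inf => t _; rewrite hornerC -(act_base u v t iu0 iv0) -cE //.
have key i : (fibre_curve u v i)`_1 = 0.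
  have <- : along c (tnth Psi i) = fibre_curve u v i.
    apply: poly_eq_inf => t _; rewrite along_horner cE.
    by rewrite -[LHS]/(act Psi _ i) PsiPhi //; exact: fibre_curve_onX.
  by rewrite along_coef1 big1 // => j _; rewrite c1 mulr0.
have q i : fibre_dir u v i = 0.
  by rewrite -(key i) coefD coefC coefZ coefX mulr1 add0r.
by have := q (iu k); have := q (iv k); rewrite /fibre_dir !ptE.
Qed.

End FibreDerivative.

(** * Comparison of two real structures over the sphere *)

Section TestPoints.
Variables (k : nat) (L : numClosedFieldType).
Notation N := (5 + k.+1)%N.
Notation X := (sphere_torus_plane L k).
Notation onX := (on_points idfun X).

(** The point of the base with [w = S T] when [S] is real; unlike [cpt], it makes sense
    for [w = 0]. *)
Definition base_pt (S T s : L) : 'I_N -> L :=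
  pt ((S * T + S * T^*) / 2%:R) ((S * T - S * T^*) / (2%:R * 'i)) s^-1 0 0 (ones s).

Let i0 : ('i : L) != 0. Proof. exact: neq0Ci. Qed.

Lemma prod_ones (s : L) : \prod_l ones (k := k) s l = s.
Proof.
rewrite (bigD1 ord0) //= ones0 big1 ?mulr1 // => l l0.
by rewrite /ones /upd (negPf l0).
Qed.

Lemma base_pt_w S T s : base_pt S T s (ix k) + 'i * base_pt S T s (iy k) = S * T.
Proof. by rewrite /base_pt !ptE; field. Qed.

Lemma base_pt_wbar S T s : base_pt S T s (ix k) - 'i * base_pt S T s (iy k) = S * T^*.
Proof. by rewrite /base_pt !ptE; field. Qed.

Section Hyps.
Variables (S T s : L).
Hypotheses (Sr : S^* = S) (sr : s^* = s) (s0 : s != 0) (SP : S ^+ 2 = P1 s) (TP : T * T^* = P2 s).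

Lemma base_pt_P12 : (S * T) * (S * T^*) = P12 s.
Proof. by rewrite /P12 -SP -TP; ring. Qed.

Lemma base_pt_onX : onX (base_pt S T s).
Proof.
apply/on_X; rewrite -/(P12 _); split.
  rewrite {3}/base_pt ptE ones0 -base_pt_P12 -(base_pt_w S T s) -(base_pt_wbar S T s).
  set x := base_pt _ _ _ _; set y := base_pt _ _ _ _.
  by transitivity (x ^+ 2 - 'i ^+ 2 * y ^+ 2); [rewrite sqrCi; ring | ring].
rewrite /base_pt ptE; under eq_bigr do rewrite ptE.
by rewrite prod_ones mulVf.
Qed.

Lemma base_pt_cpt : S * T != 0 -> base_pt S T s =1 cpt (S * T) 0 0 (ones s).
Proof.
move=> w0 i; rewrite /base_pt /cpt ones0 -/(P12 s) prod_ones.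
have -> : P12 s * (S * T)^-1 = S * T^* by rewrite -base_pt_P12 mulrAC mulfV ?mul1r.
by [].
Qed.

Lemma base_pt_root : S * T = 0 -> P12 s = 0 /\ base_pt S T s =1 root_point 0 0 (ones s).
Proof.
move=> w0; split; first by rewrite -base_pt_P12 w0 mul0r.
have w0' : S * T^* = 0 by rewrite -Sr -rmorphM w0 rmorph0.
by move=> i; rewrite /base_pt /root_point w0 w0' prod_ones subrr addr0 !mul0r.
Qed.

Lemma base_pt_real i : (base_pt S T s i)^* = base_pt S T s i.
Proof.
rewrite /base_pt; case: (ix_cases i) => [->|->|->|[->|->|[l ->]]]; rewrite ptE ?rmorph0 //.
- by rewrite rmorphM rmorphD fmorphV rmorph_nat !rmorphM /= conjCK Sr addrC.
- rewrite rmorphM rmorphB fmorphV !rmorphM rmorph_nat /= conjCK conjCi Sr; field.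
  by [].
- by rewrite fmorphV /= sr.
- by rewrite /ones /upd; case: ifP => _; rewrite ?rmorphM rmorph1 //= sr.
Qed.

End Hyps.
End TestPoints.

Section Comparison.
Variables (K : fieldType) (k : nat) (L : numClosedFieldType) (iota : {rmorphism K -> L}).
Hypothesis iota_real : forall c, (iota c)^* = iota c.
Notation N := (5 + k.+1)%N.
Notation X := (sphere_torus_plane L k).
Notation onX := (on_points idfun X).
Variables Phi Psi : N.-tuple {mpoly L[N]}.
Hypotheses (PhiX : forall z, onX z -> onX (act Phi z))
  (PsiX : forall z, onX z -> onX (act Psi z))
  (PsiPhi : forall z, onX z -> act Psi (act Phi z) =1 z)
  (PhiPsi : forall z, onX z -> act Phi (act Psi z) =1 z).
Variables (a b a' b' : {poly K}) (n m : nat).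
Hypotheses (bez : a * P1 'X ^+ n + b * P2 'X ^+ n = 1).
Hypotheses (bez' : a' * P1 'X ^+ m + b' * P2 'X ^+ m = 1).
Hypothesis Phi_real : forall z, onX z -> real_pt iota a b n z -> real_pt iota a' b' m (act Phi z).

Let i0 : ('i : L) != 0. Proof. exact: neq0Ci. Qed.

Lemma base_pt_real_pt S T s : S^* = S -> s^* = s -> s != 0 -> S ^+ 2 = P1 s -> T * T^* = P2 s ->
  real_pt iota a b n (base_pt (k := k) S T s).
Proof.
move=> Sr sr s0 SP TP; split=> [i _ _|]; first exact: base_pt_real.
have := frame_real iota_real bez Sr sr (base_pt_w k S T s) (base_pt_wbar k S T s) SP TP 0.
rewrite /frame_u /frame_v rmorph0 !mulr0 addr0 subr0.
by rewrite /base_pt !ptE ones0.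
Qed.

Lemma base_pt_s S T s : S^* = S -> s^* = s -> s != 0 -> S ^+ 2 = P1 s -> T * T^* = P2 s ->
  act Phi (base_pt (k := k) S T s) (is_ ord0) = s.
Proof.
move=> Sr sr s0 SP TP; have E := s0_fixed PhiX PsiX PhiPsi (w_comp_dichotomy PhiX PsiX PsiPhi PhiPsi) s0.
have o0 := ones_neq0 (k := k) s0.
have [w0|w0] := eqVneq (S * T) 0.
  have [P0 eqb] := base_pt_root k Sr SP TP w0.
  rewrite /act (meval_eq _ eqb) (s_comp_root PhiX) //; last by rewrite ones0.
rewrite /act (meval_eq _ (base_pt_cpt (k := k) SP TP w0)) (s_comp PhiX) //.
Qed.

(** The function [f] is [w o Phi] or [wbar o Phi], whichever has degree one in [w]; it
    vanishes at the points with [w = 0]. *)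
Lemma rotation_of_w : exists (f : {mpoly L[N]}) (eps : bool),
  (forall z, f.@[z] = act Phi z (ix k) + (-1) ^+ (~~ eps) * ('i * act Phi z (iy k))) /\
  forall S T s, S^* = S -> s^* = s -> s != 0 -> S ^+ 2 = P1 s -> T * T^* = P2 s ->
    f.@[base_pt (k := k) S T s] = S * (f.@[cpt 1 0 0 (ones s)] * T).
Proof.
have [e [He ee]] := w_comp_dichotomy PhiX PsiX PsiPhi PhiPsi.
have n1 : (1 : L) != 0 by exact: oner_neq0.
have [f [eps [fE ff]]] : exists (f : {mpoly L[N]}) (eps : bool),
  (forall z, f.@[z] = act Phi z (ix k) + (-1) ^+ (~~ eps) * ('i * act Phi z (iy k))) /\
  (forall t s, t != 0 -> (forall l, s l != 0) -> f.@[cpt t 0 0 s] = t * f.@[cpt 1 0 0 s]).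
  case: ee => ee; rewrite ee in He.
    exists (w_comp Phi), true; split=> [z|t s t0 s0].
      by rewrite w_compE expr0 mul1r.
    by have [] := He t 1 s t0 n1 s0; rewrite mulr1.
  exists (wbar_comp Phi), false; split=> [z|t s t0 s0].
    by rewrite wbar_compE expr1 mulN1r.
  by have [] := He t 1 s t0 n1 s0; rewrite mulr1 opprK.
exists f, eps; split=> // S T s Sr sr s0 SP TP; have o0 := ones_neq0 (k := k) s0.
have [w0|w0] := eqVneq (S * T) 0.
  have [P0 eqb] := base_pt_root k Sr SP TP w0.
  rewrite (meval_eq _ eqb) [RHS]mulrCA w0 mulr0.
  have P0' : P12 (ones (k := k) s ord0) = 0 by rewrite ones0.
  have [|_ H _] := @root_point_limit k L f 1 0 0 (ones s) P0'; last exact: H.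
  by move=> t t0; rewrite expr1z ff.
by rewrite (meval_eq _ (base_pt_cpt (k := k) SP TP w0)) ff // mulrAC mulrA.
Qed.

Section AtPoint.
Variables (S T T' s : L).
Hypotheses (Sr : S^* = S) (sr : s^* = s) (s0 : s != 0) (SP : S ^+ 2 = P1 s) (TP : T * T^* = P2 s)
  (TP' : T' * T'^* = P2 s).
Let z0 := base_pt (k := k) S T s.
Let z1 := act Phi z0.
Hypothesis wE : z1 (ix k) + 'i * z1 (iy k) = S * T'.

(** The coefficients [A] and [B] of the derivative of [Phi] in the two frames: the
    images of the columns of the first frame, read in the second one. *)
Definition lin_coef : L :=
  (map_poly iota a').[s] * S ^+ m * fibre_diff Phi z0 (iu k) (S ^+ n) (T^* ^+ n) +
  (map_poly iota b').[s] * T' ^+ m * fibre_diff Phi z0 (iv k) (S ^+ n) (T^* ^+ n).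
Definition anti_coef : L :=
  let u := - (map_poly iota b).[s] * T ^+ n in let v := (map_poly iota a).[s] * S ^+ n in
  (map_poly iota a').[s] * S ^+ m * fibre_diff Phi z0 (iu k) u v +
  (map_poly iota b').[s] * T' ^+ m * fibre_diff Phi z0 (iv k) u v.

(** Over the root [s_0 = 1] only one of the four partial derivatives counts in each
    coefficient. *)
Lemma coef_at_root : S = 0 -> (0 < n)%N -> (0 < m)%N ->
  lin_coef = (map_poly iota b').[s] * T' ^+ m *
    ((tnth Phi (iv k))^`M(iv k).@[base_pt 0 0 s] * T^* ^+ n) /\
  anti_coef = (map_poly iota b').[s] * T' ^+ m *
    ((tnth Phi (iv k))^`M(iu k).@[base_pt 0 0 s] * (- (map_poly iota b).[s] * T ^+ n)).
Proof.
move=> S0 n0 m0; have nn j : (0 < j)%N -> S ^+ j = 0 by move=> j0; rewrite S0 expr0n eqn0Ngt j0.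
have -> : base_pt (k := k) 0 0 s = z0 by rewrite /z0 S0 /base_pt !mul0r.
rewrite /lin_coef /anti_coef /fibre_diff (nn m m0) (nn n n0); move: z0 => z.
by move: (_.@[z]) (_.@[z]) (_.@[z]) (_.@[z]) => d1 d2 d3 d4; split; ring.
Qed.

(** For every [z], the number [z B - zbar Abar] is a solution; those for [z = 1] and
    [z = i] both vanish only if [A = B = 0]. *)
Lemma antilinear_kernel (A B : L) : A * A^* = B * B^* ->
  exists2 c, c != 0 & A * c + B * c^* = 0.
Proof.
move=> AB.
have K0 z : A * (z * B - z^* * A^*) + B * (z * B - z^* * A^*)^* = 0.
  rewrite rmorphB !rmorphM /= !conjCK.
  transitivity (z^* * (B * B^* - A * A^*)); first by ring.
  by rewrite AB subrr mulr0.
have [h1|h1] := eqVneq (B - A^*) 0; last first.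
  by exists (B - A^*) => //; have := K0 1; rewrite rmorph1 !mul1r.
have [h2|h2] := eqVneq (B + A^*) 0; last first.
  exists ('i * (B + A^*)); first by rewrite mulf_neq0.
  by rewrite -[RHS](K0 'i) conjCi; congr (_ * _ + _ * _^*); ring.
have two0 : (2%:R : L) != 0 by rewrite pnatr_eq0.
have B0 : B = 0.
  by apply: (mulfI two0); rewrite mulr0; transitivity ((B - A^*) + (B + A^*));
    [ring | rewrite h1 h2 addr0].
have A0 : A = 0.
  by apply: (can_inj (@conjCK L)); move/eqP: h2; rewrite B0 add0r rmorph0 => /eqP.
by exists 1; rewrite ?oner_neq0 // A0 B0 !mul0r addr0.
Qed.

Lemma lin_anti_moduli : lin_coef * lin_coef^* != anti_coef * anti_coef^*.
Proof.
apply/eqP => /antilinear_kernel[c c0 kc].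
have Xz0 : onX z0 by exact: base_pt_onX.
have z0u : z0 (iu k) = 0 by rewrite /z0 /base_pt ptE.
have z0v : z0 (iv k) = 0 by rewrite /z0 /base_pt ptE.
have z0r i : (z0 i)^* = z0 i by exact: base_pt_real.
have z0s : z0 (is_ ord0) = s by rewrite /z0 /base_pt ptE ones0.
have z1s : z1 (is_ ord0) = s by exact: base_pt_s.
have [z1r _] := Phi_real Xz0 (base_pt_real_pt Sr sr s0 SP TP).
have [[xu xv yu yv] _] := base_index k.
have wE' : z1 (ix k) - 'i * z1 (iy k) = S * T'^*.
  by rewrite -{1}Sr -rmorphM -wE rmorphD rmorphM /= conjCi !z1r // mulNr.
have := frame_real iota_real bez Sr sr (base_pt_w k S T s) (base_pt_wbar k S T s) SP TP c.
rewrite -/z0; set u := frame_u _ _ _ _ _ _ _ _; set v := frame_v _ _ _ _ _ _ _ _.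
rewrite -{1}z0s => fe.
have := fibre_diff_real PhiX PsiX PhiPsi Phi_real Xz0 z0u z0v (fun i _ _ => z0r i) fe.
rewrite -/z1 z1s => fe'.
have [eu ev] := coframe_real iota_real bez' Sr sr wE wE' SP TP' fe'.
have C0 : (map_poly iota a').[s] * S ^+ m * fibre_diff Phi z0 (iu k) u v +
    (map_poly iota b').[s] * T' ^+ m * fibre_diff Phi z0 (iv k) u v = 0.
  rewrite -[RHS]kc /lin_coef /anti_coef /fibre_diff /u /v /frame_u /frame_v; ring.
rewrite C0 rmorph0 /frame_u /frame_v !mulr0 subr0 ?addr0 in eu ev.
have [u0 v0] := fibre_diff_inj PhiX PsiX PsiPhi PhiPsi Xz0 z0u z0v eu ev.
have [_ _] := (u0, v0).
have : (map_poly iota a).[s] * S ^+ n * u + (map_poly iota b).[s] * T ^+ n * v = c.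
  rewrite /u /v /frame_u /frame_v.
  transitivity (((map_poly iota a).[s] * (S ^+ n) ^+ 2 + (map_poly iota b).[s] * (T ^+ n * T^* ^+ n)) * c).
    by ring.
  by rewrite -exprMn TP -exprM mulnC exprM SP (bezout_at iota bez) mul1r.
by rewrite u0 v0 !mulr0 addr0 => /esym/eqP; rewrite (negPf c0).
Qed.

End AtPoint.
End Comparison.

(** * Continuity of complex functions *)

Section ComplexContinuity.
Variable R : realType.
Notation C := (R[i]).
Notation rc := (real_complex R).
Implicit Types (F G : R * R -> C) (p : R * R).

Definition ccont F p : Prop :=
  cont_at (fun q => complex.Re (F q)) p /\ cont_at (fun q => complex.Im (F q)) p.

Lemma eq_ccont F G p : F =1 G -> ccont F p -> ccont G p.
Proof. by move=> /funext ->. Qed.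

Lemma ccont_cst c p : ccont (fun=> c) p.
Proof. by split; exact: cont_at_cst. Qed.

Lemma ccontD F G p : ccont F p -> ccont G p -> ccont (fun q => F q + G q) p.
Proof.
move=> [F1 F2] [G1 G2]; split.
  rewrite (_ : (fun q => _) = (fun q => complex.Re (F q) + complex.Re (G q))).
    exact: cont_atD.
  by apply/funext => q; case: (F q) (G q) => [? ?] [].
rewrite (_ : (fun q => _) = (fun q => complex.Im (F q) + complex.Im (G q))).
  exact: cont_atD.
by apply/funext => q; case: (F q) (G q) => [? ?] [].
Qed.

Lemma ccontM F G p : ccont F p -> ccont G p -> ccont (fun q => F q * G q) p.
Proof.
move=> [F1 F2] [G1 G2]; split.
  rewrite (_ : (fun q => _) = (fun q => complex.Re (F q) * complex.Re (G q) +
      - (complex.Im (F q) * complex.Im (G q)))).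
    by apply: cont_atD; [|apply: cont_atN]; apply: cont_atM.
  by apply/funext => q; case: (F q) (G q) => [? ?] [].
rewrite (_ : (fun q => _) = (fun q => complex.Re (F q) * complex.Im (G q) +
    complex.Im (F q) * complex.Re (G q))).
  by apply: cont_atD; apply: cont_atM.
by apply/funext => q; case: (F q) (G q) => [? ?] [].
Qed.

Lemma ccontN F p : ccont F p -> ccont (fun q => - F q) p.
Proof.
move=> cF; apply: (@eq_ccont (fun q => -1 * F q)) => [q|]; first by rewrite mulN1r.
by apply: ccontM => //; exact: ccont_cst.
Qed.

Lemma ccontX F n p : ccont F p -> ccont (fun q => F q ^+ n) p.
Proof.
move=> cF; elim: n => [|n IH]; first exact: ccont_cst.
by apply: (@eq_ccont (fun q => F q * F q ^+ n)) => [q|]; [rewrite exprS|exact: ccontM].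
Qed.

Lemma ccont_conj F p : ccont F p -> ccont (fun q => (F q)^*) p.
Proof.
move=> [F1 F2]; split.
  by rewrite (_ : (fun q => _) = (fun q => complex.Re (F q))) //; apply/funext => q; case: (F q).
rewrite (_ : (fun q => _) = (fun q => - complex.Im (F q))); first exact: cont_atN.
by apply/funext => q; case: (F q).
Qed.

Lemma ccont_real (f : R * R -> R) p : cont_at f p -> ccont (fun q => rc (f q)) p.
Proof. by move=> cf; split=> //; exact: cont_at_cst. Qed.

Lemma ccont_meval n (f : {mpoly C[n]}) (v : R * R -> 'I_n -> C) p :
  (forall i, ccont (fun q => v q i) p) -> ccont (fun q => f.@[v q]) p.
Proof.
move=> cv; elim/mpoly_ring_ind: f => [c|i|f g IHf IHg|f g IHf IHg].
- by apply: (@eq_ccont (fun=> c)) => [q|]; [rewrite mevalC | exact: ccont_cst].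
- by apply: eq_ccont (cv i) => q; rewrite mevalXU.
- by apply: eq_ccont (ccontD IHf IHg) => q; rewrite mevalD.
- by apply: eq_ccont (ccontM IHf IHg) => q; rewrite mevalM.
Qed.

Lemma ccont_horner (f : {poly C}) F p : ccont F p -> ccont (fun q => f.[F q]) p.
Proof.
move=> cF; elim/poly_ind: f => [|f c IH].
  by apply: (@eq_ccont (fun=> 0)) => [q|]; [rewrite horner0 | exact: ccont_cst].
apply: (@eq_ccont (fun q => f.[F q] * F q + c)) => [q|]; first by rewrite hornerMXaddC.
by apply: ccontD; [exact: ccontM | exact: ccont_cst].
Qed.

Definition expi (t : R) : C := Complex (cos t) (sin t).

Lemma expiD s t : expi (s + t) = expi s * expi t.
Proof. by rewrite /expi cosD sinD; congr Complex; ring. Qed.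

Lemma expiN t : expi (- t) = (expi t)^*.
Proof. by rewrite /expi cosN sinN. Qed.

Lemma expi0 : expi 0 = 1.
Proof. by rewrite /expi cos0 sin0. Qed.

Lemma expi_exp t n : expi t ^+ n = expi (n%:R * t).
Proof.
elim: n => [|n IH]; first by rewrite mul0r expi0.
by rewrite exprS IH -expiD; congr expi; rewrite -[n.+1%:R]natr1; ring.
Qed.

Lemma expi_norm t : expi t * (expi t)^* = 1.
Proof. by rewrite -expiN -expiD subrr expi0. Qed.

Lemma expi_2pi : expi (pi *+ 2) = expi 0.
Proof. by rewrite /expi cos2pi sin2pi cos0 sin0. Qed.

Lemma ccont_expi p : ccont (fun q => expi q.2) p.
Proof. by split; [exact: cont_at_cos | exact: cont_at_sin]. Qed.

Lemma Re_mul_expi (z : C) t : complex.Re (z * expi t) = complex.Re z * cos t - complex.Im z * sin t.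
Proof. by case: z. Qed.
Lemma Im_mul_expi (z : C) t : complex.Im (z * expi t) = complex.Re z * sin t + complex.Im z * cos t.
Proof. by case: z. Qed.

Lemma mul_conj_real (z : C) : z * z^* = rc ((complex.Re z) ^+ 2 + (complex.Im z) ^+ 2).
Proof. by case: z => x y; rewrite !expr2; congr Complex; rewrite /=; ring. Qed.

Lemma conj_real (x : R) : (rc x)^* = rc x.
Proof. by congr Complex; rewrite oppr0. Qed.
End ComplexContinuity.

(** * The sphere as a family of circles *)

Section TestFamily.
Variables (R : realType) (k : nat).
Notation C := (R[i]).
Notation rc := (real_complex R).

(** The parameters of the test point over [s = q.1] with [w] of argument [q.2]. *)
Definition fam_S (q : R * R) : C := rc (Num.sqrt (P1 q.1)).
Definition fam_T (q : R * R) : C := rc (Num.sqrt (P2 q.1)) * expi q.2.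
Definition fam_s (q : R * R) : C := rc q.1.
Definition fam_pt q := base_pt (k := k) (fam_S q) (fam_T q) (fam_s q).

Lemma famP q : 1 <= q.1 <= 2%:R ->
  [/\ (fam_S q)^* = fam_S q, (fam_s q)^* = fam_s q, fam_s q != 0,
      fam_S q ^+ 2 = P1 (fam_s q) & fam_T q * (fam_T q)^* = P2 (fam_s q)].
Proof.
move=> /andP[s1 s2]; rewrite /fam_S /fam_T /fam_s !conj_real.
have p1 : 0 <= P1 q.1 by rewrite /P1 subr_ge0.
have p2 : 0 <= P2 q.1 by rewrite /P2 mulr_ge0 ?subr_ge0 // addr_ge0 // sqr_ge0.
split=> //.
- by rewrite fmorph_eq0 gt_eqF // (lt_le_trans _ s1).
- by rewrite -rmorphXn /= sqr_sqrtr // rmorph_P1.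
rewrite rmorphM /= conj_real mulrACA expi_norm mulr1 -rmorphM -expr2 /= sqr_sqrtr //.
by rewrite rmorph_P2.
Qed.

Lemma ccont_fam_s p : ccont fam_s p.
Proof. by apply: ccont_real; exact: cont_at_fst. Qed.

Lemma ccont_fam_S p : ccont fam_S p.
Proof.
apply: ccont_real; apply: cont_at_sqrt; apply: cont_atD; [exact: cont_at_fst|exact: cont_at_cst].
Qed.

Lemma ccont_fam_T p : ccont fam_T p.
Proof.
apply: ccontM; last exact: ccont_expi.
apply: ccont_real; apply: cont_at_sqrt; apply: cont_atM.
  by apply: cont_atD; [exact: cont_at_cst|apply: cont_atN; exact: cont_at_fst].
by apply: cont_atD; [apply: cont_atM; exact: cont_at_fst|exact: cont_at_cst].
Qed.

Lemma ccont_fam_inv p : p.1 != 0 -> ccont (fun q => (fam_s q)^-1) p.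
Proof.
move=> p0; apply: (@eq_ccont _ (fun q => rc (q.1^-1))) => [q|]; first by rewrite fmorphV.
by apply: ccont_real; apply: cont_at_inv => //; exact: cont_at_fst.
Qed.

Lemma ccont_ones p l : ccont (fun q => ones (k := k) (fam_s q) l) p.
Proof.
rewrite /ones /upd; case: (l == ord0); last exact: ccont_cst.
by apply: ccontM; [exact: ccont_fam_s|exact: ccont_cst].
Qed.

Lemma ccont_fam_pt p i : p.1 != 0 -> ccont (fun q => fam_pt q i) p.
Proof.
move=> p0; have cS := ccont_fam_S p; have cT := ccont_fam_T p.
have cST : ccont (fun q => fam_S q * fam_T q) p by exact: ccontM.
have cST' : ccont (fun q => fam_S q * (fam_T q)^*) p by apply: ccontM => //; exact: ccont_conj.
rewrite /fam_pt /base_pt; case: (ix_cases i) => [->|->|->|[->|->|[l ->]]].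
- apply: (eq_ccont (F := fun q => (fam_S q * fam_T q + fam_S q * (fam_T q)^*) / 2%:R)) => [q|].
    by rewrite ptE.
  by apply: ccontM; [exact: ccontD|exact: ccont_cst].
- apply: (eq_ccont (F := fun q => (fam_S q * fam_T q + - (fam_S q * (fam_T q)^*)) / (2%:R * 'i))) => [q|].
    by rewrite ptE.
  by apply: ccontM; [apply: ccontD => //; exact: ccontN|exact: ccont_cst].
- by apply: eq_ccont (ccont_fam_inv p0) => q; rewrite ptE.
- by apply: (eq_ccont (F := fun=> 0)) => [q|]; [rewrite ptE|exact: ccont_cst].
- by apply: (eq_ccont (F := fun=> 0)) => [q|]; [rewrite ptE|exact: ccont_cst].
- by apply: eq_ccont (ccont_ones p l) => q; rewrite ptE.
Qed.

Lemma ccont_unit_pt p i : p.1 != 0 -> ccont (fun q => cpt 1 0 0 (ones (k := k) (fam_s q)) i) p.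
Proof.
move=> p0; have cs := ccont_fam_s p.
have cP : ccont (fun q => P12 (fam_s q)) p.
  apply: ccontM; first by apply: ccontD => //; exact: ccont_cst.
  apply: ccontM; first by apply: ccontD; [exact: ccont_cst|exact: ccontN].
  by apply: ccontD; [exact: ccontX|exact: ccont_cst].
rewrite /cpt; case: (ix_cases i) => [->|->|->|[->|->|[l ->]]].
- apply: (eq_ccont (F := fun q => (1 + P12 (fam_s q)) * 2%:R^-1)) => [q|].
    by rewrite ptE ones0 divr1.
  by apply: ccontM; [apply: ccontD => //; exact: ccont_cst|exact: ccont_cst].
- apply: (eq_ccont (F := fun q => (1 + - P12 (fam_s q)) * (2%:R * 'i)^-1)) => [q|].
    by rewrite ptE ones0 divr1.
  by apply: ccontM; [apply: ccontD; [exact: ccont_cst|exact: ccontN]|exact: ccont_cst].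
- by apply: eq_ccont (ccont_fam_inv p0) => q; rewrite ptE prod_ones.
- by apply: (eq_ccont (F := fun=> 0)) => [q|]; [rewrite ptE|exact: ccont_cst].
- by apply: (eq_ccont (F := fun=> 0)) => [q|]; [rewrite ptE|exact: ccont_cst].
- by apply: eq_ccont (ccont_ones p l) => q; rewrite ptE.
Qed.

Lemma fam_period s : [/\ fam_S (s, pi *+ 2) = fam_S (s, 0), fam_T (s, pi *+ 2) = fam_T (s, 0) &
  fam_s (s, pi *+ 2) = fam_s (s, 0)].
Proof. by rewrite /fam_T /= expi_2pi. Qed.

Lemma fam_top t : fam_T (2%:R, t) = 0.
Proof. by rewrite /fam_T /P2 /= subrr mul0r sqrtr0 rmorph0 mul0r. Qed.

Lemma fam_bottom t : fam_S (1, t) = 0 /\ fam_T (1, t) = fam_T (1, 0) * expi t.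
Proof. by rewrite /fam_S /fam_T /P1 /= subrr sqrtr0 rmorph0 expi0 mulr1. Qed.

End TestFamily.

(** * The number of twists is an invariant *)

Section Degree.
Variables (R : realType) (k : nat).
Notation C := (R[i]).
Notation rc := (real_complex R).
Notation N := (5 + k.+1)%N.
Notation X := (sphere_torus_plane C k).
Notation onX := (on_points idfun X).
Variables Phi Psi : N.-tuple {mpoly C[N]}.
Hypotheses (PhiX : forall z, onX z -> onX (act Phi z))
  (PsiX : forall z, onX z -> onX (act Psi z))
  (PsiPhi : forall z, onX z -> act Psi (act Phi z) =1 z)
  (PhiPsi : forall z, onX z -> act Phi (act Psi z) =1 z).
Variables (a b a' b' : {poly R}) (n m : nat).
Hypotheses (bez : a * P1 'X ^+ n + b * P2 'X ^+ n = 1).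
Hypotheses (bez' : a' * P1 'X ^+ m + b' * P2 'X ^+ m = 1).
Hypothesis Phi_real : forall z, onX z -> real_pt rc a b n z -> real_pt rc a' b' m (act Phi z).
Hypotheses (n0 : (0 < n)%N) (m0 : (0 < m)%N).

Let rcr c : (rc c)^* = rc c. Proof. exact: conj_real. Qed.

Section Rotation.
Variables (f : {mpoly C[N]}) (eps : bool).
Hypothesis fE : forall z, f.@[z] = act Phi z (ix k) + (-1) ^+ (~~ eps) * ('i * act Phi z (iy k)).
Hypothesis fS : forall S T s, S^* = S -> s^* = s -> s != 0 -> S ^+ 2 = P1 s -> T * T^* = P2 s ->
    f.@[base_pt (k := k) S T s] = S * (f.@[cpt 1 0 0 (ones s)] * T).

Definition rot q : C := f.@[cpt 1 0 0 (ones (fam_s q))].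
Definition fam_T' q : C := if eps then rot q * fam_T q else (rot q * fam_T q)^*.

Let z1 q := act Phi (fam_pt (k := k) q).

Lemma rot_value q : 1 <= q.1 <= 2%:R ->
  z1 q (ix k) + (-1) ^+ (~~ eps) * ('i * z1 q (iy k)) = fam_S q * (rot q * fam_T q).
Proof. by move=> /famP[Sr sr s0 SP TP]; rewrite -fE fS. Qed.

Lemma z1_real q : 1 <= q.1 <= 2%:R ->
  (z1 q (ix k))^* = z1 q (ix k) /\ (z1 q (iy k))^* = z1 q (iy k).
Proof.
move=> /famP[Sr sr s0 SP TP]; have [[xu xv yu yv] _] := base_index k.
have [H _] := Phi_real (base_pt_onX (k := k) s0 SP TP) (base_pt_real_pt k rcr bez Sr sr s0 SP TP).
by split; apply: H.
Qed.

Lemma z1_w q : 1 <= q.1 <= 2%:R -> z1 q (ix k) + 'i * z1 q (iy k) = fam_S q * fam_T' q.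
Proof.
move=> sI; have [xr yr] := z1_real sI; have E := rot_value sI; have [Sr _ _ _ _] := famP sI.
rewrite /fam_T'; case: (eps) E => /= [<-|E]; first by rewrite expr0 mul1r.
rewrite -{1}Sr -rmorphM -E expr1 mulN1r rmorphB rmorphM /= conjCi xr yr.
by rewrite mulNr opprK.
Qed.

(** Compare the values of [w wbar = P1 P2] at a test point and at its image. *)
Lemma rot_norm s t : 1 < s < 2%:R -> rot (s, t) * (rot (s, t))^* = 1.
Proof.
move=> /andP[s1 s2]; have sI : 1 <= (s, t).1 <= 2%:R by rewrite /= !ltW.
have [xr yr] := z1_real sI; have E := rot_value sI; have [Sr sr s0 SP TP] := famP sI.
have [e1 _] := (on_X _ _).1 (PhiX (base_pt_onX (k := k) s0 SP TP)).
rewrite -/(P12 _) (base_pt_s PhiX PsiX PsiPhi PhiPsi Sr sr s0 SP TP) in e1.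
have P0 : P12 (fam_s (s, t)) != 0.
  rewrite /P12 /fam_s -rmorph_P1 -rmorph_P2 -rmorphM fmorph_eq0 mulf_neq0 //.
    by rewrite /P1 subr_eq0 gt_eqF.
  rewrite /P2 mulf_neq0 //; first by rewrite subr_eq0 gt_eqF.
  by rewrite gt_eqF // ltr_wpDl ?sqr_ge0 ?ltr01.
apply: (mulfI P0); rewrite mulr1 -[RHS]e1.
transitivity (fam_S (s, t) * (rot (s, t) * fam_T (s, t)) * (fam_S (s, t) * (rot (s, t) * fam_T (s, t)))^*).
  rewrite /P12 -SP -TP; move: (fam_S _) (fam_T _) (rot _) Sr => S1 T1 r1 Sr1.
  by rewrite !rmorphM /= Sr1; ring.
rewrite -E; set x := z1 _ _ in xr *; set y := z1 _ _ in yr *.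
rewrite rmorphD !rmorphM rmorphXn rmorphN1 /= conjCi xr yr.
transitivity (x ^+ 2 - (((-1) ^+ (~~ eps)) ^+ 2) * ('i ^+ 2 * y ^+ 2)); first by ring.
by rewrite sqrr_sign sqrCi; ring.
Qed.

Lemma ccont_rot p : p.1 != 0 -> ccont rot p.
Proof. by move=> p0; apply: ccont_meval => i; exact: ccont_unit_pt. Qed.

Lemma rot_norm1 t : rot (1, t) * (rot (1, t))^* = 1.
Proof.
rewrite mul_conj_real; set g := fun q : R * R => (complex.Re (rot q)) ^+ 2 + (complex.Im (rot q)) ^+ 2.
suff -> : complex.Re (rot (1, t)) ^+ 2 + complex.Im (rot (1, t)) ^+ 2 = 1 by [].
apply: (@edge_constant R g 1 2%:R t 1); first by rewrite ltr1n.
  have [c1 c2] := @ccont_rot (1, t) (oner_neq0 _).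
  by apply: cont_atD; exact: cont_atM.
move=> s sI; have := rot_norm t sI; rewrite mul_conj_real => /eqP.
by rewrite -subr_eq0 -[1](rmorph1 rc) -rmorphB fmorph_eq0 subr_eq0 => /eqP.
Qed.

(** At [s_0 = 2] both sides vanish; at [s_0 = 1] the modulus of the rotation is
    known by continuity only. *)
Lemma fam_T'_norm q : 1 <= q.1 <= 2%:R -> fam_T' q * (fam_T' q)^* = P2 (fam_s q).
Proof.
move=> sI; have [_ _ _ _ <-] := famP sI.
have -> : fam_T' q * (fam_T' q)^* = (rot q * (rot q)^*) * (fam_T q * (fam_T q)^*).
  by rewrite /fam_T'; move: (rot q) (fam_T q) => r1 T1; case: eps; rewrite ?conjCK !rmorphM /=; ring.
case: q sI => s t /= /andP[]; rewrite le_eqVlt => /orP[/eqP <- _|s1].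
  by rewrite rot_norm1 mul1r.
rewrite le_eqVlt => /orP[/eqP ->|s2]; first by rewrite fam_top mul0r mulr0.
by rewrite rot_norm ?mul1r // s1.
Qed.

Definition loopA q : C := lin_coef rc Phi a' b' n m (fam_S q) (fam_T q) (fam_T' q) (fam_s q).
Definition loopB q : C := anti_coef rc Phi a b a' b' n m (fam_S q) (fam_T q) (fam_T' q) (fam_s q).

Lemma loop_moduli q : 1 <= q.1 <= 2%:R -> loopA q * (loopA q)^* != loopB q * (loopB q)^*.
Proof.
move=> sI; have [Sr sr s0 SP TP] := famP sI.
apply: (lin_anti_moduli rcr PhiX PsiX PsiPhi PhiPsi bez bez' Phi_real Sr sr s0 SP TP).
  exact: fam_T'_norm.
exact: z1_w.
Qed.

Lemma ccont_fam_T' p : p.1 != 0 -> ccont fam_T' p.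
Proof.
move=> p0; have H : ccont (fun q => rot q * fam_T q) p.
  by apply: ccontM; [exact: ccont_rot|exact: ccont_fam_T].
by rewrite /fam_T'; case: eps => //; exact: ccont_conj.
Qed.

Lemma ccont_fibre_diff i (u v : R * R -> C) p : p.1 != 0 -> ccont u p -> ccont v p ->
  ccont (fun q => fibre_diff Phi (fam_pt (k := k) q) i (u q) (v q)) p.
Proof.
move=> p0 cu cv; apply: ccontD; apply: ccontM => //; apply: ccont_meval => j; exact: ccont_fam_pt.
Qed.

Lemma ccont_loops p : p.1 != 0 -> ccont loopA p /\ ccont loopB p.
Proof.
move=> p0; have cS := ccont_fam_S p; have cT := ccont_fam_T p; have cs := ccont_fam_s p.
have cT' := ccont_fam_T' p0.
have ch c : ccont (fun q => (map_poly rc c).[fam_s q]) p by exact: ccont_horner.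
have cX F j : ccont F p -> ccont (fun q => F q ^+ j) p by exact: ccontX.
have cu : ccont (fun q => - (map_poly rc b).[fam_s q] * fam_T q ^+ n) p.
  by apply: ccontM; [apply: ccontN; exact: ch|exact: cX cT].
have cv : ccont (fun q => (map_poly rc a).[fam_s q] * fam_S q ^+ n) p.
  by apply: ccontM; [exact: ch|exact: cX cS].
have cTc : ccont (fun q => (fam_T q)^* ^+ n) p by apply: cX; exact: ccont_conj.
have key (F1 F2 : R * R -> C) : ccont F1 p -> ccont F2 p -> ccont (fun q =>
    (map_poly rc a').[fam_s q] * fam_S q ^+ m * F1 q +
    (map_poly rc b').[fam_s q] * fam_T' q ^+ m * F2 q) p.
  move=> c1 c2; apply: ccontD; apply: ccontM => //.
    by apply: ccontM; [exact: ch | exact: cX cS].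
  by apply: ccontM; [exact: ch | exact: cX cT'].
have cSn : ccont (fun q => fam_S q ^+ n) p by exact: cX cS.
split; rewrite /loopA /loopB /lin_coef /anti_coef.
  exact: (key _ _ (ccont_fibre_diff _ p0 cSn cTc) (ccont_fibre_diff _ p0 cSn cTc)).
exact: (key _ _ (ccont_fibre_diff _ p0 cu cv) (ccont_fibre_diff _ p0 cu cv)).
Qed.

Lemma loop_at (q q' : R * R) : fam_S q = fam_S q' -> fam_T q = fam_T q' -> q.1 = q'.1 ->
  loopA q = loopA q' /\ loopB q = loopB q'.
Proof.
move=> eS eT e1; have es : fam_s q = fam_s q' by rewrite /fam_s e1.
have eT' : fam_T' q = fam_T' q' by rewrite /fam_T' /rot eT es.
by rewrite /loopA /loopB eS eT eT' es.
Qed.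

(** The number of turns of [fam_T' ^ m] along the circle [s_0 = 1]. *)
Definition turns : int := if eps then m%:Z else - m%:Z.

Lemma fam_T'_bottom t : fam_T' (1, t) = fam_T' (1, 0) * expi ((if eps then 1 else -1) * t).
Proof.
have [_ Tt] := @fam_bottom R t; have rr : rot (1, t) = rot (1, 0) by [].
rewrite /fam_T' rr Tt; move: (rot _) (fam_T _) => r1 T1; case: eps; first by rewrite mul1r mulrA.
by rewrite mulN1r expiN -rmorphM mulrA.
Qed.

Lemma loop_bottom t : loopA (1, t) = loopA (1, 0) * expi ((turns - n%:Z)%:~R * t) /\
  loopB (1, t) = loopB (1, 0) * expi ((turns + n%:Z)%:~R * t).
Proof.
have [S0 Tt] := @fam_bottom R t; have [S00 _] := @fam_bottom R 0.
have [At Bt] := @coef_at_root R k C rc Phi a b a' b' n m (fam_S (1, t)) (fam_T (1, t)) (fam_T' (1, t)) (fam_s (1, t)) S0 n0 m0.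
have [A0 B0] := @coef_at_root R k C rc Phi a b a' b' n m (fam_S (1, 0)) (fam_T (1, 0)) (fam_T' (1, 0)) (fam_s (1, 0)) S00 n0 m0.
rewrite /loopA /loopB At Bt A0 B0 Tt fam_T'_bottom.
have ss : fam_s (1, t) = fam_s (1, 0) by [].
rewrite ss; move: (_.@[_]) (_.@[_]) (_.[_]) (_.[_]) (fam_T _) (fam_T' _) => d1 d2 c1 c2 T1 T2.
have e1 : expi ((turns - n%:Z)%:~R * t) =
    expi ((if eps then 1 else -1) * t) ^+ m * (expi t)^* ^+ n.
  rewrite -expiN !expi_exp -expiD; congr expi; rewrite /turns intrD mulrNz.
  by case: eps; rewrite ?mulrNz; ring.
have e2 : expi ((turns + n%:Z)%:~R * t) =
    expi ((if eps then 1 else -1) * t) ^+ m * expi t ^+ n.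
  rewrite !expi_exp -expiD; congr expi; rewrite /turns intrD.
  by case: eps; rewrite ?mulrNz; ring.
rewrite e1 e2; move: (expi _) (expi t) => E1 E2; rewrite rmorphM /= !exprMn.
by split; ring.
Qed.

Lemma loop_period s : loopA (s, pi *+ 2) = loopA (s, 0) /\ loopB (s, pi *+ 2) = loopB (s, 0).
Proof. by have [eS eT _] := @fam_period R s; exact: loop_at. Qed.

Lemma loop_top t : loopA (2%:R, t) = loopA (2%:R, 0) /\ loopB (2%:R, t) = loopB (2%:R, 0).
Proof. by apply: loop_at => //; rewrite !fam_top. Qed.

Lemma degrees_equal : n = m.
Proof.
have s12 s : 1 <= s <= 2%:R -> s != 0 :> R by move=> /andP[s1 _]; rewrite gt_eqF // (lt_le_trans _ s1).
have [||||||kk|kk] := @two_loops R 1 2%:R (fun q => complex.Re (loopA q)) (fun q => complex.Im (loopA q))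
  (fun q => complex.Re (loopB q)) (fun q => complex.Im (loopB q)) (turns - n%:Z) (turns + n%:Z).
- by rewrite ler1n.
- by move=> s t sI; have [[? ?] [? ?]] := @ccont_loops (s, t) (s12 s sI).
- move=> s t sI; have := @loop_moduli (s, t) sI; rewrite !mul_conj_real.
  by apply: contra_neq => ->.
- by move=> s; have [-> ->] := loop_period s.
- by move=> t; have [-> ->] := loop_top t.
- move=> t; have [-> ->] := loop_bottom t.
  by rewrite !Re_mul_expi !Im_mul_expi.
- by move: kk; rewrite /turns; case: eps; lia.
- by move: kk; rewrite /turns; case: eps; lia.
Qed.
End Rotation.

Lemma degree_unique : n = m.
Proof.
by have [f [eps [fE fS]]] := rotation_of_w PhiX PsiX PsiPhi PhiPsi; exact: degrees_equal fE fS.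
Qed.
End Degree.

(** * The theorem *)

Section Forms.
Variables (R : realType) (k : nat).
Notation rc := (real_complex R).

Lemma plane_bundle_degree (a b a' b' : {poly R}) n m :
  a * P1 'X ^+ n + b * P2 'X ^+ n = 1 -> a' * P1 'X ^+ m + b' * P2 'X ^+ m = 1 ->
  (0 < n)%N -> (0 < m)%N ->
  isomorphic (plane_bundle a b n k) (plane_bundle a' b' m k) -> n = m.
Proof.
move=> bez bez' n0 m0 [F [G [FM GM GF FG]]].
apply: (@degree_unique R k (transport rc a b n F) (transport rc a' b' m G) _ _ _ _ a b a' b' n m) => //.
- by move=> z Xz; apply: (transport_onX rc bez FM Xz).
- by move=> z Xz; apply: (transport_onX rc bez' GM Xz).
- by move=> z Xz; apply: (transportK rc bez FM GF Xz).
- by move=> z Xz; apply: (transportK rc bez' GM FG Xz).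
- move=> z Xz zr; apply: (transport_real (@conj_real R) bez FM Xz zr).
Qed.

(** The factors [s - 1] and [P2] are coprime, as [P2(1) = 2]. *)
Lemma bezout_exists n : exists ab : {poly R} * {poly R},
  ab.1 * P1 'X ^+ n + ab.2 * P2 'X ^+ n = 1.
Proof.
have : coprimep (P1 ('X : {poly R}) ^+ n) (P2 'X ^+ n).
  apply/coprimep_expl/coprimep_expr.
  have -> : P1 ('X : {poly R}) = 'X - 1%:P by rewrite /P1 polyC1.
  rewrite coprimep_sym coprimep_XsubC /root; have -> : (P2 ('X : {poly R})).[1] = 2%:R.
    by rewrite -[LHS]/(horner_eval 1 _) rmorph_P2 /= /horner_eval hornerX /P2; ring.
  by rewrite pnatr_eq0.
by move/Bezout_eq1_coprimepP => [[a b] /= E]; exists (a, b).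
Qed.

Lemma X_geometrically_integral : is_integral (complexification (sphere_torus_plane R k)).
Proof. by rewrite complexification_X; exact: (@X_integral k R[i] R[i] idfun). Qed.

Lemma complexification_plane_bundle (a b : {poly R}) n :
  a * P1 'X ^+ n + b * P2 'X ^+ n = 1 ->
  isomorphic (complexification (sphere_torus_plane R k)) (complexification (plane_bundle a b n k)).
Proof. by move=> bez; rewrite complexification_X; exact: plane_bundle_isomorphic. Qed.

Lemma X_smooth_points (Y : affine_scheme R[i]) (v : 'I_(ambient Y) -> R[i]) :
  Y = sphere_torus_plane R[i] k -> (forall p, p \in equations Y -> p.@[v] = 0) ->
  (\rank (@jacobian _ Y v) + (4 + k) = ambient Y)%N.
Proof. by move=> YX; subst Y => Yv; exact: X_jacobian_rank. Qed.
End Forms.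

Theorem theorem2 (R : realType) (d : nat) (hd : (4 <= d)%N) :
  exists X : real_affine_variety R,
    [/\ is_smooth X, is_rational X, has_dimension X d
      & exists X' : nat -> real_affine_variety R,
          (forall i, real_form X (X' i)) /\
          (forall i j, i <> j -> ~ isomorphic (X' i) (X' j))].
Proof.
have [k ->] : exists k, d = (4 + k)%N by exists (d - 4)%N; rewrite subnKC.
exists (RealAffineVariety (@X_geometrically_integral R k)).
have [ab bez] := choice (fun i => bezout_exists R i.+1).
have formi i := complexification_plane_bundle k (bez i).
have dimX := X_dimension k (real_complex R).
split.
- exists (4 + k)%N => // v Xv; apply: X_smooth_points => //; exact: complexification_X.
- by exists (4 + k)%N; exact: (X_rational k (real_complex R)).
- exact: dimX.
exists (fun i => RealAffineVariety
  (isomorphic_integral (formi i) (@X_geometrically_integral R k))).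
split=> [i|i j ij iso]; first exact: formi.
by apply: ij; have [] := plane_bundle_degree (bez i) (bez j) isT isT iso.
Qed.
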